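(* The $\mathsf{dL}_{\mathrm{CHP}}$ proof calculus listed in the context is sound: every well-formed instance of each of its axioms (satisfying the stated side conditions) is valid, i.e. true in every state, and for every well-formed instance of each of its proof rules, validity of all premises implies validity of the conclusion.
   Context: **Variables.** $V=V_{\mathbb R}\cup V_{\mathbb N}\cup V_{\mathcal T}$ is a disjoint union of real, integer and trace variables; $\mu\in V_{\mathbb R}$ is a designated variable (global time). $\mathrm{Chan}$ is a set of channel names. Conventions: $x,t\in V_{\mathbb R}$, $h,h_0\in V_{\mathcal T}$, $ch\in\mathrm{Chan}$, $z\in V$. **Terms.** Real terms: $\eta::=x\mid c\mid\eta_1+\eta_2\mid\eta_1\cdot\eta_2\mid\mathrm{val}(te[ie])\mid\mathrm{time}(te[ie])$ ($c\in\mathbb Q$). Integer terms: $ie::=n\mid 0\mid 1\mid ie_1+ie_2\mid|te|$ ($n\in V_{\mathbb N}$). Channel terms: $ce::=ch\mid\mathrm{chan}(te[ie])$. Trace terms: $te::=h\mid\epsilon\mid\langle ch,\theta_1,\theta_2\rangle\mid te_1\cdot te_2\mid te\downarrow Y$ with $\theta_1,\theta_2\in\mathbb Q[V_{\mathbb R}]$ and $Y\subseteq\mathrm{Chan}$ finite. $\theta$ always denotes a polynomial in $\mathbb Q[V_{\mathbb R}]$. **Programs (CHPs).** $\alpha,\beta::=x:=\theta\mid x:=*\mid\{x'=\theta\,\&\,\chi\}\mid?\chi\mid\alpha;\beta\mid\alpha\cup\beta\mid\alpha^*\mid ch(h)!\theta\mid ch(h)?x\mid\alpha\parallel\beta$,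 where $\chi$ is a formula of first-order real arithmetic over $V_{\mathbb R}$; $h$ is the recorder variable of a communication; in $\alpha\parallel\beta$ it is required that $V(\alpha)\cap BV(\beta)=V(\beta)\cap BV(\alpha)\subseteq\{\mu\}\cup V_{\mathcal T}$, where $V(\cdot)=FV(\cdot)\cup BV(\cdot)$. In differential equations (and the corresponding assignments) $x$ may be a list of distinct variables with a list $\theta$ of right-hand sides; if $\mu$ is in the list its right-hand side must be $1$. $\{x'=\theta\}$ abbreviates $\{x'=\theta\,\&\,\mathrm{true}\}$. $\alpha^0\equiv{?\mathrm{true}}$, $\alpha^{n+1}\equiv\alpha;\alpha^n$. (All real variables can be read and written in programs. The variable $\mu$ is not meant to be written manually, and assignments to it are only meant to be used by axioms, but the syntax does not forbid such programs.) **Formulas.** $\varphi,\psi,A,C::=e_1=e_2$ (terms of equal sort) $\mid\eta_1\ge\eta_2\mid ie_1\ge ie_2\mid te_1\preceq te_2\mid\neg\varphi\mid\varphi\wedge\psi\mid\varphi\vee\psi\mid\varphi\to\psi\mid\forall z\,\varphi\mid\exists z\,\varphi\mid[\alpha]\psi\mid[\alpha]_{\{A,C\}}\psi$, where in $[\alpha]_{\{A,C\}}\psi$ it is required that $(FV(A)\cup FV(C))\cap BV(\alpha)\subseteq V_{\mathcal T}$. **Static semantics.** $CN(\alpha)$ for a program: the channels occurring in its send/receive statements. Bound variables: $BV(x:=\theta)=BV(x:=* )=\{x\}$, $BV(\{x'=\theta\&\chi\})=\{x,\mu\}$, $BV(?\chi)=\emptyset$, $BV(ch(h)!\theta)=\{h\}$,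 $BV(ch(h)?x)=\{h,x\}$, $BV(\alpha\cup\beta)=BV(\alpha;\beta)=BV(\alpha\parallel\beta)=BV(\alpha)\cup BV(\beta)$, $BV(\alpha^* )=BV(\alpha)$. Must-bound variables: $MBV=BV$ on atomic programs, $MBV(\alpha\cup\beta)=MBV(\alpha)\cap MBV(\beta)$, $MBV(\alpha;\beta)=MBV(\alpha\parallel\beta)=MBV(\alpha)\cup MBV(\beta)$, $MBV(\alpha^* )=\emptyset$. Free variables of terms: all variables occurring. Of programs: $FV(x:=\theta)=FV(\theta)$, $FV(x:=* )=\emptyset$, $FV(?\chi)=FV(\chi)$, $FV(\{x'=\theta\&\chi\})=\{x,\mu\}\cup FV(\theta)\cup FV(\chi)$, $FV(ch(h)!\theta)=\{h,\mu\}\cup FV(\theta)$, $FV(ch(h)?x)=\{h,\mu\}$, $FV(\alpha;\beta)=FV(\alpha)\cup(FV(\beta)\setminus MBV(\alpha))$, $FV(\alpha\cup\beta)=FV(\alpha\parallel\beta)=FV(\alpha)\cup FV(\beta)$, $FV(\alpha^* )=FV(\alpha)$. Of formulas: as usual for first-order connectives and quantifiers; $FV([\alpha]\psi)=FV(\alpha)\cup(FV(\psi)\setminus MBV(\alpha))$; $FV([\alpha]_{\{A,C\}}\psi)=FV([\alpha]\psi)\cup FV(A)\cup FV(C)$. Accessed channels of terms: $CN(h)=\mathrm{Chan}$ for trace variables, $CN=\emptyset$ for other variables, constants (including channel names), and $\langle ch,\theta_1,\theta_2\rangle$; $CN(te\downarrow Y)=CN(te)\cap Y$; union over immediate subterms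 otherwise. Of formulas: union over immediate subterms/subformulas, $CN(Qz\,\varphi)=CN(\varphi)$ for $Q\in\{\forall,\exists\}$, $CN([\alpha]\psi)=CN(\psi)$, $CN([\alpha]_{\{A,C\}}\psi)=CN(\psi)\cup CN(A)\cup CN(C)$. **Traces and states.** A (raw) trace ($\mathcal T$) is a finite sequence of events $\langle ch,a,s\rangle$ ($ch\in\mathrm{Chan}$; $a,s\in\mathbb R$) that is chronological, i.e. its timestamps $s$ are nondecreasing. A recorded trace ($\mathcal T_{rec}$) is a trace each of whose events additionally carries a recorder variable, i.e. a chronological finite sequence of events $\langle h,ch,a,s\rangle$ ($h\in V_{\mathcal T}$). $\epsilon$ is the empty trace, $\cdot$ concatenation, $\tau\downarrow Y$ the subsequence of events with channel in $Y$, $\preceq$/$\prec$ (proper) prefix; $\tau\downarrow\alpha:=\tau\downarrow CN(\alpha)$. A state $v\in\mathcal S$ maps variables to $\mathbb R,\mathbb N,\mathcal T$ according to sort; $v[z\mapsto d]$ is the updated state; $\mathcal S_\bot=\mathcal S\cup\{\bot\}$. For $\tau\in\mathcal T_{rec}$, $v\cdot\tau$ agrees with $v$ off $V_{\mathcal T}$ and $(v\cdot\tau)(h)=v(h)\cdot\tau(h)$, where $\tau(h)$ is the subsequence of events of $\tau$ recorded by $h$, with the recorder dropped. **Term semantics** $[\![e]\!]v$: the evident one; $\mathrm{val},\mathrm{time},\mathrm{chan}$ of $te[ie]$ give value, timestamp, channel of the event of index $ie$ (indices $0,\dots,|te|-1$), and $0$, $0$, a fixed channel if the index is out of range; $|te|$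 is length. **Program semantics** $[\![\alpha]\!]\subseteq\mathcal D=\mathcal S\times\mathcal T_{rec}\times\mathcal S_\bot$. Let $\bot_{\mathcal D}=\mathcal S\times\{\epsilon\}\times\{\bot\}$, and $(\tau',w')\preceq(\tau,w)$ iff ($w'=w$ and $\tau'=\tau$) or ($w'=\bot$ and $\tau'\preceq\tau$). For $U,M\subseteq\mathcal D$: $U_\bot=\{(v,\tau,\bot)\mid(v,\tau,w)\in U\}$; $(v,\tau,w)\in U\triangleright M$ iff there are $(v,\tau_1,u)\in U$, $u\ne\bot$, $(u,\tau_2,w)\in M$ with $\tau=\tau_1\cdot\tau_2$. - $[\![x:=\theta]\!]=\bot_{\mathcal D}\cup\{(v,\epsilon,v[x\mapsto[\![\theta]\!]v])\}$; $[\![x:=*]\!]=\bot_{\mathcal D}\cup\{(v,\epsilon,v[x\mapsto a])\mid a\in\mathbb R\}$; $[\![?\chi]\!]=\bot_{\mathcal D}\cup\{(v,\epsilon,v)\mid v\models\chi\}$. - $[\![\{x'=\theta\&\chi\}]\!]=\bot_{\mathcal D}\cup\{(\phi(0),\epsilon,\phi(s))\}$ over all $s\ge0$ and $\phi:[0,s]\to\mathcal S$ such that for all $\zeta\in[0,s]$: $\phi(\zeta)\models\mu'=1\wedge x'=\theta\wedge\chi$, where $\phi(\zeta)(z')$ is the time derivative of $\phi(\cdot)(z)$ at $\zeta$ for $z\in\{x,\mu\}$, and $\phi(\zeta)=\phi(0)$ off $\{x,\mu\}$. - $[\![ch(h)!\theta]\!]=\{(v,\tau,w)\mid(\tau,w)\preceq(\langle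 h,ch,[\![\theta]\!]v,v(\mu)\rangle,v)\}$; $[\![ch(h)?x]\!]=\{(v,\tau,w)\mid(\tau,w)\preceq(\langle h,ch,a,v(\mu)\rangle,v[x\mapsto a]),\ a\in\mathbb R\}$. - $[\![\alpha\cup\beta]\!]=[\![\alpha]\!]\cup[\![\beta]\!]$; $[\![\alpha;\beta]\!]=[\![\alpha]\!]_\bot\cup([\![\alpha]\!]\triangleright[\![\beta]\!])$; $[\![\alpha^*]\!]=\bigcup_{n\in\mathbb N}[\![\alpha^n]\!]$. - $[\![\alpha\parallel\beta]\!]$ is the set of $(v,\tau,w_\alpha\oplus w_\beta)\in\mathcal D$ with $(v,\tau\downarrow\alpha,w_\alpha)\in[\![\alpha]\!]$, $(v,\tau\downarrow\beta,w_\beta)\in[\![\beta]\!]$, $w_\alpha(\mu)=w_\beta(\mu)$ (considered fulfilled if $w_\alpha=\bot$ or $w_\beta=\bot$), $\tau=\tau\downarrow(\alpha\parallel\beta)$. Here $w_\alpha\oplus w_\beta=\bot$ if one of them is $\bot$; otherwise it equals $w_\alpha$ on $BV(\alpha)$ and $w_\beta$ elsewhere. **Formula semantics** $v\models\varphi$: usual for first-order connectives (quantifiers range over all values of the sort of $z$). $v\models[\alpha]\psi$ iff $w\cdot\tau\models\psi$ for all $(v,\tau,w)\in[\![\alpha]\!]$ with $w\neq\bot$. $v\models[\alpha]_{\{A,C\}}\psi$ iff for all $(v,\tau,w)\in[\![\alpha]\!]$: (commit) if $v\cdot\tau'\models A$ for all $\tau'\prec\tau$ then $v\cdot\tau\models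 C$; and (post) if $v\cdot\tau'\models A$ for all $\tau'\preceq\tau$ and $w\ne\bot$ then $w\cdot\tau\models\psi$. **Noninterference.** $\beta$ does not interfere with $[\alpha]_{\{A,C\}}\psi$ iff $FV(\psi)\cap BV(\beta)\subseteq\{\mu\}\cup V_{\mathcal T}$; $FV(\chi)\cap BV(\beta)\subseteq V_{\mathcal T}$ for $\chi\in\{A,C\}$; $CN(\chi)\cap CN(\beta)\subseteq CN(\alpha)$ for $\chi\in\{A,C,\psi\}$. **The calculus.** All programs and formulas in instances are well-formed. Axioms: 1. $[x:=\theta]\psi(x)\leftrightarrow\psi(\theta)$ (admissible substitution: every free occurrence of $x$ in $\psi$ is a syntactic occurrence inside a term, and replacing it by $\theta$ causes no variable capture). 2. $[x:=*]\psi\leftrightarrow\forall x\,\psi$. 3. $[?\chi]\psi\leftrightarrow(\chi\to\psi)$. 4. $[\alpha]\psi\leftrightarrow[\alpha]_{\{\mathrm{true},\mathrm{true}\}}\psi$. 5. $[\alpha;\beta]_{\{A,C\}}\psi\leftrightarrow[\alpha]_{\{A,C\}}[\beta]_{\{A,C\}}\psi$. 6. $[\alpha\cup\beta]_{\{A,C\}}\psi\leftrightarrow[\alpha]_{\{A,C\}}\psi\wedge[\beta]_{\{A,C\}}\psi$. 7. $[\alpha^*]_{\{A,C\}}\psi\leftrightarrow[\alpha^0]_{\{A,C\}}\psi\wedge[\alpha]_{\{A,C\}}[\alpha^*]_{\{A,C\}}\psi$. 8. $[\alpha^*]_{\{A,C\}}\psi\leftrightarrow[\alpha^0]_{\{A,C\}}\psi\wedge[\alpha^*]_{\{A,\mathrm{true}\}}(\psi\to[\alpha]_{\{A,C\}}\psi)$.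 9. $[\{x'=\theta\&\chi\}]\psi\leftrightarrow[\{\mu'=1,x'=\theta\&\chi\}]\psi$ (the two programs being identified if $\mu$ is already among $x$). 10. $[\{x'=\theta(x)\}]\psi(x)\leftrightarrow\forall t\ge0\,[x:=y(t)]\psi(x)$, where $\mu$ is among $x$, $t$ is fresh, and $y(t)$ is (a list of polynomial terms expressing) the solution of $y'(t)=\theta(y)$ with $y(0)=x$. 11. $[ch(h)!\theta]\psi(h)\leftrightarrow\forall h_0\,(h_0=h\cdot\langle ch,\theta,\mu\rangle\to\psi(h_0))$, $h_0$ fresh, where $\psi(h_0)$ replaces every occurrence of $h$ in $\psi(h)$, including recorder annotations in programs, by $h_0$. 12. $[ch(h)!\theta]_{\{A,C\}}\psi\leftrightarrow C\wedge\big(A\to[ch(h)!\theta](C\wedge(A\to\psi))\big)$. 13. $[ch(h)?x]_{\{A,C\}}\psi\leftrightarrow[x:=*][ch(h)!x]_{\{A,C\}}\psi$. 14. $(\forall K)\wedge[\alpha]_{\{A_1\wedge A_2,\,C_1\wedge C_2\}}\psi\to[\alpha]_{\{A,\,C_1\wedge C_2\}}\psi$, where $K\equiv(A\wedge C_1\to A_2)\wedge(A\wedge C_2\to A_1)$ and $\forall K$ is its universal closure over $FV(K)$. 15. $[\alpha]_{\{A,C\}}\psi\to[\alpha\parallel\beta]_{\{A,C\}}\psi$, if $\beta$ does not interfere with $[\alpha]_{\{A,C\}}\psi$. 16. $[\alpha]_{\{A,C\}}\psi\leftrightarrow C\wedge(A\to[\alpha]\psi)$, if $CN(\alpha)=\emptyset$.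 17. $[\alpha]_{\{A,C\}}\psi\leftrightarrow C\wedge[\alpha]_{\{A,C\}}(C\wedge(A\to\psi))$. 18. $[\alpha]_{\{A,C_1\wedge C_2\}}(\psi_1\wedge\psi_2)\leftrightarrow[\alpha]_{\{A,C_1\}}\psi_1\wedge[\alpha]_{\{A,C_2\}}\psi_2$. Rules: 19. From $A_2\to A_1$, $C_1\to C_2$, $\psi_1\to\psi_2$ infer $[\alpha]_{\{A_1,C_1\}}\psi_1\to[\alpha]_{\{A_2,C_2\}}\psi_2$. 20. From $C\wedge\psi$ infer $[\alpha]_{\{A,C\}}\psi$.
   Formalization: Traces (in states, quantifiers and runs of sequential programs) need not be chronological, only the interleavings of α∥β must be; FV(α∥β) also contains μ when μ is bound by a component but not must-bound by both; axiom 13 requires x≠μ. *)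

(* Defs.v *)
From Stdlib Require Import Reals QArith Qreals List ListSet Sorted.
Import ListNotations.
Set Implicit Arguments.
Unset Strict Implicit.
Unset Printing Implicit Defensive.
Local Open Scope R_scope.

(* [sch_dflt] is the value of chan(te[ie]) when the index is out of range. *)
Record signature := Signature {
  sVR : Type; sVN : Type; sVT : Type; sChan : Type;
  sVR_dec : forall x y : sVR, {x = y} + {x <> y};
  sVN_dec : forall x y : sVN, {x = y} + {x <> y};
  sVT_dec : forall x y : sVT, {x = y} + {x <> y};
  sChan_dec : forall x y : sChan, {x = y} + {x <> y};
  smu : sVR;
  sch_dflt : sChan }.

Section dLCHP.
Context {Sg : signature}.

Local Notation VR := (sVR Sg).
Local Notation VN := (sVN Sg).
Local Notation VT := (sVT Sg).
Local Notation Chan := (sChan Sg).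
Local Notation mu := (smu Sg).

Inductive var := VarR (x : VR) | VarN (n : VN) | VarT (h : VT).

Definition var_dec (y z : var) : {y = z} + {y <> z}.
Proof. decide equality; [apply sVR_dec | apply sVN_dec | apply sVT_dec]. Defined.

Inductive poly :=
| PVar (x : VR) | PConst (c : Q) | PAdd (a b : poly) | PMul (a b : poly).

Inductive ttm :=
| TVar (h : VT)
| TEps
| TItem (ch : Chan) (th1 th2 : poly)
| TCat (te1 te2 : ttm)
| TProj (te : ttm) (Y : list Chan).

Inductive itm :=
| IVar (n : VN) | IZero | IOne | IAdd (a b : itm) | ILen (te : ttm).

Inductive ctm := CName (ch : Chan) | CChan (te : ttm) (ie : itm).

Inductive rtm :=
| RVar (x : VR) | RConst (c : Q) | RAdd (a b : rtm) | RMul (a b : rtm)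
| RVal (te : ttm) (ie : itm) | RTime (te : ttm) (ie : itm).

(* First-order real arithmetic, the language of tests and domain constraints. *)
Inductive fora :=
| AEq (a b : poly) | AGe (a b : poly)
| ANot (c : fora) | AAnd (c d : fora) | AOr (c d : fora) | AImp (c d : fora)
| AAll (x : VR) (c : fora) | AEx (x : VR) (c : fora).

(* Assignments and differential equations take a list of pairs
   (left-hand side, right-hand side); [x := theta] is [PAssign [(x, theta)]]. *)
Inductive prog :=
| PAssign (l : list (VR * poly))
| PAny (x : VR)
| PODE (l : list (VR * poly)) (chi : fora)
| PTest (chi : fora)
| PSeq (a b : prog)
| PChoice (a b : prog)
| PLoop (a : prog)
| PSend (ch : Chan) (h : VT) (th : poly)
| PRecv (ch : Chan) (h : VT) (x : VR)
| PPar (a b : prog).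

Inductive fml :=
| FEqR (a b : rtm) | FEqI (a b : itm) | FEqC (a b : ctm) | FEqT (a b : ttm)
| FGeR (a b : rtm) | FGeI (a b : itm) | FPre (a b : ttm)
| FNot (p : fml) | FAnd (p q : fml) | FOr (p q : fml) | FImp (p q : fml)
| FAll (z : var) (p : fml) | FEx (z : var) (p : fml)
| FBox (a : prog) (p : fml)
| FACBox (a : prog) (A C : fml) (p : fml).

Definition FIff (p q : fml) : fml := FAnd (FImp p q) (FImp q p).

Fixpoint rtm_of_poly (th : poly) : rtm :=
  match th with
  | PVar x => RVar x
  | PConst c => RConst c
  | PAdd a b => RAdd (rtm_of_poly a) (rtm_of_poly b)
  | PMul a b => RMul (rtm_of_poly a) (rtm_of_poly b)
  end.

Fixpoint fml_of_fora (chi : fora) : fml :=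
  match chi with
  | AEq a b => FEqR (rtm_of_poly a) (rtm_of_poly b)
  | AGe a b => FGeR (rtm_of_poly a) (rtm_of_poly b)
  | ANot c => FNot (fml_of_fora c)
  | AAnd c d => FAnd (fml_of_fora c) (fml_of_fora d)
  | AOr c d => FOr (fml_of_fora c) (fml_of_fora d)
  | AImp c d => FImp (fml_of_fora c) (fml_of_fora d)
  | AAll x c => FAll (VarR x) (fml_of_fora c)
  | AEx x c => FEx (VarR x) (fml_of_fora c)
  end.

Definition ATrue : fora := AEq (PConst 0%Q) (PConst 0%Q).
Definition FTrue : fml := fml_of_fora ATrue.

Fixpoint PPow (a : prog) (n : nat) : prog :=
  match n with
  | O => PTest ATrue
  | S m => PSeq a (PPow a m)
  end.

(* Finite sets of variables are lists, compared through [In]. *)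
Local Notation vunion := (set_union var_dec).
Local Notation vinter := (set_inter var_dec).
Local Notation vdiff := (set_diff var_dec).

Definition is_tvar (z : var) : Prop := match z with VarT _ => True | _ => False end.

Definition lhs (l : list (VR * poly)) : list var := map (fun p => VarR (fst p)) l.

Fixpoint fv_poly (th : poly) : list var :=
  match th with
  | PVar x => [VarR x]
  | PConst _ => []
  | PAdd a b | PMul a b => vunion (fv_poly a) (fv_poly b)
  end.

Fixpoint fv_rhs (l : list (VR * poly)) : list var :=
  match l with
  | [] => []
  | (_, th) :: l' => vunion (fv_poly th) (fv_rhs l')
  end.

Fixpoint fv_ttm (te : ttm) : list var :=
  match te with
  | TVar h => [VarT h]
  | TEps => []
  | TItem _ th1 th2 => vunion (fv_poly th1) (fv_poly th2)
  | TCat a b => vunion (fv_ttm a) (fv_ttm b)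
  | TProj a _ => fv_ttm a
  end.

Fixpoint fv_itm (ie : itm) : list var :=
  match ie with
  | IVar n => [VarN n]
  | IZero | IOne => []
  | IAdd a b => vunion (fv_itm a) (fv_itm b)
  | ILen te => fv_ttm te
  end.

Definition fv_ctm (ce : ctm) : list var :=
  match ce with
  | CName _ => []
  | CChan te ie => vunion (fv_ttm te) (fv_itm ie)
  end.

Fixpoint fv_rtm (e : rtm) : list var :=
  match e with
  | RVar x => [VarR x]
  | RConst _ => []
  | RAdd a b | RMul a b => vunion (fv_rtm a) (fv_rtm b)
  | RVal te ie | RTime te ie => vunion (fv_ttm te) (fv_itm ie)
  end.

Fixpoint fv_fora (chi : fora) : list var :=
  match chi with
  | AEq a b | AGe a b => vunion (fv_poly a) (fv_poly b)
  | ANot c => fv_fora c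
  | AAnd c d | AOr c d | AImp c d => vunion (fv_fora c) (fv_fora d)
  | AAll x c | AEx x c => vdiff (fv_fora c) [VarR x]
  end.

Fixpoint bv (a : prog) : list var :=
  match a with
  | PAssign l => lhs l
  | PAny x => [VarR x]
  | PODE l _ => vunion (lhs l) [VarR mu]
  | PTest _ => []
  | PSend _ h _ => [VarT h]
  | PRecv _ h x => [VarT h; VarR x]
  | PSeq a b | PChoice a b | PPar a b => vunion (bv a) (bv b)
  | PLoop a => bv a
  end.

Fixpoint mbv (a : prog) : list var :=
  match a with
  | PChoice a b => vinter (mbv a) (mbv b)
  | PSeq a b | PPar a b => vunion (mbv a) (mbv b)
  | PLoop _ => []
  | _ => bv a
  end.

(* [par_mu a b] is [mu] if the synchronization of the final values of [mu] in
   [PPar a b] can depend on the initial value of [mu], i.e. if [mu] is bound by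
   a component but not must-bound by both; otherwise it is empty.  If [mu] is
   written by communications and differential equations only, then [par_mu a b]
   is already contained in the union of FV(a) and FV(b).  For explicit assignments it is
   not: [mu := 3] in parallel with [y := 1] has no terminating run unless
   [mu] is [3] initially.  Without this contribution to [fv_prog], the truth of
   a formula could depend on [mu] although [mu] is not free in it. *)
Definition par_mu (a b : prog) : list var :=
  vdiff (vinter [VarR mu] (vunion (bv a) (bv b))) (vinter (mbv a) (mbv b)).

Fixpoint fv_prog (a : prog) : list var :=
  match a with
  | PAssign l => fv_rhs l
  | PAny _ => []
  | PTest chi => fv_fora chi
  | PODE l chi =>
      vunion (vunion (lhs l) [VarR mu]) (vunion (fv_rhs l) (fv_fora chi))
  | PSend _ h th => vunion [VarT h; VarR mu] (fv_poly th)
  | PRecv _ h _ => [VarT h; VarR mu]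
  | PSeq a b => vunion (fv_prog a) (vdiff (fv_prog b) (mbv a))
  | PChoice a b => vunion (fv_prog a) (fv_prog b)
  | PPar a b => vunion (vunion (fv_prog a) (fv_prog b)) (par_mu a b)
  | PLoop a => fv_prog a
  end.

Definition v_prog (a : prog) : list var := vunion (fv_prog a) (bv a).

Fixpoint fv (p : fml) : list var :=
  match p with
  | FEqR a b | FGeR a b => vunion (fv_rtm a) (fv_rtm b)
  | FEqI a b | FGeI a b => vunion (fv_itm a) (fv_itm b)
  | FEqC a b => vunion (fv_ctm a) (fv_ctm b)
  | FEqT a b | FPre a b => vunion (fv_ttm a) (fv_ttm b)
  | FNot p => fv p
  | FAnd p q | FOr p q | FImp p q => vunion (fv p) (fv q)
  | FAll z p | FEx z p => vdiff (fv p) [z]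
  | FBox a p => vunion (fv_prog a) (vdiff (fv p) (mbv a))
  | FACBox a A C p =>
      vunion (vunion (fv_prog a) (vdiff (fv p) (mbv a))) (vunion (fv A) (fv C))
  end.

Fixpoint cn_prog (a : prog) : list Chan :=
  match a with
  | PSend ch _ _ | PRecv ch _ _ => [ch]
  | PSeq a b | PChoice a b | PPar a b => cn_prog a ++ cn_prog b
  | PLoop a => cn_prog a
  | _ => []
  end.

(* Accessed channels of terms and formulas; they can be infinitely many. *)
Fixpoint cn_ttm (te : ttm) (c : Chan) : Prop :=
  match te with
  | TVar _ => True
  | TEps | TItem _ _ _ => False
  | TCat a b => cn_ttm a c \/ cn_ttm b c
  | TProj a Y => cn_ttm a c /\ In c Y
  end.

Fixpoint cn_itm (ie : itm) (c : Chan) : Prop :=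
  match ie with
  | IVar _ | IZero | IOne => False
  | IAdd a b => cn_itm a c \/ cn_itm b c
  | ILen te => cn_ttm te c
  end.

Definition cn_ctm (ce : ctm) (c : Chan) : Prop :=
  match ce with
  | CName _ => False
  | CChan te ie => cn_ttm te c \/ cn_itm ie c
  end.

Fixpoint cn_rtm (e : rtm) (c : Chan) : Prop :=
  match e with
  | RVar _ | RConst _ => False
  | RAdd a b | RMul a b => cn_rtm a c \/ cn_rtm b c
  | RVal te ie | RTime te ie => cn_ttm te c \/ cn_itm ie c
  end.

Fixpoint cn (p : fml) (c : Chan) : Prop :=
  match p with
  | FEqR a b | FGeR a b => cn_rtm a c \/ cn_rtm b c
  | FEqI a b | FGeI a b => cn_itm a c \/ cn_itm b c
  | FEqC a b => cn_ctm a c \/ cn_ctm b c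
  | FEqT a b | FPre a b => cn_ttm a c \/ cn_ttm b c
  | FNot p => cn p c
  | FAnd p q | FOr p q | FImp p q => cn p c \/ cn q c
  | FAll _ p | FEx _ p => cn p c
  | FBox _ p => cn p c
  | FACBox _ A C p => cn p c \/ cn A c \/ cn C c
  end.

(* All variables with a syntactic occurrence, free or bound. *)
Fixpoint occ_fora (chi : fora) : list var :=
  match chi with
  | AEq a b | AGe a b => fv_poly a ++ fv_poly b
  | ANot c => occ_fora c
  | AAnd c d | AOr c d | AImp c d => occ_fora c ++ occ_fora d
  | AAll x c | AEx x c => VarR x :: occ_fora c
  end.

Fixpoint occ_prog (a : prog) : list var :=
  match a with
  | PAssign l => lhs l ++ fv_rhs l
  | PAny x => [VarR x]
  | PODE l chi => lhs l ++ fv_rhs l ++ occ_fora chi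
  | PTest chi => occ_fora chi
  | PSend _ h th => VarT h :: fv_poly th
  | PRecv _ h x => [VarT h; VarR x]
  | PSeq a b | PChoice a b | PPar a b => occ_prog a ++ occ_prog b
  | PLoop a => occ_prog a
  end.

Fixpoint occ (p : fml) : list var :=
  match p with
  | FNot p => occ p
  | FAnd p q | FOr p q | FImp p q => occ p ++ occ q
  | FAll z p | FEx z p => z :: occ p
  | FBox a p => occ_prog a ++ occ p
  | FACBox a A C p => occ_prog a ++ occ A ++ occ C ++ occ p
  | _ => fv p
  end.

Fixpoint wf_prog (a : prog) : Prop :=
  match a with
  | PAssign l => NoDup (map fst l)
  | PODE l _ =>
      NoDup (map fst l) /\ forall th, In (mu, th) l -> th = PConst 1%Q
  | PSeq a b | PChoice a b => wf_prog a /\ wf_prog b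
  | PLoop a => wf_prog a
  | PPar a b =>
      wf_prog a /\ wf_prog b /\
      (forall z, In z (vinter (v_prog a) (bv b)) <->
                 In z (vinter (v_prog b) (bv a))) /\
      (forall z, In z (vinter (v_prog a) (bv b)) -> z = VarR mu \/ is_tvar z)
  | _ => True
  end.

Fixpoint wf (p : fml) : Prop :=
  match p with
  | FNot p => wf p
  | FAnd p q | FOr p q | FImp p q => wf p /\ wf q
  | FAll _ p | FEx _ p => wf p
  | FBox a p => wf_prog a /\ wf p
  | FACBox a A C p =>
      wf_prog a /\ wf A /\ wf C /\ wf p /\
      forall z, In z (vinter (vunion (fv A) (fv C)) (bv a)) -> is_tvar z
  | _ => True
  end.

(* Trace values and recorded traces are finite sequences of events: neither
   te1 . te2 nor v . tau preserves chronology (v may map h to events that are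
   later than v(mu)), so the types do not impose it.  The recorded traces of a
   sequential program that never decreases mu are chronological; if they were
   required to be so for all programs, [ax_seq] would fail for
   ch(h1)!0; mu := mu - 1; ch(h2)!0.  For interleavings in parallel
   compositions, [sem] does impose [chronological]. *)
Record event := Event { ev_ch : Chan; ev_val : R; ev_time : R }.
Definition trace := list event.
Definition rtrace := list (VT * event).

Definition chronological (tau : rtrace) : Prop :=
  StronglySorted Rle (map (fun e => ev_time (snd e)) tau).

Definition mem_chan (Y : list Chan) (c : Chan) : bool :=
  if in_dec (@sChan_dec Sg) c Y then true else false.

Definition proj (Y : list Chan) (t : trace) : trace :=
  filter (fun e => mem_chan Y (ev_ch e)) t.
Definition rproj (Y : list Chan) (tau : rtrace) : rtrace :=
  filter (fun e => mem_chan Y (ev_ch (snd e))) tau.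

Definition rec_by (h : VT) (tau : rtrace) : trace :=
  map snd (filter (fun e => if sVT_dec (fst e) h then true else false) tau).

Definition prefix (T : Type) (s t : list T) : Prop := exists r, t = s ++ r.
Definition pprefix (T : Type) (s t : list T) : Prop := prefix s t /\ s <> t.

Record state := State { st_R : VR -> R; st_N : VN -> nat; st_T : VT -> trace }.

Definition sort_val (z : var) : Type :=
  match z with VarR _ => R | VarN _ => nat | VarT _ => trace end.

Definition updR (v : state) (x : VR) (d : R) : state :=
  State (fun y => if sVR_dec y x then d else st_R v y) (st_N v) (st_T v).
Definition updN (v : state) (n : VN) (d : nat) : state :=
  State (st_R v) (fun m => if sVN_dec m n then d else st_N v m) (st_T v).
Definition updT (v : state) (h : VT) (d : trace) : state :=
  State (st_R v) (st_N v) (fun g => if sVT_dec g h then d else st_T v g).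

Definition upd (v : state) (z : var) : sort_val z -> state :=
  match z with VarR x => updR v x | VarN n => updN v n | VarT h => updT v h end.

Definition same_at (v w : state) (z : var) : Prop :=
  match z with
  | VarR x => st_R v x = st_R w x
  | VarN n => st_N v n = st_N w n
  | VarT h => st_T v h = st_T w h
  end.

Definition append (v : state) (tau : rtrace) : state :=
  State (st_R v) (st_N v) (fun h => st_T v h ++ rec_by h tau).

Fixpoint ev_poly (th : poly) (v : state) : R :=
  match th with
  | PVar x => st_R v x
  | PConst c => Q2R c
  | PAdd a b => ev_poly a v + ev_poly b v
  | PMul a b => ev_poly a v * ev_poly b v
  end.

Fixpoint ev_ttm (te : ttm) (v : state) : trace :=
  match te with
  | TVar h => st_T v h
  | TEps => []
  | TItem ch th1 th2 => [Event ch (ev_poly th1 v) (ev_poly th2 v)]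
  | TCat a b => ev_ttm a v ++ ev_ttm b v
  | TProj a Y => proj Y (ev_ttm a v)
  end.

Fixpoint ev_itm (ie : itm) (v : state) : nat :=
  match ie with
  | IVar n => st_N v n
  | IZero => 0
  | IOne => 1
  | IAdd a b => ev_itm a v + ev_itm b v
  | ILen te => length (ev_ttm te v)
  end%nat.

Definition ev_at (T : Type) (f : event -> T) (d : T) (t : trace) (i : nat) : T :=
  match nth_error t i with Some e => f e | None => d end.

Definition ev_ctm (ce : ctm) (v : state) : Chan :=
  match ce with
  | CName ch => ch
  | CChan te ie => ev_at (@ev_ch) (sch_dflt Sg) (ev_ttm te v) (ev_itm ie v)
  end.

Fixpoint ev_rtm (e : rtm) (v : state) : R :=
  match e with
  | RVar x => st_R v x
  | RConst c => Q2R c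
  | RAdd a b => ev_rtm a v + ev_rtm b v
  | RMul a b => ev_rtm a v * ev_rtm b v
  | RVal te ie => ev_at (@ev_val) 0 (ev_ttm te v) (ev_itm ie v)
  | RTime te ie => ev_at (@ev_time) 0 (ev_ttm te v) (ev_itm ie v)
  end.

Fixpoint sat_fora (chi : fora) (v : state) : Prop :=
  match chi with
  | AEq a b => ev_poly a v = ev_poly b v
  | AGe a b => ev_poly a v >= ev_poly b v
  | ANot c => ~ sat_fora c v
  | AAnd c d => sat_fora c v /\ sat_fora d v
  | AOr c d => sat_fora c v \/ sat_fora d v
  | AImp c d => sat_fora c v -> sat_fora d v
  | AAll x c => forall d : R, sat_fora c (updR v x d)
  | AEx x c => exists d : R, sat_fora c (updR v x d)
  end.

(* [None] is the bottom element of S_bot. *)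
Definition denot := state -> rtrace -> option state -> Prop.

Definition bot_D : denot := fun _ tau w => tau = [] /\ w = None.

Definition obs_le (tau' : rtrace) (w' : option state)
    (tau : rtrace) (w : option state) : Prop :=
  (w' = w /\ tau' = tau) \/ (w' = None /\ prefix tau' tau).

Fixpoint subst_lookup (l : list (VR * poly)) (x : VR) : poly :=
  match l with
  | [] => PVar x
  | (y, th) :: l' => if sVR_dec y x then th else subst_lookup l' x
  end.

Definition assign (l : list (VR * poly)) (v : state) : state :=
  State (fun x => ev_poly (subst_lookup l x) v) (st_N v) (st_T v).

(* Derivatives are taken within [0, s], hence are one-sided at the end points;
   they impose nothing if s = 0. *)
Definition ode_run (l : list (VR * poly)) (chi : fora)
    (s : R) (phi : R -> state) : Prop :=
  let I := fun z => 0 <= z <= s in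
  forall z, I z ->
    D_in (fun r => st_R (phi r) mu) (fun _ => 1) I z /\
    (forall x th, In (x, th) l ->
       D_in (fun r => st_R (phi r) x) (fun r => ev_poly th (phi r)) I z) /\
    sat_fora chi (phi z) /\
    (forall y, ~ In y (vunion (lhs l) [VarR mu]) -> same_at (phi z) (phi 0) y).

Definition sem_test (chi : fora) : denot := fun v tau w =>
  bot_D v tau w \/ (tau = [] /\ w = Some v /\ sat_fora chi v).

Definition sem_bot (U : denot) : denot := fun v tau w =>
  w = None /\ exists w', U v tau w'.

Definition sem_then (U M : denot) : denot := fun v tau w =>
  exists tau1 u tau2, U v tau1 (Some u) /\ M u tau2 w /\ tau = tau1 ++ tau2.

Definition sem_seq (U M : denot) : denot := fun v tau w =>
  sem_bot U v tau w \/ sem_then U M v tau w.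

Fixpoint sem_pow (U : denot) (n : nat) : denot :=
  match n with
  | O => sem_test ATrue
  | S m => sem_seq U (sem_pow U m)
  end.

Definition merge (X : list var) (wa wb : state) : state :=
  State
    (fun x => if in_dec var_dec (VarR x) X then st_R wa x else st_R wb x)
    (fun n => if in_dec var_dec (VarN n) X then st_N wa n else st_N wb n)
    (fun h => if in_dec var_dec (VarT h) X then st_T wa h else st_T wb h).

Definition omerge (X : list var) (wa wb : option state) : option state :=
  match wa, wb with
  | Some a, Some b => Some (merge X a b)
  | _, _ => None
  end.

Definition mu_agree (wa wb : option state) : Prop :=
  match wa, wb with
  | Some a, Some b => st_R a mu = st_R b mu
  | _, _ => True
  end.

Fixpoint sem (a : prog) : denot :=
  match a with
  | PAssign l => fun v tau w =>
      bot_D v tau w \/ (tau = [] /\ w = Some (assign l v))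
  | PAny x => fun v tau w =>
      bot_D v tau w \/ (tau = [] /\ exists d, w = Some (updR v x d))
  | PODE l chi => fun v tau w =>
      bot_D v tau w \/
      (tau = [] /\ exists s phi,
         0 <= s /\ ode_run l chi s phi /\ v = phi 0 /\ w = Some (phi s))
  | PTest chi => sem_test chi
  | PSeq a b => sem_seq (sem a) (sem b)
  | PChoice a b => fun v tau w => sem a v tau w \/ sem b v tau w
  | PLoop a => fun v tau w => exists n, sem_pow (sem a) n v tau w
  | PSend ch h th => fun v tau w =>
      obs_le tau w [(h, Event ch (ev_poly th v) (st_R v mu))] (Some v)
  | PRecv ch h x => fun v tau w =>
      exists d, obs_le tau w [(h, Event ch d (st_R v mu))] (Some (updR v x d))
  | PPar a b => fun v tau w =>
      exists wa wb,
        sem a v (rproj (cn_prog a) tau) wa /\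
        sem b v (rproj (cn_prog b) tau) wb /\
        mu_agree wa wb /\
        chronological tau /\
        tau = rproj (cn_prog (PPar a b)) tau /\
        w = omerge (bv a) wa wb
  end.

Lemma sem_loopE (a : prog) v tau w :
  sem (PLoop a) v tau w <-> exists n, sem (PPow a n) v tau w.
Proof.
assert (E : forall n, sem (PPow a n) = sem_pow (sem a) n).
{ induction n as [|n IH]; simpl; [reflexivity | now rewrite IH]. }
split; intros [n H]; exists n; [rewrite E | rewrite <- E]; exact H.
Qed.

Fixpoint sat (p : fml) (v : state) : Prop :=
  match p with
  | FEqR a b => ev_rtm a v = ev_rtm b v
  | FEqI a b => ev_itm a v = ev_itm b v
  | FEqC a b => ev_ctm a v = ev_ctm b v
  | FEqT a b => ev_ttm a v = ev_ttm b v
  | FGeR a b => ev_rtm a v >= ev_rtm b v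
  | FGeI a b => (ev_itm a v >= ev_itm b v)%nat
  | FPre a b => prefix (ev_ttm a v) (ev_ttm b v)
  | FNot p => ~ sat p v
  | FAnd p q => sat p v /\ sat q v
  | FOr p q => sat p v \/ sat q v
  | FImp p q => sat p v -> sat q v
  | FAll z p => forall d : sort_val z, sat p (upd v d)
  | FEx z p => exists d : sort_val z, sat p (upd v d)
  | FBox a p =>
      forall tau w, sem a v tau (Some w) -> sat p (append w tau)
  | FACBox a A C p =>
      forall tau w, sem a v tau w ->
        ((forall tau', pprefix tau' tau -> sat A (append v tau')) ->
           sat C (append v tau)) /\
        ((forall tau', prefix tau' tau -> sat A (append v tau')) ->
           forall u, w = Some u -> sat p (append u tau))
  end.

Definition valid (p : fml) : Prop := forall v, sat p v.

(* Substitutions are association lists; [sminus s X] no longer replaces the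
   variables in X. *)
Definition sminus (s : list (VR * poly)) (X : list var) : list (VR * poly) :=
  filter (fun p => if in_dec var_dec (VarR (fst p)) X then false else true) s.

Fixpoint subst_poly (s : list (VR * poly)) (th : poly) : poly :=
  match th with
  | PVar x => subst_lookup s x
  | PConst c => PConst c
  | PAdd a b => PAdd (subst_poly s a) (subst_poly s b)
  | PMul a b => PMul (subst_poly s a) (subst_poly s b)
  end.

Definition subst_rhs (s l : list (VR * poly)) : list (VR * poly) :=
  map (fun p => (fst p, subst_poly s (snd p))) l.

Fixpoint subst_ttm (s : list (VR * poly)) (te : ttm) : ttm :=
  match te with
  | TVar h => TVar h
  | TEps => TEps
  | TItem ch th1 th2 => TItem ch (subst_poly s th1) (subst_poly s th2)
  | TCat a b => TCat (subst_ttm s a) (subst_ttm s b)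
  | TProj a Y => TProj (subst_ttm s a) Y
  end.

Fixpoint subst_itm (s : list (VR * poly)) (ie : itm) : itm :=
  match ie with
  | IVar n => IVar n
  | IZero => IZero
  | IOne => IOne
  | IAdd a b => IAdd (subst_itm s a) (subst_itm s b)
  | ILen te => ILen (subst_ttm s te)
  end.

Definition subst_ctm (s : list (VR * poly)) (ce : ctm) : ctm :=
  match ce with
  | CName ch => CName ch
  | CChan te ie => CChan (subst_ttm s te) (subst_itm s ie)
  end.

Fixpoint subst_rtm (s : list (VR * poly)) (e : rtm) : rtm :=
  match e with
  | RVar x => rtm_of_poly (subst_lookup s x)
  | RConst c => RConst c
  | RAdd a b => RAdd (subst_rtm s a) (subst_rtm s b)
  | RMul a b => RMul (subst_rtm s a) (subst_rtm s b)
  | RVal te ie => RVal (subst_ttm s te) (subst_itm s ie)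
  | RTime te ie => RTime (subst_ttm s te) (subst_itm s ie)
  end.

Fixpoint subst_fora (s : list (VR * poly)) (chi : fora) : fora :=
  match chi with
  | AEq a b => AEq (subst_poly s a) (subst_poly s b)
  | AGe a b => AGe (subst_poly s a) (subst_poly s b)
  | ANot c => ANot (subst_fora s c)
  | AAnd c d => AAnd (subst_fora s c) (subst_fora s d)
  | AOr c d => AOr (subst_fora s c) (subst_fora s d)
  | AImp c d => AImp (subst_fora s c) (subst_fora s d)
  | AAll x c => AAll x (subst_fora (sminus s [VarR x]) c)
  | AEx x c => AEx x (subst_fora (sminus s [VarR x]) c)
  end.

Fixpoint subst_prog (s : list (VR * poly)) (a : prog) : prog :=
  match a with
  | PAssign l => PAssign (subst_rhs s l)
  | PAny x => PAny x
  | PODE l chi => PODE (subst_rhs s l) (subst_fora s chi)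
  | PTest chi => PTest (subst_fora s chi)
  | PSeq a b => PSeq (subst_prog s a) (subst_prog (sminus s (mbv a)) b)
  | PChoice a b => PChoice (subst_prog s a) (subst_prog s b)
  | PLoop a => PLoop (subst_prog s a)
  | PSend ch h th => PSend ch h (subst_poly s th)
  | PRecv ch h x => PRecv ch h x
  | PPar a b => PPar (subst_prog s a) (subst_prog s b)
  end.

Fixpoint subst (s : list (VR * poly)) (p : fml) : fml :=
  match p with
  | FEqR a b => FEqR (subst_rtm s a) (subst_rtm s b)
  | FEqI a b => FEqI (subst_itm s a) (subst_itm s b)
  | FEqC a b => FEqC (subst_ctm s a) (subst_ctm s b)
  | FEqT a b => FEqT (subst_ttm s a) (subst_ttm s b)
  | FGeR a b => FGeR (subst_rtm s a) (subst_rtm s b)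
  | FGeI a b => FGeI (subst_itm s a) (subst_itm s b)
  | FPre a b => FPre (subst_ttm s a) (subst_ttm s b)
  | FNot p => FNot (subst s p)
  | FAnd p q => FAnd (subst s p) (subst s q)
  | FOr p q => FOr (subst s p) (subst s q)
  | FImp p q => FImp (subst s p) (subst s q)
  | FAll z p => FAll z (subst (sminus s [z]) p)
  | FEx z p => FEx z (subst (sminus s [z]) p)
  | FBox a p => FBox (subst_prog s a) (subst (sminus s (mbv a)) p)
  | FACBox a A C p =>
      FACBox (subst_prog s a) (subst s A) (subst s C)
        (subst (sminus s (mbv a)) p)
  end.

(* The replaced variables among X can be replaced in the scope of binders of B:
   neither they nor the variables of their replacements are in B. *)
Definition no_capture (s : list (VR * poly)) (X B : list var) : Prop :=
  forall x th, In (x, th) s -> In (VarR x) X ->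
    ~ In (VarR x) B /\ forall z, In z (fv_poly th) -> ~ In z B.

(* The variables in X are not replaced.  Used for free occurrences that are not
   inside a term: left-hand sides of differential equations and implicit reads
   of [mu]. *)
Definition avoids (s : list (VR * poly)) (X : list var) : Prop :=
  forall x, In (VarR x) X -> ~ In x (map fst s).

Fixpoint adm_fora (s : list (VR * poly)) (chi : fora) : Prop :=
  match chi with
  | AEq _ _ | AGe _ _ => True
  | ANot c => adm_fora s c
  | AAnd c d | AOr c d | AImp c d => adm_fora s c /\ adm_fora s d
  | AAll x c | AEx x c =>
      let s' := sminus s [VarR x] in
      adm_fora s' c /\ no_capture s' (fv_fora c) [VarR x]
  end.

Fixpoint adm_prog (s : list (VR * poly)) (a : prog) : Prop :=
  match a with
  | PAssign _ | PAny _ => True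
  | PODE l chi =>
      let B := vunion (lhs l) [VarR mu] in
      avoids s B /\ adm_fora s chi /\
      no_capture s (vunion (fv_rhs l) (fv_fora chi)) B
  | PTest chi => adm_fora s chi
  | PSeq a b =>
      let s' := sminus s (mbv a) in
      adm_prog s a /\ adm_prog s' b /\ no_capture s' (fv_prog b) (bv a)
  | PChoice a b => adm_prog s a /\ adm_prog s b
  | PLoop a => adm_prog s a /\ no_capture s (fv_prog a) (bv a)
  | PSend _ _ _ | PRecv _ _ _ => avoids s [VarR mu]
  | PPar a b => adm_prog s a /\ adm_prog s b /\ avoids s (par_mu a b)
  end.

(* In [FACBox a A C p], A and C are not in the scope of a: their real variables
   are read in the initial state. *)
Fixpoint adm (s : list (VR * poly)) (p : fml) : Prop :=
  match p with
  | FNot p => adm s p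
  | FAnd p q | FOr p q | FImp p q => adm s p /\ adm s q
  | FAll z p | FEx z p =>
      let s' := sminus s [z] in
      adm s' p /\ no_capture s' (fv p) [z]
  | FBox a p =>
      let s' := sminus s (mbv a) in
      adm_prog s a /\ adm s' p /\ no_capture s' (fv p) (bv a)
  | FACBox a A C p =>
      let s' := sminus s (mbv a) in
      adm_prog s a /\ adm s A /\ adm s C /\
      adm s' p /\ no_capture s' (fv p) (bv a)
  | _ => True
  end.

Definition ren_tvar (h h0 g : VT) : VT := if sVT_dec g h then h0 else g.

Definition ren_var (h h0 : VT) (z : var) : var :=
  match z with VarT g => VarT (ren_tvar h h0 g) | _ => z end.

Fixpoint ren_ttm (h h0 : VT) (te : ttm) : ttm :=
  match te with
  | TVar g => TVar (ren_tvar h h0 g)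
  | TEps => TEps
  | TItem ch th1 th2 => TItem ch th1 th2
  | TCat a b => TCat (ren_ttm h h0 a) (ren_ttm h h0 b)
  | TProj a Y => TProj (ren_ttm h h0 a) Y
  end.

Fixpoint ren_itm (h h0 : VT) (ie : itm) : itm :=
  match ie with
  | IVar n => IVar n
  | IZero => IZero
  | IOne => IOne
  | IAdd a b => IAdd (ren_itm h h0 a) (ren_itm h h0 b)
  | ILen te => ILen (ren_ttm h h0 te)
  end.

Definition ren_ctm (h h0 : VT) (ce : ctm) : ctm :=
  match ce with
  | CName ch => CName ch
  | CChan te ie => CChan (ren_ttm h h0 te) (ren_itm h h0 ie)
  end.

Fixpoint ren_rtm (h h0 : VT) (e : rtm) : rtm :=
  match e with
  | RVar x => RVar x
  | RConst c => RConst c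
  | RAdd a b => RAdd (ren_rtm h h0 a) (ren_rtm h h0 b)
  | RMul a b => RMul (ren_rtm h h0 a) (ren_rtm h h0 b)
  | RVal te ie => RVal (ren_ttm h h0 te) (ren_itm h h0 ie)
  | RTime te ie => RTime (ren_ttm h h0 te) (ren_itm h h0 ie)
  end.

Fixpoint ren_prog (h h0 : VT) (a : prog) : prog :=
  match a with
  | PSeq a b => PSeq (ren_prog h h0 a) (ren_prog h h0 b)
  | PChoice a b => PChoice (ren_prog h h0 a) (ren_prog h h0 b)
  | PLoop a => PLoop (ren_prog h h0 a)
  | PSend ch g th => PSend ch (ren_tvar h h0 g) th
  | PRecv ch g x => PRecv ch (ren_tvar h h0 g) x
  | PPar a b => PPar (ren_prog h h0 a) (ren_prog h h0 b)
  | _ => a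
  end.

Fixpoint ren (h h0 : VT) (p : fml) : fml :=
  match p with
  | FEqR a b => FEqR (ren_rtm h h0 a) (ren_rtm h h0 b)
  | FEqI a b => FEqI (ren_itm h h0 a) (ren_itm h h0 b)
  | FEqC a b => FEqC (ren_ctm h h0 a) (ren_ctm h h0 b)
  | FEqT a b => FEqT (ren_ttm h h0 a) (ren_ttm h h0 b)
  | FGeR a b => FGeR (ren_rtm h h0 a) (ren_rtm h h0 b)
  | FGeI a b => FGeI (ren_itm h h0 a) (ren_itm h h0 b)
  | FPre a b => FPre (ren_ttm h h0 a) (ren_ttm h h0 b)
  | FNot p => FNot (ren h h0 p)
  | FAnd p q => FAnd (ren h h0 p) (ren h h0 q)
  | FOr p q => FOr (ren h h0 p) (ren h h0 q)
  | FImp p q => FImp (ren h h0 p) (ren h h0 q)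
  | FAll z p => FAll (ren_var h h0 z) (ren h h0 p)
  | FEx z p => FEx (ren_var h h0 z) (ren h h0 p)
  | FBox a p => FBox (ren_prog h h0 a) (ren h h0 p)
  | FACBox a A C p =>
      FACBox (ren_prog h h0 a) (ren h h0 A) (ren h h0 C) (ren h h0 p)
  end.

Definition no_interference (a b : prog) (A C p : fml) : Prop :=
  (forall z, In z (vinter (fv p) (bv b)) -> z = VarR mu \/ is_tvar z) /\
  (forall q, q = A \/ q = C ->
     forall z, In z (vinter (fv q) (bv b)) -> is_tvar z) /\
  (forall q, q = A \/ q = C \/ q = p ->
     forall c, cn q c -> In c (cn_prog b) -> In c (cn_prog a)).

(* [ys] lists polynomials in [t] that express, for every initial state v, the
   solution of the differential equations [l] from v for all times r >= 0. *)
Definition solution (t : VR) (l ys : list (VR * poly)) : Prop :=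
  map fst ys = map fst l /\
  forall v : state,
    (forall x y, In (x, y) ys -> ev_poly y (updR v t 0) = st_R v x) /\
    (forall r, 0 <= r -> forall x y th, In (x, y) ys -> In (x, th) l ->
       derivable_pt_lim (fun r' => ev_poly y (updR v t r')) r
         (ev_poly th (assign ys (updR v t r)))).

Definition add_time (l : list (VR * poly)) : list (VR * poly) :=
  if in_dec (@sVR_dec Sg) mu (map fst l) then l else (mu, PConst 1%Q) :: l.

Definition forall_list (zs : list var) (p : fml) : fml := fold_right FAll p zs.

Definition is_closure (p q : fml) : Prop :=
  exists zs, NoDup zs /\ (forall z, In z zs <-> In z (fv p)) /\
    q = forall_list zs p.

Inductive axiom : fml -> Prop :=
| ax_assign l p :
    adm l p ->
    axiom (FIff (FBox (PAssign l) p) (subst l p))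
| ax_any x p :
    axiom (FIff (FBox (PAny x) p) (FAll (VarR x) p))
| ax_test chi p :
    axiom (FIff (FBox (PTest chi) p) (FImp (fml_of_fora chi) p))
| ax_box a p :
    axiom (FIff (FBox a p) (FACBox a FTrue FTrue p))
| ax_seq a b A C p :
    axiom (FIff (FACBox (PSeq a b) A C p) (FACBox a A C (FACBox b A C p)))
| ax_choice a b A C p :
    axiom (FIff (FACBox (PChoice a b) A C p)
                (FAnd (FACBox a A C p) (FACBox b A C p)))
| ax_unfold a A C p :
    axiom (FIff (FACBox (PLoop a) A C p)
                (FAnd (FACBox (PPow a 0) A C p)
                      (FACBox a A C (FACBox (PLoop a) A C p))))
| ax_induction a A C p :
    axiom (FIff (FACBox (PLoop a) A C p)
                (FAnd (FACBox (PPow a 0) A C p)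
                      (FACBox (PLoop a) A FTrue (FImp p (FACBox a A C p)))))
| ax_time l chi p :
    axiom (FIff (FBox (PODE l chi) p) (FBox (PODE (add_time l) chi) p))
| ax_solve l ys t p :
    In mu (map fst l) ->
    ~ In (VarR t) (occ (FBox (PODE l ATrue) p)) ->
    solution t l ys ->
    axiom (FIff (FBox (PODE l ATrue) p)
                (FAll (VarR t) (FImp (FGeR (RVar t) (RConst 0%Q))
                                     (FBox (PAssign ys) p))))
| ax_send ch h th h0 p :
    ~ In (VarT h0) (occ (FBox (PSend ch h th) p)) ->
    axiom (FIff (FBox (PSend ch h th) p)
                (FAll (VarT h0)
                   (FImp (FEqT (TVar h0) (TCat (TVar h) (TItem ch th (PVar mu))))
                         (ren h h0 p))))
| ax_acsend ch h th A C p :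
    axiom (FIff (FACBox (PSend ch h th) A C p)
                (FAnd C (FImp A (FBox (PSend ch h th) (FAnd C (FImp A p))))))
(* If x is mu, the communication on the left is stamped with the time before
   the input, but the one on the right with the received value. *)
| ax_acrecv ch h x A C p :
    x <> mu ->
    axiom (FIff (FACBox (PRecv ch h x) A C p)
                (FBox (PAny x) (FACBox (PSend ch h (PVar x)) A C p)))
| ax_assumption_closure a A A1 A2 C1 C2 p K :
    is_closure (FAnd (FImp (FAnd A C1) A2) (FImp (FAnd A C2) A1)) K ->
    axiom (FImp (FAnd K (FACBox a (FAnd A1 A2) (FAnd C1 C2) p))
                (FACBox a A (FAnd C1 C2) p))
| ax_par a b A C p :
    no_interference a b A C p ->
    axiom (FImp (FACBox a A C p) (FACBox (PPar a b) A C p))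
| ax_no_com a A C p :
    cn_prog a = [] ->
    axiom (FIff (FACBox a A C p) (FAnd C (FImp A (FBox a p))))
| ax_weaken a A C p :
    axiom (FIff (FACBox a A C p)
                (FAnd C (FACBox a A C (FAnd C (FImp A p)))))
| ax_and a A C1 C2 p1 p2 :
    axiom (FIff (FACBox a A (FAnd C1 C2) (FAnd p1 p2))
                (FAnd (FACBox a A C1 p1) (FACBox a A C2 p2))).

Inductive rule : list fml -> fml -> Prop :=
| rule_mono a A1 A2 C1 C2 p1 p2 :
    rule [FImp A2 A1; FImp C1 C2; FImp p1 p2]
         (FImp (FACBox a A1 C1 p1) (FACBox a A2 C2 p2))
| rule_nec a A C p :
    rule [FAnd C p] (FACBox a A C p).

End dLCHP.

Arguments var : clear implicits.
Arguments poly : clear implicits.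
Arguments fora : clear implicits.
Arguments prog : clear implicits.
Arguments fml : clear implicits.
Arguments state : clear implicits.

(* Main.v *)
(* Everything rests on one simulation: if v0 agrees with the substituted state
   [assign s v] on the free variables of a program (formula), then the program
   (formula) behaves from v0 as its substitution instance does from v.  For
   s = [] this is the coincidence property.  Formulas may moreover observe
   traces only through the channels they access, which gives the parallel axiom:
   restricting a trace to the channels of a removes only events that the
   contract of a cannot see.  Loops are sequences of powers, the assumption
   closure axiom is an induction along the prefixes of a trace, and the solution
   axiom needs uniqueness for polynomial differential equations, obtained from a
   Gronwall estimate for the squared distance of two solutions. *)
From Stdlib Require Import Reals QArith Qreals List ListSet Sorted Lra Lia.
From Stdlib Require Import FunctionalExtensionality.
Require Import Defs.
Import ListNotations.
Set Implicit Arguments.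
Unset Strict Implicit.
Unset Printing Implicit Defensive.
Local Open Scope R_scope.

(** Related runs have equal traces; only their final states are related, on the real variables that
    agreed initially or are must-bound. This is the invariant that makes subtracting must-bound
    variables in [fv_prog] and [fv] legitimate. Recorders escape it, because [sem] leaves them
    untouched and [append] extends them afterwards. Hence nested boxes start the second program with
    a longer history than sequential composition does, and the two have to be reconciled. Parallel
    composition is delicate at [mu], the only real variable that both components may bind: whether
    the final clocks match must have the same answer on both sides of the simulation. For
    assumption-commitment boxes the subtle point is that commitments rely on proper prefixes and
    postconditions on all prefixes, so composition has to distinguish whether the second program
    contributed an event. For differential equations, derivatives are relative to [[0, s]], and
    polynomials are Lipschitz on bounded sets only, so solutions are first bounded by
    compactness. *)

Section Sets.
Context {T : Type} (dec : forall x y : T, {x = y} + {x <> y}).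

Lemma In_union z X Y : In z (set_union dec X Y) <-> In z X \/ In z Y.
Proof. exact (set_union_iff dec z X Y). Qed.

Lemma In_inter z X Y : In z (set_inter dec X Y) <-> In z X /\ In z Y.
Proof. exact (set_inter_iff dec z X Y). Qed.

Lemma In_diff z X Y : In z (set_diff dec X Y) <-> In z X /\ ~ In z Y.
Proof. exact (set_diff_iff dec z X Y). Qed.

End Sets.

#[local] Arguments set_union {A} _ _ _ : simpl never.
#[local] Arguments set_inter {A} _ _ _ : simpl never.
#[local] Arguments set_diff {A} _ _ _ : simpl never.

Ltac insimp :=
  repeat first [ rewrite In_union in * | rewrite In_inter in *
               | rewrite In_diff in * | rewrite in_app_iff in * ].

(** * Prefixes and proper prefixes of lists *)

Section Prefixes.
Context {T : Type}.
Implicit Types s t : list T.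

Lemma prefix_refl t : prefix t t.
Proof. exists []; now rewrite app_nil_r. Qed.

Lemma prefix_nil t : prefix t [] -> t = [].
Proof. intros [r E]; symmetry in E; now apply app_eq_nil in E. Qed.

Lemma prefix_app_l s t r : prefix s t -> prefix s (t ++ r).
Proof. intros [q ->]; exists (q ++ r); now rewrite app_assoc. Qed.

Lemma prefix_app_r s t r : prefix t r -> prefix (s ++ t) (s ++ r).
Proof. intros [q ->]; exists q; now rewrite app_assoc. Qed.

Lemma prefix_trans s t r : prefix s t -> prefix t r -> prefix s r.
Proof. intros P [q ->]; now apply prefix_app_l. Qed.

Lemma prefix_app_inv q s t :
  prefix q (s ++ t) -> prefix q s \/ exists t', q = s ++ t' /\ prefix t' t.
Proof.
intros [r E]. apply app_eq_app in E as [l [[-> ->]|[-> ->]]].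
- left; now exists l.
- right; exists l; split; [reflexivity | now exists r].
Qed.

Lemma prefix_length s t : prefix s t -> (length s <= length t)%nat.
Proof. intros [r ->]; rewrite length_app; lia. Qed.

Lemma prefix_app_self s r : prefix (s ++ r) s -> r = [].
Proof.
intros P; apply prefix_length in P; rewrite length_app in P.
destruct r; [reflexivity | simpl in P; lia].
Qed.

Lemma pprefix_length s t : pprefix s t -> (length s < length t)%nat.
Proof.
intros [[r ->] N]; rewrite length_app.
destruct r; [now rewrite app_nil_r in N | simpl; lia].
Qed.

Lemma pprefix_trans_r s t r : pprefix s t -> prefix t r -> pprefix s r.
Proof.
intros P Q; split; [exact (prefix_trans (proj1 P) Q)|].
intros ->; apply pprefix_length in P; apply prefix_length in Q; lia.
Qed.

Lemma prefix_pprefix s t : prefix s t -> s = t \/ pprefix s t.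
Proof.
intros [r ->]; destruct r as [|e r]; [left; now rewrite app_nil_r|].
right; split; [now exists (e :: r)|].
intros E; apply (f_equal (@length T)) in E; rewrite length_app in E.
simpl in E; lia.
Qed.

(** Once the second program has contributed an event, strict assumptions on the whole trace give the
    non-strict ones under which the first program's postcondition is available. *)
Lemma pprefix_app_l s t r : r <> [] -> prefix s t -> pprefix s (t ++ r).
Proof.
intros N P; destruct (prefix_pprefix (prefix_app_l r P)) as [->|Q]; [|exact Q].
now destruct N; apply (prefix_app_self (s := t)).
Qed.

Lemma pprefix_app_r s t r : pprefix t r -> pprefix (s ++ t) (s ++ r).
Proof.
intros [P N]; split; [now apply prefix_app_r|].
intros E; apply N; exact (app_inv_head _ _ _ E).
Qed.

End Prefixes.

(** * Frame, channel and prefix properties of programs *)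

Section Semantics.
Context {Sg : signature}.
Implicit Types (v u : state Sg) (tau : rtrace (Sg := Sg)).

Lemma state_eq v w :
  (forall x, st_R v x = st_R w x) -> (forall n, st_N v n = st_N w n) ->
  (forall h, st_T v h = st_T w h) -> v = w.
Proof.
destruct v as [r n t], w as [r' n' t']; simpl; intros E F G.
apply functional_extensionality in E, F, G; now subst.
Qed.

Lemma rec_by_app h tau1 tau2 :
  rec_by h (tau1 ++ tau2) = rec_by h tau1 ++ rec_by h tau2.
Proof. unfold rec_by; now rewrite filter_app, map_app. Qed.

Lemma append_nil v : append v [] = v.
Proof. apply state_eq; intros; simpl; trivial; apply app_nil_r. Qed.

Lemma append_app v tau1 tau2 :
  append (append v tau1) tau2 = append v (tau1 ++ tau2).
Proof. apply state_eq; intros; simpl; rewrite ?rec_by_app, ?app_assoc; trivial. Qed.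

Lemma In_lhs x (l : list (sVR Sg * poly Sg)) :
  In (VarR x) (lhs l) <-> In x (map fst l).
Proof.
unfold lhs; rewrite !in_map_iff; split; intros [p [E I]]; exists p; split; trivial;
  congruence.
Qed.

Lemma In_lhs_real z (l : list (sVR Sg * poly Sg)) :
  In z (lhs l) -> exists x, z = VarR x.
Proof. unfold lhs; rewrite in_map_iff; intros [p [<- _]]; now exists (fst p). Qed.

Lemma lookup_notin x (l : list (sVR Sg * poly Sg)) :
  ~ In x (map fst l) -> subst_lookup l x = PVar x.
Proof.
induction l as [|[y th] l IH]; simpl; [reflexivity|].
intros N; destruct (sVR_dec y x); [subst; destruct N; now left | apply IH; tauto].
Qed.

Lemma lookup_in x (l : list (sVR Sg * poly Sg)) :
  In x (map fst l) -> In (x, subst_lookup l x) l.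
Proof.
induction l as [|[y th] l IH]; simpl; [trivial|].
destruct (sVR_dec y x) as [->|N]; [now left|].
intros [E|I]; [now destruct N | right; now apply IH].
Qed.

Lemma lookup_dec x (l : list (sVR Sg * poly Sg)) :
  In (x, subst_lookup l x) l \/ (~ In x (map fst l) /\ subst_lookup l x = PVar x).
Proof.
destruct (in_dec (@sVR_dec Sg) x (map fst l)) as [I|N].
- left; now apply lookup_in.
- right; split; trivial; now apply lookup_notin.
Qed.

Lemma lookup_sminus x (l : list (sVR Sg * poly Sg)) X :
  subst_lookup (sminus l X) x =
  if in_dec (@var_dec Sg) (VarR x) X then PVar x else subst_lookup l x.
Proof.
induction l as [|[y th] l IH]; simpl.
- now destruct in_dec.
- destruct (in_dec _ (VarR y) X) as [I|N]; simpl; rewrite ?IH;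
    destruct (sVR_dec y x) as [->|D]; trivial; now destruct in_dec.
Qed.

Lemma sminus_nil (l : list (sVR Sg * poly Sg)) : sminus l [] = l.
Proof. induction l as [|p l IH]; simpl; [reflexivity | now rewrite IH]. Qed.

Lemma ev_poly_ext th v w :
  (forall x, In (VarR x) (fv_poly th) -> st_R v x = st_R w x) ->
  ev_poly th v = ev_poly th w.
Proof.
induction th; simpl; intros E; [now apply E; left | trivial | |];
  rewrite IHth1, IHth2; trivial; intros; apply E; insimp; tauto.
Qed.

Lemma ev_subst_poly s th v :
  ev_poly (subst_poly s th) v = ev_poly th (assign s v).
Proof. induction th; simpl; congruence. Qed.

Lemma ev_rtm_of_poly th v : ev_rtm (rtm_of_poly th) v = ev_poly th v.
Proof. induction th; simpl; congruence. Qed.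

Lemma sat_fml_of_fora chi v : sat (fml_of_fora chi) v <-> sat_fora chi v.
Proof.
revert v; induction chi; intros v; simpl; rewrite ?ev_rtm_of_poly; try tauto;
  try (rewrite ?IHchi, ?IHchi1, ?IHchi2; tauto).
- split; intros H d; now apply IHchi, H.
- split; intros [d H]; exists d; now apply IHchi, H.
Qed.

(* [sem] never touches the trace variables: their update is deferred to [append]. *)
Definition frame (X : list (var Sg)) v w : Prop :=
  st_N w = st_N v /\ st_T w = st_T v /\
  forall x, ~ In (VarR x) X -> st_R w x = st_R v x.

Lemma frame_refl X v : frame X v v.
Proof. repeat split. Qed.

Lemma frame_mono X Y v w : incl X Y -> frame X v w -> frame Y v w.
Proof. intros S [N [T R]]; repeat split; auto. Qed.

Lemma frame_trans X u v w : frame X u v -> frame X v w -> frame X u w.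
Proof.
intros [N [T R]] [N' [T' R']]; split; [|split]; [congruence..|].
intros x I; rewrite R', R; trivial.
Qed.

Lemma ode_run_frame l chi s (phi : R -> state Sg) r :
  0 <= r <= s -> ode_run l chi s phi ->
  frame (set_union (@var_dec Sg) (lhs l) [VarR (smu Sg)]) (phi 0) (phi r).
Proof.
intros J O; pose proof (O r J) as [_ [_ [_ O']]].
assert (B : forall z, In z (set_union (@var_dec Sg) (lhs l) [VarR (smu Sg)]) ->
  exists x, z = VarR x).
{ intros z I; insimp; destruct I as [I|[<-|[]]]; [exact (In_lhs_real I) | eauto]. }
repeat split.
- apply functional_extensionality; intros n; apply (O' (VarN n)).
  intros I; now apply B in I as [? ?].
- apply functional_extensionality; intros n; apply (O' (VarT n)).
  intros I; now apply B in I as [? ?].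
- intros x; apply (O' (VarR x)).
Qed.

Lemma sem_frame a v tau w : sem a v tau (Some w) -> frame (bv a) v w.
Proof.
revert v tau w; induction a; intros v tau w; cbn [sem].
- intros [[_ E]|[_ [= ->]]]; [discriminate|].
  repeat split; simpl; intros x I; rewrite In_lhs in I.
  now rewrite lookup_notin.
- intros [[_ E]|[_ [d [= ->]]]]; [discriminate|].
  repeat split; simpl; intros y I; destruct sVR_dec; [subst; destruct I; now left | trivial].
- intros [[_ E]|[_ [s [phi [S [O [-> [= ->]]]]]]]]; [discriminate|].
  apply (ode_run_frame (r := s)) in O; [exact O | lra].
- intros [[_ E]|[_ [[= ->] _]]]; [discriminate | apply frame_refl].
- intros [[E _]|(tau1 & u & tau2 & H1 & H2 & _)]; [discriminate|].
  apply IHa1 in H1; apply IHa2 in H2.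
  apply frame_trans with u; eapply frame_mono; try eassumption;
    intros z; simpl; insimp; tauto.
- intros [H|H]; [apply IHa1 in H | apply IHa2 in H];
    (eapply frame_mono; [|exact H]); intros z; simpl; insimp; tauto.
- intros [n H]; revert v tau w H; induction n as [|n IH]; intros v tau w; simpl.
  + intros [[_ E]|[_ [[= ->] _]]]; [discriminate | apply frame_refl].
  + intros [[E _]|(tau1 & u & tau2 & H1 & H2 & _)]; [discriminate|].
    exact (frame_trans (IHa _ _ _ H1) (IH _ _ _ H2)).
- intros [[[= ->] _]|[E _]]; [apply frame_refl | discriminate].
- intros [d [[[= ->] _]|[E _]]]; [|discriminate].
  repeat split; simpl; intros y I; destruct sVR_dec; [subst; destruct I; right; now left | trivial].
- intros (wa & wb & H1 & H2 & _ & _ & _ & E).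
  destruct wa as [wa|], wb as [wb|]; try discriminate; injection E as ->.
  apply IHa1 in H1 as [N1 [T1 R1]]; apply IHa2 in H2 as [N2 [T2 R2]].
  repeat split; simpl.
  + apply functional_extensionality; intros n; rewrite N1, N2; now destruct in_dec.
  + apply functional_extensionality; intros n; rewrite T1, T2; now destruct in_dec.
  + intros x I; insimp; destruct in_dec; [tauto|]; apply R2; tauto.
Qed.

Lemma mem_chan_In Y (c : sChan Sg) : mem_chan Y c = true <-> In c Y.
Proof. unfold mem_chan; destruct in_dec; split; congruence || trivial. Qed.

Lemma rproj_app Y tau1 tau2 : rproj Y (tau1 ++ tau2) = rproj Y tau1 ++ rproj Y tau2.
Proof. apply filter_app. Qed.

Lemma sem_chan a v tau w e :
  sem a v tau w -> In e tau -> In (ev_ch (snd e)) (cn_prog a).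
Proof.
revert v tau w; induction a; intros v tau w; cbn [sem cn_prog].
- intros [[-> _]|[-> _]] [].
- intros [[-> _]|[-> _]] [].
- intros [[-> _]|[-> _]] [].
- intros [[-> _]|[-> _]] [].
- intros [[_ [w' H]]|(tau1 & u & tau2 & H1 & H2 & ->)] I; insimp.
  + left; eauto.
  + destruct I; eauto.
- intros [H|H] I; insimp; eauto.
- intros [n H]; revert v tau w H; induction n as [|n IH]; intros v tau w; simpl.
  + intros [[-> _]|[-> _]] [].
  + intros [[_ [w' H]]|(tau1 & u & tau2 & H1 & H2 & ->)] I; insimp; [eauto|].
    destruct I; eauto.
- intros [[_ ->]|[_ P]] I; [|destruct P as [r E]; assert (J := in_or_app _ r _ (or_introl I));
  rewrite <- E in J; clear I; rename J into I]; destruct I as [<-|[]]; now left.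
- intros [d [[_ ->]|[_ P]]] I; [|destruct P as [r E]; assert (J := in_or_app _ r _ (or_introl I));
  rewrite <- E in J; clear I; rename J into I]; destruct I as [<-|[]]; now left.
- intros (wa & wb & _ & _ & _ & _ & E & _) I; rewrite E in I.
  now apply filter_In in I as [_ I]; apply mem_chan_In in I.
Qed.

(** Since the empty trace has no proper prefix, this run forces the commitment in the initial state:
    the conjunct [C] of several axioms. *)
Lemma sem_nil a v : sem a v [] None.
Proof.
revert v; induction a; intros v; cbn [sem]; try (left; now split).
- left; split; [reflexivity|]; now exists None.
- now left.
- exists O; left; now split.
- right; split; [reflexivity|]; now eexists.
- exists 0; right; split; [reflexivity|]; now eexists.
- exists None, None; repeat split; trivial; constructor.
Qed.

Lemma chronological_app_l tau1 tau2 :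
  chronological (tau1 ++ tau2) -> chronological tau1.
Proof.
unfold chronological; rewrite map_app.
induction (map _ tau1) as [|t ts IH]; simpl; intros H; [constructor|].
apply StronglySorted_inv in H as [H F]; constructor; [now apply IH|].
now apply Forall_app in F.
Qed.

(** A trace equals its projection exactly when all its events pass the filter, and a prefix inherits
    that. *)
Lemma rproj_fix_app_l Y tau1 tau2 :
  tau1 ++ tau2 = rproj Y (tau1 ++ tau2) -> tau1 = rproj Y tau1.
Proof.
intros E; assert (A : forall e, In e tau1 -> mem_chan Y (ev_ch (snd e)) = true).
{ intros e I; assert (J : In e (tau1 ++ tau2)) by (apply in_app_iff; tauto).
  rewrite E in J; now apply filter_In in J. }
clear E; induction tau1 as [|e tau1 IH]; simpl; [trivial|].
rewrite A by now left.
now rewrite <- IH by (intros; apply A; now right).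
Qed.

(** In a composition a prefix either ends within the first program's trace, whose run is then
    abandoned, or continues into the second; projecting to a component's channels maps prefixes to
    prefixes. The shorter runs are those over which the assumption closure axiom inducts. *)
Lemma sem_prefix a v tau tau' w :
  sem a v tau w -> prefix tau' tau -> sem a v tau' None.
Proof.
revert v tau tau' w; induction a; intros v tau tau' w; cbn [sem].
- intros [[-> _]|[-> _]] P; left; split; trivial; now apply prefix_nil.
- intros [[-> _]|[-> _]] P; left; split; trivial; now apply prefix_nil.
- intros [[-> _]|[-> _]] P; left; split; trivial; now apply prefix_nil.
- intros [[-> _]|[-> _]] P; left; split; trivial; now apply prefix_nil.
- intros [[_ [w' H]]|(tau1 & u & tau2 & H1 & H2 & ->)] P.
  + left; split; trivial; exists None; eauto.
  + apply prefix_app_inv in P as [P|(t & -> & P)].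
    * left; split; trivial; exists None; eauto.
    * right; exists tau1, u, t; eauto.
- intros [H|H] P; eauto.
- intros [n H] P; exists n; revert v tau tau' w H P.
  induction n as [|n IH]; intros v tau tau' w; simpl.
  + intros [[-> _]|[-> _]] P; left; split; trivial; now apply prefix_nil.
  + intros [[_ [w' H]]|(tau1 & u & tau2 & H1 & H2 & ->)] P.
    * left; split; trivial; exists None; eauto.
    * apply prefix_app_inv in P as [P|(t & -> & P)].
      -- left; split; trivial; exists None; eauto.
      -- right; exists tau1, u, t; eauto.
- intros [[_ ->]|[_ Q]] P; right; split; trivial; exact (prefix_trans P Q).
- intros [d [[_ ->]|[_ Q]]] P; exists d; right; split; trivial;
    exact (prefix_trans P Q).
- intros (wa & wb & H1 & H2 & _ & S & E & _) [r ->].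
  exists None, None; repeat split.
  + eapply IHa1; [exact H1|]; rewrite rproj_app; now eexists.
  + eapply IHa2; [exact H2|]; rewrite rproj_app; now eexists.
  + exact (chronological_app_l S).
  + exact (rproj_fix_app_l E).
Qed.

End Semantics.

(** * Substitution in programs *)

Section Simulation.
Context {Sg : signature}.
Implicit Types (v u : state Sg) (tau : rtrace (Sg := Sg)).

Lemma In_sminus x th (s : list (sVR Sg * poly Sg)) X :
  In (x, th) (sminus s X) <-> In (x, th) s /\ ~ In (VarR x) X.
Proof. unfold sminus; rewrite filter_In; cbn [fst]; destruct in_dec; intuition congruence. Qed.

Definition orel (Q : state Sg -> state Sg -> Prop) (w w0 : option (state Sg)) : Prop :=
  match w, w0 with
  | Some w, Some w0 => Q w w0
  | None, None => True
  | _, _ => False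
  end.

(** Both directions are required because boxes quantify over all runs and formulas are to be
    transferred as equivalences. *)
Definition bisim (Q : state Sg -> state Sg -> Prop) (U U0 : denot) v v0 : Prop :=
  (forall tau w, U v tau w -> exists w0, U0 v0 tau w0 /\ orel Q w w0) /\
  (forall tau w0, U0 v0 tau w0 -> exists w, U v tau w /\ orel Q w w0).

Lemma orel_mono (Q Q' : state Sg -> state Sg -> Prop) w w0 :
  (forall w w0, Q w w0 -> Q' w w0) -> orel Q w w0 -> orel Q' w w0.
Proof. destruct w, w0; simpl; auto. Qed.

Lemma bisim_mono (Q Q' : state Sg -> state Sg -> Prop) U U0 v v0 :
  (forall w w0, Q w w0 -> Q' w w0) -> bisim Q U U0 v v0 -> bisim Q' U U0 v v0.
Proof.
intros S [F B]; split.
- intros tau w H; destruct (F _ _ H) as [w0 [H0 O]]; eauto using orel_mono.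
- intros tau w H; destruct (B _ _ H) as [w0 [H0 O]]; eauto using orel_mono.
Qed.

(** The second simulation is demanded only between states actually reached, so that the frame
    property of the first program can be used to establish it. *)
Lemma bisim_seq Q1 Q2 (U U0 M M0 : denot) v v0 :
  bisim Q1 U U0 v v0 ->
  (forall tau w w0, U v tau (Some w) -> U0 v0 tau (Some w0) -> Q1 w w0 ->
     bisim Q2 M M0 w w0) ->
  bisim Q2 (sem_seq U M) (sem_seq U0 M0) v v0.
Proof.
intros [F B] S; split; intros tau w [[-> [w' H]]|(tau1 & u & tau2 & H1 & H2 & ->)].
- destruct (F _ _ H) as [w0 [H0 _]]; exists None; split; [|exact I].
  left; split; [reflexivity | now exists w0].
- destruct (F _ _ H1) as [[u0|] [H0 O]]; [|destruct O].
  destruct (S _ _ _ H1 H0 O) as [F2 _]; destruct (F2 _ _ H2) as [w0 [H3 O3]].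
  exists w0; split; [|exact O3]; right; now exists tau1, u0, tau2.
- destruct (B _ _ H) as [w0 [H0 _]]; exists None; split; [|exact I].
  left; split; [reflexivity | now exists w0].
- destruct (B _ _ H1) as [[u0|] [H0 O]]; [|destruct O].
  destruct (S _ _ _ H0 H1 O) as [_ F2]; destruct (F2 _ _ H2) as [w0 [H3 O3]].
  exists w0; split; [|exact O3]; right; now exists tau1, u0, tau2.
Qed.

Lemma bisim_test (Q : state Sg -> state Sg -> Prop) chi chi0 v v0 :
  Q v v0 -> (sat_fora chi v <-> sat_fora chi0 v0) ->
  bisim Q (sem_test chi) (sem_test chi0) v v0.
Proof.
intros q E; split; intros tau w [[-> ->]|(-> & -> & H)].
- exists None; split; [left; now split | exact I].
- exists (Some v0); split; [right; tauto | exact q].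
- exists None; split; [left; now split | exact I].
- exists (Some v); split; [right; tauto | exact q].
Qed.

(** A real variable of the final states is either inherited from an initial value or written on
    every terminating run; these are the two disjuncts. Variables that may, but need not, be written
    are covered only if they agreed initially. *)
Definition track (a : prog Sg) v v0 w w0 : Prop :=
  forall x, st_R v0 x = st_R v x \/ In (VarR x) (mbv a) -> st_R w0 x = st_R w x.

(** Variables in [Y] are must-bound, hence agree by [track]. A variable that is still replaced is
    not written by [a], nor are the variables of its replacement, so its equation persists. Any
    other variable agreed initially. [Y] is [mbv a] for compositions and boxes, and empty for loops
    and differential equations. *)
Lemma track_step a s X Y v v0 w w0 :
  no_capture (sminus s Y) X (bv a) -> incl Y (mbv a) ->
  frame (bv a) v w -> frame (bv a) v0 w0 -> track a v v0 w w0 ->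
  (forall x, In (VarR x) X -> ~ In (VarR x) Y -> st_R v0 x = st_R (assign s v) x) ->
  forall x, In (VarR x) X -> st_R w0 x = st_R (assign (sminus s Y) w) x.
Proof.
intros N S [_ [_ F]] [_ [_ F0]] T E x I; simpl; rewrite lookup_sminus.
destruct in_dec as [J|J]; [apply T; right; auto|].
specialize (E x I J); simpl in E.
destruct (lookup_dec x s) as [D|[_ D]].
- destruct (N x (subst_lookup s x)) as [B C].
  { now apply In_sminus. }
  { exact I. }
  rewrite F0, E by exact B; apply ev_poly_ext; intros y K; symmetry; now apply F, C.
- rewrite D in *; simpl in *; apply T; now left.
Qed.

Lemma bv_subst_prog s (a : prog Sg) : bv (subst_prog s a) = bv a.
Proof.
revert s; induction a; intros s; simpl; try congruence;
  unfold lhs, subst_rhs; now rewrite map_map.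
Qed.

Lemma cn_subst_prog s (a : prog Sg) : cn_prog (subst_prog s a) = cn_prog a.
Proof. revert s; induction a; intros s; simpl; congruence. Qed.

Lemma lookup_subst_rhs s (l : list (sVR Sg * poly Sg)) x :
  In x (map fst l) -> subst_lookup (subst_rhs s l) x = subst_poly s (subst_lookup l x).
Proof.
induction l as [|[y th] l IH]; simpl; [tauto|].
destruct sVR_dec; [trivial|]; intros [E|I]; [now destruct n | auto].
Qed.

Lemma fst_subst_rhs s (l : list (sVR Sg * poly Sg)) :
  map fst (subst_rhs s l) = map fst l.
Proof. unfold subst_rhs; now rewrite map_map. Qed.

Lemma lhs_subst_rhs s (l : list (sVR Sg * poly Sg)) : lhs (subst_rhs s l) = lhs l.
Proof. unfold lhs, subst_rhs; now rewrite map_map. Qed.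

Lemma fv_rhs_In (l : list (sVR Sg * poly Sg)) x th z :
  In (x, th) l -> In z (fv_poly th) -> In z (fv_rhs l).
Proof.
induction l as [|[y th'] l IH]; simpl; [tauto|].
intros [[= -> ->]|I] J; insimp; auto.
Qed.

Lemma mbv_bv (a : prog Sg) : incl (mbv a) (bv a).
Proof.
intros z; induction a; simpl; insimp; tauto.
Qed.

Lemma bv_VarN (a : prog Sg) n : ~ In (VarN n) (bv a).
Proof.
induction a; simpl; insimp; simpl; try intuition discriminate.
- intros H; now apply In_lhs_real in H as [? ?].
- intros [H|[H|[]]]; [now apply In_lhs_real in H as [? ?] | discriminate].
Qed.

(** Recorders are extended rather than overwritten, so communications also count them as free.
    Therefore subtracting must-bound variables loses no trace variable. *)
Lemma mbv_VarT (a : prog Sg) h : In (VarT h) (mbv a) -> In (VarT h) (fv_prog a).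
Proof.
induction a; simpl; insimp; simpl; try tauto.
- intros H; now apply In_lhs_real in H as [? ?].
- intros [H|[]]; discriminate.
- intros [H|[H|[]]]; [now left | discriminate].
Qed.

(** The quantifier counterpart of [track_step], with the bound variable [z] as the only one
    written. *)
Lemma assign_sminus_upd s (z : var Sg) (d : sort_val z) X v v0 :
  no_capture (sminus s [z]) X [z] ->
  (forall x, In (VarR x) X -> VarR x <> z -> st_R v0 x = st_R (assign s v) x) ->
  forall x, In (VarR x) X ->
    st_R (upd v0 d) x = st_R (assign (sminus s [z]) (upd v d)) x.
Proof.
intros N E x I; simpl; rewrite lookup_sminus.
destruct in_dec as [[->|[]]|J]; simpl.
{ now destruct sVR_dec. }
assert (Hx : VarR x <> z) by (intros <-; apply J; now left).
assert (U : forall u y, VarR y <> z -> st_R (upd u d) y = st_R u y).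
{ intros u y D; destruct z; simpl; trivial; destruct sVR_dec; [subst; now destruct D|trivial]. }
rewrite U, E by trivial; simpl.
destruct (lookup_dec x s) as [D|[_ D]].
- destruct (N x (subst_lookup s x)) as [B C].
  { now apply In_sminus. }
  { exact I. }
  apply ev_poly_ext; intros y K; symmetry; apply U; intros D'; apply (C _ K); now left.
- rewrite D; simpl; symmetry; now apply U.
Qed.

Lemma ev_subst_agree s th v v0 :
  (forall x, In (VarR x) (fv_poly th) -> st_R v0 x = st_R (assign s v) x) ->
  ev_poly (subst_poly s th) v = ev_poly th v0.
Proof. intros E; rewrite ev_subst_poly; symmetry; now apply ev_poly_ext. Qed.

Lemma sat_subst_fora chi : forall s v v0, adm_fora s chi ->
  (forall x, In (VarR x) (fv_fora chi) -> st_R v0 x = st_R (assign s v) x) ->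
  (sat_fora (subst_fora s chi) v <-> sat_fora chi v0).
Proof.
induction chi; intros s v v0 A E; simpl in *.
1,2: rewrite !(@ev_subst_agree s _ v v0); [tauto | |];
  intros x I; apply E; insimp; tauto.
1: now rewrite (IHchi s v v0).
1-3: rewrite (IHchi1 s v v0), (IHchi2 s v v0); try tauto;
  intros x I; apply E; insimp; tauto.
all: assert (J : forall d, sat_fora (subst_fora (sminus s [VarR x]) chi) (updR v x d) <->
       sat_fora chi (updR v0 x d)).
1,3: intros d; apply IHchi; [tauto|];
  apply (@assign_sminus_upd s (VarR x) d (fv_fora chi)); [tauto|];
  intros y I D; apply E; insimp; split; trivial; intros [F|[]]; congruence.
- split; intros H d; now apply J.
- split; intros [d H]; exists d; now apply J.
Qed.

(** Used to transplant a solution of a differential equation to another initial state: the evolving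
    variables [X] follow the solution, everything else stays as in [v0]. *)
Definition blend (X : list (var Sg)) v v0 : state Sg :=
  State (fun x => if in_dec (@var_dec Sg) (VarR x) X then st_R v x else st_R v0 x)
    (st_N v0) (st_T v0).

(** [D_in] reads the derivative function only at the point itself, so agreement of [d] and [e] there
    suffices. *)
Lemma D_in_ext f g d e D x :
  f = g -> d x = e x -> D_in f d D x -> D_in g e D x.
Proof. unfold D_in, limit1_in; intros <- E; now rewrite E. Qed.

Lemma ode_run_blend l l' chi chi' s phi v0 :
  0 <= s -> lhs l' = lhs l ->
  (forall x, In (VarR x) (set_union (@var_dec Sg) (lhs l) [VarR (smu Sg)]) ->
     st_R v0 x = st_R (phi 0) x) ->
  (forall r, 0 <= r <= s ->
     let u := blend (set_union (@var_dec Sg) (lhs l) [VarR (smu Sg)]) (phi r) v0 in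
     (forall x th', In (x, th') l' -> exists th, In (x, th) l /\
        ev_poly th' u = ev_poly th (phi r)) /\
     (sat_fora chi (phi r) -> sat_fora chi' u)) ->
  ode_run l chi s phi ->
  let psi := fun r => blend (set_union (@var_dec Sg) (lhs l) [VarR (smu Sg)]) (phi r) v0 in
  ode_run l' chi' s psi /\ psi 0 = v0.
Proof.
intros S L E0 E O psi; split.
- intros r J; destruct (E r J) as [E1 E2]; pose proof (O r J) as [D1 [D2 [D3 D4]]].
  split; [|split; [|split]].
  + refine (D_in_ext _ _ D1); [|reflexivity].
    apply functional_extensionality; intros z; unfold psi, blend; simpl.
    destruct in_dec as [I|N]; [trivial|]; destruct N; insimp; right; now left.
  + intros x th' I; destruct (E1 x th' I) as [th [I' Eth]].
    refine (D_in_ext _ _ (D2 x th I')); [|now symmetry].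
    apply functional_extensionality; intros z; unfold psi, blend; simpl.
    destruct in_dec as [I2|N]; [trivial|]; destruct N; insimp; left.
    rewrite In_lhs; exact (in_map fst _ _ I').
  + now apply E2.
  + intros [x|n|h] N; simpl; trivial; rewrite L in N; now destruct in_dec.
- apply state_eq; unfold psi; simpl; trivial; intros x.
  destruct in_dec as [I|N]; [|trivial]; now rewrite E0.
Qed.

Lemma subst_rhs_In s (l : list (sVR Sg * poly Sg)) x th :
  In (x, th) (subst_rhs s l) <-> exists th', th = subst_poly s th' /\ In (x, th') l.
Proof.
unfold subst_rhs; rewrite in_map_iff; split.
- intros [[y th'] [[= <- <-] I]]; eauto.
- intros [th' [-> I]]; exists (x, th'); auto.
Qed.

Theorem sem_subst (a : prog Sg) : forall s v v0,
  wf_prog a -> adm_prog s a ->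
  (forall x, In (VarR x) (fv_prog a) -> st_R v0 x = st_R (assign s v) x) ->
  bisim (track a v v0) (sem (subst_prog s a)) (sem a) v v0.
Proof.
induction a; intros s v v0 W A E; cbn [subst_prog sem wf_prog adm_prog fv_prog] in *.
- assert (K : track (PAssign l) v v0 (assign (subst_rhs s l) v) (assign l v0)).
  { intros x H; simpl.
    destruct (lookup_dec x l) as [I|[I D]].
    - rewrite lookup_subst_rhs by exact (in_map fst _ _ I).
      symmetry; apply ev_subst_agree; intros y J; apply E; exact (fv_rhs_In I J).
    - rewrite (@lookup_notin _ x (subst_rhs s l)) by now rewrite fst_subst_rhs.
      rewrite D; simpl in *; rewrite In_lhs in H; tauto. }
  split; intros tau w [[-> ->]|[-> ->]].
  1,3: exists None; split; [left; now split | exact I].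
  all: eexists (Some _); split; [right; split; reflexivity | exact K].
- assert (K : forall d, track (PAny x) v v0 (updR v x d) (updR v0 x d)).
  { intros d y; simpl; destruct sVR_dec; trivial; intros [H|[H|[]]]; congruence. }
  split; intros tau w [[-> ->]|[-> [d ->]]].
  1,3: exists None; split; [left; now split | exact I].
  all: eexists (Some _); split; [right; split; [reflexivity | now exists d] | apply K].
- set (B := set_union (@var_dec Sg) (lhs l) [VarR (smu Sg)]) in *.
  destruct A as [A1 [A2 A3]].
  assert (E0 : forall x, In (VarR x) B -> st_R v0 x = st_R v x).
  { intros x I; rewrite E by (insimp; tauto); simpl.
    rewrite lookup_notin by now apply A1. reflexivity. }
  (* The agreement needed by right-hand sides and domain constraint persists along the evolution:
     the evolving variables are not replaced and do not occur in the replacements made there. *)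
  assert (EB : forall u u0, frame B v u -> frame B v0 u0 ->
     (forall x, In (VarR x) B -> st_R u0 x = st_R u x) ->
     forall x, In (VarR x) (set_union (@var_dec Sg) (fv_rhs l) (fv_fora chi)) ->
       st_R u0 x = st_R (assign s u) x).
  { intros u u0 F F0 H x I; rewrite <- (sminus_nil s).
    refine (@track_step (PODE l chi) s _ [] v v0 u u0 _ _ F F0 _ _ x I).
    - now rewrite sminus_nil.
    - intros ? [].
    - intros y [D|D]; [|now apply H].
      destruct (in_dec (@var_dec Sg) (VarR y) B) as [K|K]; [now apply H|].
      destruct F as [_ [_ F]], F0 as [_ [_ F0]]; rewrite F, F0; trivial.
    - intros y J _; apply E; insimp; tauto. }
  assert (Q : forall u u0, frame B v u -> frame B v0 u0 ->
     (forall x, In (VarR x) B -> st_R u0 x = st_R u x) -> track (PODE l chi) v v0 u u0).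
  { intros u u0 F F0 H y [D|D]; [|now apply H].
    destruct (in_dec (@var_dec Sg) (VarR y) B) as [K|K]; [now apply H|].
    destruct F as [_ [_ F]], F0 as [_ [_ F0]]; rewrite F, F0; trivial. }
  assert (FB : forall u u', frame B u (blend B u' u)).
  { intros u u'; repeat split; simpl; intros x N; now destruct in_dec. }
  assert (SB : forall u u' x, In (VarR x) B -> st_R (blend B u' u) x = st_R u' x).
  { intros u u' x I; simpl; now destruct in_dec. }
  assert (FO : forall l' chi' t phi r, lhs l' = lhs l -> 0 <= r <= t ->
     ode_run l' chi' t phi -> frame B (phi 0) (phi r)).
  { intros l' chi' t phi r L J O; pose proof (ode_run_frame J O) as F; now rewrite L in F. }
  split.
  + intros tau w [[-> ->]|(-> & t & phi & T & O & -> & ->)].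
    { exists None; split; [left; now split | exact I]. }
    pose proof (fun r J => FO _ _ _ _ r (lhs_subst_rhs s l) J O) as FO'.
    destruct (@ode_run_blend (subst_rhs s l) l (subst_fora s chi) chi t phi v0) as [O' Z];
      rewrite ?lhs_subst_rhs; trivial.
    * fold B; intros r J; cbv zeta; split.
      -- intros x th I; exists (subst_poly s th); split.
         { apply subst_rhs_In; eauto. }
         symmetry; apply ev_subst_agree; intros y K; apply (EB (phi r)); auto.
         insimp; left; exact (fv_rhs_In I K).
      -- apply sat_subst_fora; trivial; intros y K; apply (EB (phi r)); auto.
         insimp; tauto.
    * rewrite lhs_subst_rhs in O', Z; fold B in O', Z.
      exists (Some (blend B (phi t) v0)); split.
      -- right; split; trivial; eexists t, _; split; [exact T|]; split; [exact O'|].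
         split; [now rewrite Z | reflexivity].
      -- apply Q; auto. apply FO'; lra.
  + intros tau w [[-> ->]|(-> & t & phi & T & O & -> & ->)].
    { exists None; split; [left; now split | exact I]. }
    pose proof (fun r J => FO _ _ _ _ r eq_refl J O) as FO'.
    destruct (@ode_run_blend l (subst_rhs s l) chi (subst_fora s chi) t phi v) as [O' Z];
      rewrite ?lhs_subst_rhs; trivial.
    * intros; symmetry; now apply E0.
    * fold B; intros r J; cbv zeta; split.
      -- intros x th I; apply subst_rhs_In in I as [th' [-> I]].
         exists th'; split; trivial.
         apply ev_subst_agree; intros y K; apply (EB (blend B (phi r) v)); auto.
         { intros z Hz; symmetry; now apply SB. }
         insimp; left; exact (fv_rhs_In I K).
      -- apply sat_subst_fora; trivial; intros y K; apply (EB (blend B (phi r) v)); auto.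
         { intros z Hz; symmetry; now apply SB. }
         insimp; tauto.
    * fold B in O', Z.
      exists (Some (blend B (phi t) v)); split.
      -- right; split; trivial; eexists t, _; split; [exact T|]; split; [exact O'|].
         split; [now rewrite Z | reflexivity].
      -- apply Q; auto. { apply FO'; lra. } intros; symmetry; now apply SB.
- apply bisim_test.
  + intros x [H|[]]; exact H.
  + now apply sat_subst_fora.
- destruct W as [W1 W2], A as [A1 [A2 A3]].
  eapply bisim_seq.
  + apply (IHa1 s v v0 W1 A1); intros x I; apply E; insimp; tauto.
  + intros tau w w0 H H0 T; apply sem_frame in H, H0; rewrite bv_subst_prog in H.
    eapply bisim_mono; [|apply (IHa2 (sminus s (mbv a1)) w w0 W2 A2)].
    * intros u u0 T2 x D; apply T2; simpl in D; insimp.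
      destruct D as [D|[D|D]]; [left; now apply T; left | left; now apply T; right|].
      now right.
    * eapply track_step; try eassumption; [apply incl_refl|].
      intros x I J; apply E; insimp; tauto.
- destruct W as [W1 W2], A as [A1 A2].
  destruct (IHa1 s v v0 W1 A1) as [F1 B1]; [intros x I; apply E; insimp; tauto|].
  destruct (IHa2 s v v0 W2 A2) as [F2 B2]; [intros x I; apply E; insimp; tauto|].
  split; intros tau w [H|H];
    [apply F1 in H | apply F2 in H | apply B1 in H | apply B2 in H];
    destruct H as [w' [H O]]; exists w'; (split; [tauto|]);
    (eapply orel_mono; [|exact O]); intros u u0 T x D; apply T; simpl in D; insimp; tauto.
- destruct A as [A1 A2].
  (* The states vary because each iteration starts where the previous one ended; [no_capture] makes
     the agreement on [fv_prog a] a loop invariant. *)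
  assert (L : forall n v v0,
    (forall x, In (VarR x) (fv_prog a) -> st_R v0 x = st_R (assign s v) x) ->
    bisim (track (PLoop a) v v0) (sem_pow (sem (subst_prog s a)) n) (sem_pow (sem a) n) v v0).
  { clear v v0 E; induction n as [|n IH]; intros v v0 E; simpl.
    - apply bisim_test; simpl; [|tauto]; intros x [D|[]]; exact D.
    - eapply bisim_seq; [exact (IHa s v v0 W A1 E)|].
      intros tau w w0 H H0 T; apply sem_frame in H, H0; rewrite bv_subst_prog in H.
      eapply bisim_mono; [|apply IH].
      + intros u u0 T2 x [D|[]]; apply T2; left; apply T; now left.
      + rewrite <- (sminus_nil s) in A2 |- *; eapply track_step; try eassumption;
          [intros ? [] | intros; now apply E]. }
  split; intros tau w [n H]; apply (L n v v0 E) in H as [w' [H O]];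
    exists w'; split; trivial; now exists n.
- assert (M : st_R v0 (smu Sg) = st_R v (smu Sg)).
  { rewrite E by (insimp; left; right; now left); simpl.
    rewrite lookup_notin; [reflexivity|]; apply A; now left. }
  unfold bisim; rewrite (@ev_subst_agree s th v v0) by (intros x I; apply E; insimp; tauto).
  rewrite M.
  assert (K : track (PSend ch h th) v v0 v v0).
  { intros x [D|[D|[]]]; [exact D | discriminate]. }
  split; intros tau w [[-> ->]|[-> P]].
  1: exists (Some v0); split; [left; now split | exact K].
  2: exists (Some v); split; [left; now split | exact K].
  all: exists None; split; [right; now split | exact I].
- assert (M : st_R v0 (smu Sg) = st_R v (smu Sg)).
  { rewrite E by (right; now left); simpl.
    rewrite lookup_notin; [reflexivity|]; apply A; now left. }
  unfold bisim; rewrite M.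
  assert (K : forall d, track (PRecv ch h x) v v0 (updR v x d) (updR v0 x d)).
  { intros d y; simpl; destruct sVR_dec; trivial; intros [D|[D|[D|[]]]]; congruence. }
  split; intros tau w [d [[-> ->]|[-> P]]].
  1: exists (Some (updR v0 x d)); split; [exists d; left; now split | apply K].
  2: exists (Some (updR v x d)); split; [exists d; left; now split | apply K].
  all: exists None; split; [exists d; right; now split | exact I].
- destruct W as [W1 [W2 [W3 W4]]], A as [A1 [A2 A3]].
  destruct (IHa1 s v v0 W1 A1) as [F1 B1]; [intros x I; apply E; insimp; tauto|].
  destruct (IHa2 s v v0 W2 A2) as [F2 B2]; [intros x I; apply E; insimp; tauto|].
  (* Three cases for the clock: must-bound by both components, it is tracked; otherwise bound by one
     of them, it lies in [par_mu], so it is not replaced and agreed initially; bound by neither, all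
     four final values are initial ones and both equations hold. *)
  assert (MU : forall wa wb wa0 wb0,
    frame (bv a1) v wa -> frame (bv a2) v wb ->
    frame (bv a1) v0 wa0 -> frame (bv a2) v0 wb0 ->
    track a1 v v0 wa wa0 -> track a2 v v0 wb wb0 ->
    (st_R wa (smu Sg) = st_R wb (smu Sg) <-> st_R wa0 (smu Sg) = st_R wb0 (smu Sg))).
  { intros wa wb wa0 wb0 [_ [_ Ga]] [_ [_ Gb]] [_ [_ Ga0]] [_ [_ Gb0]] Ta Tb.
    destruct (in_dec (@var_dec Sg) (VarR (smu Sg)) (set_inter (@var_dec Sg) (mbv a1) (mbv a2)))
      as [I|N].
    { apply In_inter in I as [I1 I2]; rewrite Ta, Tb by (right; assumption); tauto. }
    destruct (in_dec (@var_dec Sg) (VarR (smu Sg)) (set_union (@var_dec Sg) (bv a1) (bv a2)))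
      as [I|N'].
    - assert (P : In (VarR (smu Sg)) (par_mu a1 a2)).
      { apply In_diff; split; [apply In_inter; split; [now left | exact I] | exact N]. }
      assert (V : st_R v0 (smu Sg) = st_R v (smu Sg)).
      { rewrite E by (apply In_union; now right); simpl.
        now rewrite (lookup_notin (A3 _ P)). }
      rewrite Ta, Tb by (left; exact V); tauto.
    - rewrite In_union in N'; rewrite Ga, Gb, Ga0, Gb0 by tauto; tauto. }
  assert (MG : forall wa wb wa0 wb0,
    mu_agree wa wb -> mu_agree wa0 wb0 ->
    orel (track a1 v v0) wa wa0 -> orel (track a2 v v0) wb wb0 ->
    orel (track (PPar a1 a2) v v0) (omerge (bv a1) wa wb) (omerge (bv a1) wa0 wb0)).
  { intros [wa|] [wb|] [wa0|] [wb0|]; simpl; try tauto.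
    intros M M0 Ta Tb x D; simpl in *; insimp.
    (* The merge takes variables bound by [a1] from the first component, although they may be
       must-bound by [a2] only. Well-formedness leaves just [mu], which synchronization lets one
       read from the second component. *)
    assert (X2 : In (VarR x) (bv a1) -> In (VarR x) (mbv a2) -> x = smu Sg).
    { intros I1 I2; apply mbv_bv in I2.
      destruct (W4 (VarR x)) as [[=]|[]]; trivial.
      unfold v_prog; insimp; tauto. }
    destruct in_dec as [I1|N1].
    - destruct D as [D|[D|D]]; [apply Ta; tauto | apply Ta; tauto|].
      pose proof (X2 I1 D); subst x; rewrite M, M0; apply Tb; tauto.
    - apply Tb; destruct D as [D|[D|D]]; [tauto | now apply mbv_bv in D | tauto]. }
  rewrite bv_subst_prog, !cn_subst_prog.
  split.
  + intros tau w (wa & wb & Ha & Hb & M & S & R & ->).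
    destruct (F1 _ _ Ha) as [wa0 [Ha0 Oa]], (F2 _ _ Hb) as [wb0 [Hb0 Ob]].
    assert (M0 : mu_agree wa0 wb0).
    { destruct wa as [wa|], wb as [wb|], wa0 as [wa0|], wb0 as [wb0|]; simpl in *; try tauto.
      apply sem_frame in Ha, Hb, Ha0, Hb0; rewrite bv_subst_prog in Ha, Hb.
      now apply (MU wa wb wa0 wb0). }
    exists (omerge (bv a1) wa0 wb0); split; [|now apply MG].
    exists wa0, wb0; simpl in R; rewrite !cn_subst_prog in R; tauto.
  + intros tau w (wa0 & wb0 & Ha0 & Hb0 & M0 & S & R & ->).
    destruct (B1 _ _ Ha0) as [wa [Ha Oa]], (B2 _ _ Hb0) as [wb [Hb Ob]].
    assert (M : mu_agree wa wb).
    { destruct wa as [wa|], wb as [wb|], wa0 as [wa0|], wb0 as [wb0|]; simpl in *; try tauto.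
      apply sem_frame in Ha, Hb, Ha0, Hb0; rewrite bv_subst_prog in Ha, Hb.
      now apply (MU wa wb wa0 wb0). }
    exists (omerge (bv a1) wa wb); split; [|now apply MG].
    exists wa, wb; simpl; rewrite !cn_subst_prog; tauto.
Qed.

End Simulation.

(** * Substitution in formulas and coincidence *)

Section Coincidence.
Context {Sg : signature}.
Implicit Types (v u : state Sg) (tau : rtrace (Sg := Sg)) (t : trace (Sg := Sg)).
Implicit Types (f g : sChan Sg -> bool).

Definition fch f t : trace := filter (fun e => f (ev_ch e)) t.

Lemma fch_fch f g t : fch g (fch f t) = fch (fun c => g c && f c)%bool t.
Proof.
induction t as [|e t IH]; simpl; trivial.
destruct (f (ev_ch e)); simpl; destruct (g (ev_ch e)); simpl; congruence.
Qed.

Lemma fch_ext f g t : (forall c, f c = g c) -> fch f t = fch g t.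
Proof. intros E; apply filter_ext; intros; apply E. Qed.

Lemma fch_true t : fch (fun _ => true) t = t.
Proof. induction t as [|e t IH]; simpl; congruence. Qed.

Lemma fch_sub f g t : (forall c, g c = true -> f c = true) -> fch g (fch f t) = fch g t.
Proof.
intros S; rewrite fch_fch; apply fch_ext; intros c; specialize (S c).
destruct (g c); [now rewrite S | trivial].
Qed.

(* Observing traces on the channels in [f] only is what lets the parallel
   component [b] of [ax_par] contribute events. *)
Definition agree f s v v0 (z : var Sg) : Prop :=
  match z with
  | VarR x => st_R v0 x = st_R (assign s v) x
  | VarN n => st_N v0 n = st_N v n
  | VarT h => fch f (st_T v0 h) = fch f (st_T v h)
  end.

Lemma agree_append f s v v0 tau z :
  agree f s v v0 z -> agree f s (append v tau) (append v0 tau) z.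
Proof.
destruct z; simpl; intros E; trivial.
{ rewrite E; now apply ev_poly_ext. }
unfold fch; rewrite !filter_app; fold (fch f); unfold fch in E; now rewrite E.
Qed.

(** The filter [g] varies in the induction: below a projection to [Y] only the channels of [g] in
    [Y] remain visible, matching how [cn_ttm] shrinks there. *)
Lemma ev_subst_ttm te f g s v v0 :
  (forall z, In z (fv_ttm te) -> agree f s v v0 z) ->
  (forall c, cn_ttm te c -> g c = true -> f c = true) ->
  fch g (ev_ttm (subst_ttm s te) v) = fch g (ev_ttm te v0).
Proof.
revert g; induction te; intros g E S; simpl in *.
- specialize (E (VarT h) (or_introl eq_refl)); simpl in E.
  rewrite <- (fch_sub (f := f)), <- E; [apply fch_sub|]; auto.
- trivial.
- rewrite !(@ev_subst_agree _ s _ v v0); trivial;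
    intros x I; apply (E (VarR x)); insimp; tauto.
- unfold fch; rewrite !filter_app; f_equal; [apply IHte1 | apply IHte2];
    intros; try apply E; try apply S; insimp; tauto.
- change (fch g (fch (mem_chan Y) (ev_ttm (subst_ttm s te) v)) =
          fch g (fch (mem_chan Y) (ev_ttm te v0))).
  rewrite !fch_fch; apply IHte; trivial.
  intros c I J; apply andb_prop in J as [J K]; rewrite mem_chan_In in K; auto.
Qed.

Lemma ev_subst_ttm_full te f s v v0 :
  (forall z, In z (fv_ttm te) -> agree f s v v0 z) ->
  (forall c, cn_ttm te c -> f c = true) ->
  ev_ttm (subst_ttm s te) v = ev_ttm te v0.
Proof.
intros E S; rewrite <- (fch_true (ev_ttm (subst_ttm s te) v)), <- (fch_true (ev_ttm te v0)).
apply ev_subst_ttm with f; auto.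
Qed.

Lemma ev_subst_itm ie f s v v0 :
  (forall z, In z (fv_itm ie) -> agree f s v v0 z) ->
  (forall c, cn_itm ie c -> f c = true) ->
  ev_itm (subst_itm s ie) v = ev_itm ie v0.
Proof.
induction ie; simpl; intros E S; trivial.
- symmetry; apply (E (VarN n)); now left.
- rewrite IHie1, IHie2; trivial; intros; try apply E; try apply S; insimp; tauto.
- now rewrite (@ev_subst_ttm_full te f s v v0).
Qed.

Lemma ev_subst_rtm e f s v v0 :
  (forall z, In z (fv_rtm e) -> agree f s v v0 z) ->
  (forall c, cn_rtm e c -> f c = true) ->
  ev_rtm (subst_rtm s e) v = ev_rtm e v0.
Proof.
induction e; simpl; intros E S; trivial.
- rewrite ev_rtm_of_poly; symmetry; apply (E (VarR x)); now left.
- rewrite IHe1, IHe2; trivial; intros; try apply E; try apply S; insimp; tauto.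
- rewrite IHe1, IHe2; trivial; intros; try apply E; try apply S; insimp; tauto.
- rewrite (@ev_subst_ttm_full te f s v v0), (@ev_subst_itm ie f s v v0); trivial;
    intros; try apply E; try apply S; insimp; tauto.
- rewrite (@ev_subst_ttm_full te f s v v0), (@ev_subst_itm ie f s v v0); trivial;
    intros; try apply E; try apply S; insimp; tauto.
Qed.

Lemma ev_subst_ctm ce f s v v0 :
  (forall z, In z (fv_ctm ce) -> agree f s v v0 z) ->
  (forall c, cn_ctm ce c -> f c = true) ->
  ev_ctm (subst_ctm s ce) v = ev_ctm ce v0.
Proof.
destruct ce; simpl; intros E S; trivial.
rewrite (@ev_subst_ttm_full te f s v v0), (@ev_subst_itm ie f s v v0); trivial;
  intros; try apply E; try apply S; insimp; tauto.
Qed.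

Lemma agree_upd f s z (d : sort_val z) X v v0 :
  no_capture (sminus s [z]) X [z] ->
  (forall y, In y (set_diff (@var_dec Sg) X [z]) -> agree f s v v0 y) ->
  forall y, In y X -> agree f (sminus s [z]) (upd v d) (upd v0 d) y.
Proof.
intros N E y I.
assert (E' : y <> z -> agree f s v v0 y).
{ intros D; apply E; insimp; split; trivial; intros [D'|[]]; now destruct D. }
destruct y as [x|n|h].
- refine (@assign_sminus_upd _ s z d X v v0 N _ x I).
  intros y J D; apply (E (VarR y)); insimp; split; trivial; intros [D'|[]]; now destruct D.
- destruct z as [x|m|h]; simpl; try (now apply E').
  destruct sVN_dec; trivial; apply E'; congruence.
- destruct z as [x|m|h']; simpl; try (now apply E').
  destruct sVT_dec; trivial; apply E'; congruence.
Qed.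

(** Of the must-bound variables missing from the hypothesis, the real ones agree by [track], integer
    variables are never bound by programs, and trace variables reappear in [fv_prog a] by
    [mbv_VarT]. *)
Lemma agree_sem a s f p v v0 tau w w0 :
  no_capture (sminus s (mbv a)) (fv p) (bv a) ->
  (forall z, In z (set_union (@var_dec Sg) (fv_prog a)
                     (set_diff (@var_dec Sg) (fv p) (mbv a))) -> agree f s v v0 z) ->
  frame (bv a) v w -> frame (bv a) v0 w0 -> track a v v0 w w0 ->
  forall z, In z (fv p) ->
    agree f (sminus s (mbv a)) (append w tau) (append w0 tau) z.
Proof.
intros N E F F0 T z I; apply agree_append; destruct z as [x|n|h].
- refine (track_step N (incl_refl _) F F0 T _ I).
  intros y J K; apply (E (VarR y)); insimp; tauto.
- destruct F as [F _], F0 as [F0 _]; simpl; rewrite F, F0.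
  apply (E (VarN n)); insimp; right; split; trivial.
  intros J; apply mbv_bv in J; exact (bv_VarN J).
- destruct F as [_ [F _]], F0 as [_ [F0 _]]; simpl; rewrite F, F0.
  apply (E (VarT h)); insimp.
  destruct (in_dec (@var_dec Sg) (VarT h) (mbv a)) as [J|J]; [|tauto].
  left; now apply mbv_VarT.
Qed.

Theorem sat_subst p : forall f s v v0,
  wf p -> adm s p -> (forall c, cn p c -> f c = true) ->
  (forall z, In z (fv p) -> agree f s v v0 z) ->
  (sat (subst s p) v <-> sat p v0).
Proof.
induction p; intros f s v v0 W A S E;
  cbn [subst sat wf adm cn fv] in *.
1,5: rewrite (@ev_subst_rtm a f s v v0), (@ev_subst_rtm b f s v v0); try tauto;
  intros; try apply E; try apply S; insimp; tauto.
1,4: rewrite (@ev_subst_itm a f s v v0), (@ev_subst_itm b f s v v0); try tauto;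
  intros; try apply E; try apply S; insimp; tauto.
1: rewrite (@ev_subst_ctm a f s v v0), (@ev_subst_ctm b f s v v0); try tauto;
  intros; try apply E; try apply S; insimp; tauto.
1,2: rewrite (@ev_subst_ttm_full a f s v v0), (@ev_subst_ttm_full b f s v v0); try tauto;
  intros; try apply E; try apply S; insimp; tauto.
1: rewrite (IHp f s v v0); tauto.
1-3: rewrite (IHp1 f s v v0), (IHp2 f s v v0); try tauto;
  intros; try apply E; try apply S; insimp; tauto.
1,2: assert (J : forall d, sat (subst (sminus s [z]) p) (upd v d) <->
       sat p (@upd _ v0 z d))
  by (intros d; apply (IHp f); [tauto..|]; intros y; apply agree_upd; tauto).
- split; intros H d; now apply J.
- split; intros [d H]; exists d; now apply J.
- destruct W as [W1 W2], A as [A1 [A2 A3]].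
  destruct (@sem_subst _ a s v v0 W1 A1) as [F B].
  { intros x I; apply (E (VarR x)); insimp; tauto. }
  assert (J : forall tau w w0, sem (subst_prog s a) v tau (Some w) ->
    sem a v0 tau (Some w0) -> track a v v0 w w0 ->
    (sat (subst (sminus s (mbv a)) p) (append w tau) <-> sat p (append w0 tau))).
  { intros tau w w0 H H0 T; apply (IHp f); trivial.
    apply sem_frame in H, H0; rewrite bv_subst_prog in H.
    now apply agree_sem with v v0. }
  split; intros K tau w H.
  + destruct (B _ _ H) as [[w0|] [H0 T]]; [|destruct T].
    apply (J _ _ _ H0 H T); auto.
  + destruct (F _ _ H) as [[w0|] [H0 T]]; [|destruct T].
    apply (J _ _ _ H H0 T); auto.
- destruct W as [W1 [W2 [W3 [W4 _]]]], A as [A1 [A2 [A3 [A4 A5]]]].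
  destruct (@sem_subst _ a s v v0 W1 A1) as [F B].
  { intros x I; apply (E (VarR x)); insimp; tauto. }
  (* Assumption and commitment are read in the initial state extended by a trace, so the full
     substitution [s] applies to them and appending equal traces preserves agreement. *)
  assert (JA : forall tau, sat (subst s p1) (append v tau) <-> sat p1 (append v0 tau)).
  { intros tau; apply (IHp1 f); auto; intros z I; apply agree_append, E; insimp; tauto. }
  assert (JC : forall tau, sat (subst s p2) (append v tau) <-> sat p2 (append v0 tau)).
  { intros tau; apply (IHp2 f); auto; intros z I; apply agree_append, E; insimp; tauto. }
  assert (J : forall tau w w0, sem (subst_prog s a) v tau (Some w) ->
    sem a v0 tau (Some w0) -> track a v v0 w w0 ->
    (sat (subst (sminus s (mbv a)) p3) (append w tau) <-> sat p3 (append w0 tau))).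
  { intros tau w w0 H H0 T; apply (IHp3 f); auto.
    apply sem_frame in H, H0; rewrite bv_subst_prog in H.
    apply agree_sem with v v0; trivial.
    intros z I; apply E; apply In_union; tauto. }
  split; intros K tau w H.
  + destruct (B _ _ H) as [w0 [H0 T]]; destruct (K _ _ H0) as [K1 K2]; split.
    * intros Q; apply JC, K1; intros; now apply JA, Q.
    * intros Q u ->; destruct w0 as [w0|]; [|destruct T].
      apply (J _ _ _ H0 H T), K2; trivial; intros; now apply JA, Q.
  + destruct (F _ _ H) as [w0 [H0 T]]; destruct (K _ _ H0) as [K1 K2]; split.
    * intros Q; apply JC, K1; intros; now apply JA, Q.
    * intros Q u ->; destruct w0 as [w0|]; [|destruct T].
      apply (J _ _ _ H H0 T), K2; trivial; intros; now apply JA, Q.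
Qed.

(** * The empty substitution and coincidence *)

Lemma subst_poly_nil (th : poly Sg) : subst_poly [] th = th.
Proof. induction th; simpl; congruence. Qed.

Lemma subst_rhs_nil (l : list (sVR Sg * poly Sg)) : subst_rhs [] l = l.
Proof.
induction l as [|[x th] l IH]; simpl; trivial; now rewrite subst_poly_nil, IH.
Qed.

Lemma subst_fora_nil (chi : fora Sg) : subst_fora [] chi = chi.
Proof. induction chi; simpl; rewrite ?subst_poly_nil; congruence. Qed.

Lemma subst_prog_nil (a : prog Sg) : subst_prog [] a = a.
Proof.
induction a; simpl; rewrite ?subst_poly_nil, ?subst_rhs_nil, ?subst_fora_nil; congruence.
Qed.

Lemma subst_ttm_nil (te : ttm) : subst_ttm (Sg := Sg) [] te = te.
Proof. induction te; simpl; rewrite ?subst_poly_nil; congruence. Qed.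

Lemma subst_itm_nil (ie : itm) : subst_itm (Sg := Sg) [] ie = ie.
Proof. induction ie; simpl; rewrite ?subst_ttm_nil; congruence. Qed.

Lemma subst_ctm_nil (ce : ctm) : subst_ctm (Sg := Sg) [] ce = ce.
Proof. destruct ce; simpl; rewrite ?subst_ttm_nil, ?subst_itm_nil; congruence. Qed.

Lemma subst_rtm_nil (e : rtm) : subst_rtm (Sg := Sg) [] e = e.
Proof. induction e; simpl; rewrite ?subst_ttm_nil, ?subst_itm_nil; congruence. Qed.

Lemma subst_nil (p : fml Sg) : subst [] p = p.
Proof.
induction p; simpl;
  rewrite ?subst_rtm_nil, ?subst_itm_nil, ?subst_ctm_nil, ?subst_ttm_nil, ?subst_prog_nil;
  congruence.
Qed.

Lemma adm_fora_nil (chi : fora Sg) : adm_fora [] chi.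
Proof.
induction chi; simpl; auto; split; try assumption; intros ? ? [].
Qed.

Lemma avoids_nil (X : list (var Sg)) : avoids [] X.
Proof. intros x _ []. Qed.

Lemma adm_prog_nil (a : prog Sg) : adm_prog [] a.
Proof.
induction a; simpl; repeat apply conj; try assumption; try exact I; try apply adm_fora_nil;
  try apply avoids_nil; intros ? ? [].
Qed.

Lemma adm_nil (p : fml Sg) : adm [] p.
Proof.
induction p; simpl; repeat apply conj; try assumption; try exact I;
  try apply adm_prog_nil; intros ? ? [].
Qed.

Lemma coincidence_chan p f v v0 :
  wf p -> (forall c, cn p c -> f c = true) ->
  (forall z, In z (fv p) -> agree f [] v v0 z) -> (sat p v <-> sat p v0).
Proof.
intros W S E; rewrite <- (subst_nil p) at 1; apply sat_subst with f; trivial.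
apply adm_nil.
Qed.

Lemma coincidence p v v0 :
  wf p -> (forall z, In z (fv p) -> same_at v v0 z) -> (sat p v <-> sat p v0).
Proof.
intros W E; apply coincidence_chan with (fun _ => true); trivial.
intros z I; specialize (E z I); destruct z; simpl in *; congruence.
Qed.

(** Programs evaluate real polynomials and real arithmetic only, so histories and integer variables
    of the initial state influence neither the traces nor the final real values. *)
Lemma sem_real (a : prog Sg) v v0 :
  wf_prog a -> (forall x, st_R v0 x = st_R v x) ->
  bisim (fun w w0 => forall x, st_R w0 x = st_R w x) (sem a) (sem a) v v0.
Proof.
intros W E; eapply bisim_mono; [|rewrite <- (subst_prog_nil a) at 1; apply sem_subst].
- intros w w0 T x; apply T; left; apply E.
- exact W.
- apply adm_prog_nil.
- intros x _; apply E.
Qed.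

End Coincidence.

(** * Assumption-commitment boxes *)

Section Boxes.
Context {Sg : signature}.
Implicit Types (v u : state Sg) (tau : rtrace (Sg := Sg)) (a b : prog Sg).
Implicit Types (A C P : state Sg -> Prop).

(** At [sem a], [sat A], [sat C] and [sat p] this is convertible to [sat (FACBox a A C p)]. Working
    with denotations allows replacing [U] by an equivalent one. *)
Definition acbox (U : denot) A C P v : Prop :=
  forall tau w, U v tau w ->
    ((forall tau', pprefix tau' tau -> A (append v tau')) -> C (append v tau)) /\
    ((forall tau', prefix tau' tau -> A (append v tau')) ->
       forall u, w = Some u -> P (append u tau)).

Definition preserves (U : denot) A : Prop :=
  forall v tau u t, U v tau (Some u) -> (A (append u t) <-> A (append v t)).

(** In a nested box the second program starts in [append u t], in a sequential composition it starts
    in [u] and the whole trace is appended at the end. *)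
Definition append_invariant (M : denot) : Prop :=
  forall u t tau w, M (append u t) tau w <->
    exists w', w = option_map (fun w => append w t) w' /\ M u tau w'.

Lemma sat_FACBox_mono a (A1 A2 C1 C2 p1 p2 : fml Sg) v :
  (forall u, sat A2 u -> sat A1 u) -> (forall u, sat C1 u -> sat C2 u) ->
  (forall u, sat p1 u -> sat p2 u) ->
  sat (FACBox a A1 C1 p1) v -> sat (FACBox a A2 C2 p2) v.
Proof.
intros HA HC HP H tau w R; destruct (H tau w R) as [K1 K2]; split.
- intros Q; apply HC, K1; intros t P; now apply HA, Q.
- intros Q u E; apply HP, K2; trivial; intros t P; now apply HA, Q.
Qed.

Lemma acbox_ext (U U' : denot) A C P v :
  (forall tau w, U v tau w <-> U' v tau w) -> (acbox U A C P v <-> acbox U' A C P v).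
Proof. intros E; split; intros H tau w R; now apply H, E. Qed.

(** A prefix of [tau1 ++ tau2] lies within [tau1] or extends it; assumptions on the latter kind are
    moved between [v] and the intermediate state by [preserves]. *)
Lemma acbox_seq (U M : denot) A C P v :
  preserves U A -> preserves U C -> append_invariant M ->
  (acbox (sem_seq U M) A C P v <-> acbox U A C (acbox M A C P) v).
Proof.
intros PA PC AM; split; intros H.
- intros tau w R; split.
  + apply (H tau None); left; split; [reflexivity | now exists w].
  + intros HA u -> tau2 w2 R2; apply AM in R2 as [w' [-> R2]].
    destruct (H (tau ++ tau2) w') as [H1 H2]; [right; now exists tau, u, tau2|].
    assert (L : forall t, A (append (append u tau) t) <-> A (append v (tau ++ t))).
    { intros t; rewrite append_app; exact (PA _ _ _ _ R). }
    split.
    * intros HA2; rewrite append_app; apply (PC _ _ _ _ R), H1; intros t Q.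
      pose proof Q as [Q' N]; apply prefix_app_inv in Q' as [Q'|(t' & -> & Q')]; auto.
      apply L, HA2; split; trivial; congruence.
    * intros HA2 u' E; destruct w' as [w'|]; [injection E as <- | discriminate].
      rewrite append_app; apply H2; trivial; intros t Q.
      apply prefix_app_inv in Q as [Q|(t' & -> & Q)]; auto; now apply L, HA2.
- intros tau w [[-> [w' R]]|(tau1 & u & tau2 & R1 & R2 & ->)].
  + destruct (H _ _ R) as [H1 _]; split; [exact H1 | discriminate].
  + destruct (H _ _ R1) as [H1 H2].
    assert (L : forall t, A (append (append u tau1) t) <-> A (append v (tau1 ++ t))).
    { intros t; rewrite append_app; exact (PA _ _ _ _ R1). }
    assert (R3 : M (append u tau1) tau2 (option_map (fun w => append w tau1) w))
      by (apply AM; eauto).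
    split.
    * intros HA; destruct tau2 as [|e tau2].
      { rewrite app_nil_r in *; auto. }
      destruct (H2 (fun t Q => HA t (pprefix_app_l (r := e :: tau2) ltac:(discriminate) Q))
        u eq_refl _ _ R3) as [H3 _].
      apply (PC _ _ _ _ R1); rewrite <- append_app; apply H3.
      intros t Q; now apply L, HA, pprefix_app_r.
    * intros HA u' ->.
      destruct (H2 (fun t Q => HA t (prefix_app_l _ Q)) u eq_refl _ _ R3) as [_ H3].
      rewrite <- append_app; apply H3; [|reflexivity].
      intros t Q; now apply L, HA, prefix_app_r.
Qed.

(** Histories do not influence a run ([sem_real]) and pass through it unchanged ([sem_frame]), so
    they may be extended before or after it. *)
Lemma append_invariant_sem a : wf_prog a -> append_invariant (sem a).
Proof.
assert (E : forall v v0 w w0 t,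
  frame (bv a) v w -> frame (bv a) v0 w0 -> v0 = append v t ->
  (forall x, st_R w0 x = st_R w x) -> w0 = append w t).
{ intros v v0 w w0 t [N [T _]] [N0 [T0 _]] -> R; apply state_eq; intros y; simpl.
  - apply R. - now rewrite N0, N. - now rewrite T0, T. }
intros W u t tau w; destruct (@sem_real _ a u (append u t) W) as [F B]; [reflexivity|].
split.
- intros H; destruct (B _ _ H) as [w' [H' O]]; exists w'; split; trivial.
  destruct w as [w|], w' as [w'|]; simpl in *; try tauto; f_equal.
  apply sem_frame in H, H'; now apply (E u (append u t)).
- intros [w' [-> H']]; destruct (F _ _ H') as [w [H O]].
  replace (option_map _ w') with w; trivial.
  destruct w as [w|], w' as [w'|]; simpl in *; try tauto; f_equal.
  apply sem_frame in H, H'; now apply (E u (append u t)).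
Qed.

Lemma sem_preserves a (q : fml Sg) : wf q ->
  (forall z, In z (fv q) -> In z (bv a) -> is_tvar z) -> preserves (sem a) (sat q).
Proof.
intros W N v tau u t H; apply sem_frame in H as [HN [HT HR]].
apply coincidence; trivial; intros z I; destruct z as [x|n|h]; simpl.
- apply HR; intros J; exact (N _ I J).
- now rewrite HN.
- now rewrite HT.
Qed.

Lemma sat_true v : sat FTrue v.
Proof. reflexivity. Qed.

(** * Loops as sequences of powers *)

Lemma sem_PPow a n : sem (PPow a n) = sem_pow (sem a) n.
Proof. induction n as [|n IH]; simpl; congruence. Qed.

Lemma bv_PPow a n : incl (bv (PPow a n)) (bv a).
Proof.
induction n as [|n IH]; simpl; [intros ? []|].
intros z; insimp; intros [I|I]; auto.
Qed.

Lemma wf_PPow a n : wf_prog a -> wf_prog (PPow a n).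
Proof. induction n as [|n IH]; simpl; auto. Qed.

Lemma sem_seq_ext (U U' M M' : denot) v tau w :
  (forall v tau w, U v tau w <-> U' v tau w) ->
  (forall v tau w, M v tau w <-> M' v tau w) ->
  (sem_seq U M v tau w <-> sem_seq (Sg := Sg) U' M' v tau w).
Proof.
intros E F; split; intros [[-> [w' H]]|(t1 & u & t2 & H1 & H2 & ->)].
- left; split; trivial; exists w'; now apply E.
- right; exists t1, u, t2; rewrite <- E, <- F; auto.
- left; split; trivial; exists w'; now apply E.
- right; exists t1, u, t2; rewrite E, F; auto.
Qed.

Lemma sem_seq_assoc (U M N : denot) v tau w :
  sem_seq (Sg := Sg) U (sem_seq M N) v tau w <-> sem_seq (sem_seq U M) N v tau w.
Proof.
split.
- intros [[-> [w' H]]|(t1 & u & t2 & H1 & [[-> [w' H2]]|(t3 & u' & t4 & H3 & H4 & ->)] & ->)].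
  + left; split; trivial; exists None; left; split; trivial; now exists w'.
  + left; split; trivial; exists w'; right; now exists t1, u, t2.
  + right; exists (t1 ++ t3), u', t4; rewrite app_assoc; repeat split; trivial.
    right; now exists t1, u, t3.
- intros [[-> [w' [[-> [w'' H]]|(t1 & u & t2 & H1 & H2 & ->)]]]|
    (t1 & u & t2 & [[[=] _]|(t3 & u' & t4 & H3 & H4 & ->)] & H2 & ->)].
  + left; split; trivial; now exists w''.
  + right; exists t1, u, t2; repeat split; trivial; left; split; trivial; now exists w'.
  + right; exists t3, u', (t4 ++ t2); rewrite app_assoc; repeat split; trivial.
    right; now exists t4, u, t2.
Qed.

Lemma sem_seq_test_l a v tau w :
  sem_seq (sem_test ATrue) (sem a) v tau w <-> sem a v tau w.
Proof.
split.
- intros [[-> [w' [[-> ->]|[-> _]]]]|(t1 & u & t2 & [[_ [=]]|[-> [[= ->] _]]] & R & ->)];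
    [apply sem_nil..|exact R].
- intros H; right; exists [], v, tau; repeat split; trivial.
  right; repeat split.
Qed.

Lemma sem_seq_test_r a v tau w :
  sem_seq (sem a) (sem_test ATrue) v tau w <-> sem a v tau w.
Proof.
split.
- intros [[-> [w' H]]|(t1 & u & t2 & H & [[-> ->]|[-> [-> _]]] & ->)].
  + exact (sem_prefix H (prefix_refl _)).
  + rewrite app_nil_r; exact (sem_prefix H (prefix_refl _)).
  + now rewrite app_nil_r.
- destruct w as [w|]; intros H.
  + right; exists tau, w, []; rewrite app_nil_r; repeat split; trivial; right; repeat split.
  + left; split; trivial; now exists None.
Qed.

(** Powers are defined by peeling off the first iteration; the induction axiom needs the last one.
    Associativity and neutrality of the trivial test convert one into the other. *)
Lemma sem_pow_Sr a n v tau w :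
  sem_pow (sem a) (S n) v tau w <-> sem_seq (sem_pow (sem a) n) (sem a) v tau w.
Proof.
revert v tau w; induction n as [|n IH]; intros v tau w; cbn [sem_pow].
- now rewrite sem_seq_test_r, sem_seq_test_l.
- rewrite <- sem_seq_assoc; apply sem_seq_ext; [tauto | exact IH].
Qed.

Lemma sat_FACBox_loop a (A C p : fml Sg) v :
  sat (FACBox (PLoop a) A C p) v <-> forall n, sat (FACBox (PPow a n) A C p) v.
Proof.
split.
- intros H n tau w R; apply (H tau w); apply sem_loopE; now exists n.
- intros H tau w R; apply sem_loopE in R as [n R]; now apply (H n).
Qed.

Lemma sat_FACBox_seq a b (A C p : fml Sg) v :
  wf (FACBox (PSeq a b) A C p) ->
  (sat (FACBox (PSeq a b) A C p) v <-> sat (FACBox a A C (FACBox b A C p)) v).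
Proof.
intros [[Wa Wb] [WA [WC [_ N]]]]; apply acbox_seq.
- apply sem_preserves; trivial; intros z I J; apply N; simpl; insimp; tauto.
- apply sem_preserves; trivial; intros z I J; apply N; simpl; insimp; tauto.
- now apply append_invariant_sem.
Qed.

(** Instantiating each quantifier with the value in [v'] moves [v] step by step to a state that
    agrees with [v'] on the free variables of [p]. *)
Lemma sat_forall_list zs (p : fml Sg) v v' :
  wf p -> (forall z, In z (fv p) -> In z zs \/ same_at v v' z) ->
  sat (forall_list zs p) v -> sat p v'.
Proof.
intros W; revert v; induction zs as [|z zs IH]; intros v E H; simpl in *.
- apply (coincidence (v := v)); trivial; intros z I; destruct (E z I) as [[]|J]; exact J.
- assert (K : exists d, forall y, same_at v v' y \/ y = z -> same_at (@upd _ v z d) v' y).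
  { destruct z as [x|n|h].
    - exists (st_R v' x); intros y D; destruct y as [y|y|y]; simpl in *;
        try destruct sVR_dec; subst; trivial; destruct D; congruence.
    - exists (st_N v' n); intros y D; destruct y as [y|y|y]; simpl in *;
        try destruct sVN_dec; subst; trivial; destruct D; congruence.
    - exists (st_T v' h); intros y D; destruct y as [y|y|y]; simpl in *;
        try destruct sVT_dec; subst; trivial; destruct D; congruence. }
  destruct K as [d K]; apply (IH (upd v d)); [|apply H].
  intros y I; destruct (E y I) as [[->|J]|J]; auto.
Qed.

(** * Soundness of the axioms for atomic programs and assumption-commitment boxes *)

Lemma valid_FIff (p q : fml Sg) : (forall v, sat p v <-> sat q v) -> valid (FIff p q).
Proof. intros E v; exact (E v). Qed.

Lemma sound_any x (p : fml Sg) : valid (FIff (FBox (PAny x) p) (FAll (VarR x) p)).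
Proof.
apply valid_FIff; intros v; split; intros H.
- intros d; simpl; rewrite <- (append_nil (updR v x d)); apply H; right; eauto.
- intros tau w [[_ [=]]|[-> [d [= ->]]]]; rewrite append_nil; apply (H d).
Qed.

Lemma sound_test chi (p : fml Sg) :
  valid (FIff (FBox (PTest chi) p) (FImp (fml_of_fora chi) p)).
Proof.
apply valid_FIff; intros v; split; intros H.
- intros K; rewrite <- (append_nil v); apply H; right; rewrite <- sat_fml_of_fora; auto.
- intros tau w [[_ [=]]|[-> [[= ->] K]]]; rewrite append_nil; apply H.
  now apply sat_fml_of_fora.
Qed.

Lemma sound_assign l (p : fml Sg) : wf p -> adm l p ->
  valid (FIff (FBox (PAssign l) p) (subst l p)).
Proof.
intros W A; apply valid_FIff; intros v.
rewrite (@sat_subst _ p (fun _ => true) l v (assign l v)); trivial;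
  [|intros [x|n|h] _; reflexivity].
split; intros H.
- rewrite <- (append_nil (assign l v)); apply H; now right.
- intros tau w [[_ [=]]|[-> [= ->]]]; now rewrite append_nil.
Qed.

Lemma sound_box a (p : fml Sg) : valid (FIff (FBox a p) (FACBox a FTrue FTrue p)).
Proof.
apply valid_FIff; intros v; split; intros H.
- intros tau w R; split; [reflexivity|]; intros _ u ->; now apply H.
- intros tau w R; apply (H tau (Some w) R); reflexivity.
Qed.

Lemma sound_seq a b (A C p : fml Sg) : wf (FACBox (PSeq a b) A C p) ->
  valid (FIff (FACBox (PSeq a b) A C p) (FACBox a A C (FACBox b A C p))).
Proof. intros W; apply valid_FIff; intros v; now apply sat_FACBox_seq. Qed.

Lemma sound_choice a b (A C p : fml Sg) :
  valid (FIff (FACBox (PChoice a b) A C p) (FAnd (FACBox a A C p) (FACBox b A C p))).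
Proof.
apply valid_FIff; intros v; split; intros H.
- split; intros tau w R; apply (H tau w); [now left | now right].
- intros tau w [R|R]; now apply H in R.
Qed.

Lemma wf_FACBox_pow a n (A C p : fml Sg) :
  wf (FACBox (PLoop a) A C p) -> wf (FACBox (PPow a n) A C p).
Proof.
intros [Wa [WA [WC [Wp N]]]]; repeat split; trivial; [now apply wf_PPow|].
intros z I; apply N; insimp; destruct I as [I J]; split; trivial; now apply bv_PPow in J.
Qed.

Lemma sound_unfold a (A C p : fml Sg) : wf (FACBox (PLoop a) A C p) ->
  valid (FIff (FACBox (PLoop a) A C p)
    (FAnd (FACBox (PPow a 0) A C p) (FACBox a A C (FACBox (PLoop a) A C p)))).
Proof.
intros W; apply valid_FIff; intros v.
assert (E : sat (FACBox a A C (FACBox (PLoop a) A C p)) v <->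
  forall n, sat (FACBox (PPow a (S n)) A C p) v).
{ split.
  - intros H n; apply sat_FACBox_seq; [exact (wf_FACBox_pow (S n) W)|].
    revert H; apply sat_FACBox_mono; trivial; intros u H; now apply sat_FACBox_loop.
  - intros H; assert (K : forall n, sat (FACBox a A C (FACBox (PPow a n) A C p)) v).
    { intros n; apply sat_FACBox_seq; [exact (wf_FACBox_pow (S n) W) | apply H]. }
    (* The quantifier over [n] commutes with the box: the commitment is the same for every [n], so
       it is read off at [n = 0], and postconditions may be conjoined. *)
    intros tau w R; split; [apply (K O tau w R)|].
    intros HA u ->; apply sat_FACBox_loop; intros n.
    destruct (K n tau (Some u) R) as [_ K2]; exact (K2 HA u eq_refl). }
rewrite sat_FACBox_loop; split.
- intros H; split; [apply (H O)|]; apply E; intros n; apply H.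
- intros [H0 H] [|n]; [exact H0|]; now apply E.
Qed.

Lemma sat_FACBox_pow_Sr a n (A C p : fml Sg) v : wf (FACBox (PLoop a) A C p) ->
  (sat (FACBox (PPow a (S n)) A C p) v <->
   sat (FACBox (PPow a n) A C (FACBox a A C p)) v).
Proof.
intros W; rewrite <- (@sat_FACBox_seq (PPow a n) a).
- apply acbox_ext; intros tau w; rewrite sem_PPow, sem_pow_Sr; simpl.
  now rewrite sem_PPow.
- destruct W as [Wa [WA [WC [Wp N]]]]; repeat split; trivial; [now apply wf_PPow|].
  intros z I; apply N; simpl in *; insimp; destruct I as [I [J|J]]; split; trivial.
  now apply bv_PPow in J.
Qed.

(** The contract of the [n]-th power supplies its commitment and [p] after finished runs; the loop
    conjunct then turns that [p] into the contract of one further iteration. *)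
Lemma sound_induction a (A C p : fml Sg) : wf (FACBox (PLoop a) A C p) ->
  valid (FIff (FACBox (PLoop a) A C p)
    (FAnd (FACBox (PPow a 0) A C p)
      (FACBox (PLoop a) A FTrue (FImp p (FACBox a A C p))))).
Proof.
intros W; apply valid_FIff; intros v.
rewrite sat_FACBox_loop; split.
- intros H; split; [apply (H O)|]; apply sat_FACBox_loop; intros n.
  specialize (H (S n)); apply sat_FACBox_pow_Sr in H; [|exact W].
  revert H; apply sat_FACBox_mono; trivial; [intros; apply sat_true | intros u K _; exact K].
- intros [H0 H] n; induction n as [|n IH]; [exact H0|].
  apply sat_FACBox_pow_Sr; trivial.
  rewrite sat_FACBox_loop in H; specialize (H n).
  intros tau w R; destruct (IH tau w R) as [I1 I2], (H tau w R) as [_ H2]; split; trivial.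
  intros HA u E; exact (H2 HA u E (I2 HA u E)).
Qed.

Lemma sound_acsend ch h th (A C p : fml Sg) :
  valid (FIff (FACBox (PSend ch h th) A C p)
    (FAnd C (FImp A (FBox (PSend ch h th) (FAnd C (FImp A p)))))).
Proof.
apply valid_FIff; intros v; split.
- intros H; split.
  { rewrite <- (append_nil v); apply (H [] None (sem_nil _ _)).
    intros t Q; apply pprefix_length in Q; simpl in Q; lia. }
  intros HA tau w [[[= ->] E]|[[=] _]].
  destruct (H tau (Some v)) as [H1 H2]; [now left|].
  assert (HA' : forall t, pprefix t tau -> sat A (append v t)).
  { intros t Q; apply pprefix_length in Q; subst tau; destruct t; simpl in Q; [|lia].
    now rewrite append_nil. }
  split; [now apply H1|]; intros HA2; apply H2; trivial.
  intros t Q; apply prefix_pprefix in Q as [->|Q]; [exact HA2 | exact (HA' _ Q)].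
- intros [HC HA] tau w R; cbn [sem] in R.
  set (e := [(h, _)]) in R.
  (* A prefix of a one-event trace is empty or everything, so either nothing was observed or the
     event was, with or without termination. *)
  assert (D : (tau = [] /\ w = None) \/ (tau = e /\ (w = None \/ w = Some v))).
  { destruct R as [[-> ->]|[-> [r E]]]; [tauto|].
    destruct tau as [|e' tau]; [tauto|]; right; split; [|tauto].
    unfold e in *; injection E as -> E; symmetry in E; apply app_eq_nil in E as [-> _].
    reflexivity. }
  destruct D as [[-> ->]|[-> D]].
  { rewrite append_nil; split; [trivial | discriminate]. }
  (* The unfinished run that shows the event is handled through the finished run on the same trace,
     the only kind the plain box mentions. *)
  assert (K : (forall t, pprefix t e -> sat A (append v t)) ->
    sat (FAnd C (FImp A p)) (append v e)).
  { intros Q; apply HA; [|left; now split].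
    rewrite <- (append_nil v); apply Q; split; [now exists e | discriminate]. }
  split; [intros Q; now apply K|].
  intros Q u E; destruct D; [congruence|]; replace u with v by congruence.
  apply K; [|apply Q, prefix_refl]; intros t [S _]; auto.
Qed.

(** Choosing the input beforehand changes only [x]: the timestamp is unaffected since [x] is not
    [mu], and [A] and [C] do not mention [x] by well-formedness. *)
Lemma sound_acrecv ch h x (A C p : fml Sg) :
  x <> smu Sg -> wf (FACBox (PRecv ch h x) A C p) ->
  valid (FIff (FACBox (PRecv ch h x) A C p)
    (FBox (PAny x) (FACBox (PSend ch h (PVar x)) A C p))).
Proof.
intros M [_ [WA [WC [_ N]]]]; apply valid_FIff; intros v.
assert (E : forall (q : fml Sg), wf q -> ~ In (VarR x) (fv q) -> forall d t,
  sat q (append (updR v x d) t) <-> sat q (append v t)).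
{ intros q W I d t; apply coincidence; trivial; intros [y|n|g] J; simpl; trivial.
  destruct sVR_dec; [congruence | trivial]. }
assert (EA : ~ In (VarR x) (fv A)).
{ intros I; apply (N (VarR x)); simpl; insimp; split; [tauto | right; now left]. }
assert (EC : ~ In (VarR x) (fv C)).
{ intros I; apply (N (VarR x)); simpl; insimp; split; [tauto | right; now left]. }
assert (T : forall d, st_R (updR v x d) x = d /\ st_R (updR v x d) (smu Sg) = st_R v (smu Sg)).
{ intros d; simpl; split; destruct sVR_dec; congruence. }
split; intros H.
- intros tau w [[_ [=]]|[-> [d [= ->]]]]; rewrite append_nil.
  intros tau w R; destruct (H tau w) as [H1 H2].
  { exists d; cbn [sem ev_poly] in R; destruct (T d) as [T1 T2]; now rewrite T1, T2 in R. }
  split.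
  + intros Q; apply E, H1; trivial; intros t P; apply (E A WA EA d), Q, P.
  + intros Q; apply H2; intros t P; apply (E A WA EA d), Q, P.
- intros tau w [d R].
  pose proof (H [] (updR v x d)) as K; rewrite append_nil in K.
  destruct (fun k => K k tau w) as [H1 H2].
  { right; split; trivial; now exists d. }
  { destruct (T d) as [T1 T2]; cbn [sem ev_poly]; now rewrite T1, T2. }
  split.
  + intros Q; apply (E C WC EC d), H1; intros t P; apply E, Q; trivial.
  + intros Q; apply H2; intros t P; apply E, Q; trivial.
Qed.

Lemma sound_assumption_closure a (A A1 A2 C1 C2 p K : fml Sg) :
  wf (FAnd (FImp (FAnd A C1) A2) (FImp (FAnd A C2) A1)) ->
  is_closure (FAnd (FImp (FAnd A C1) A2) (FImp (FAnd A C2) A1)) K ->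
  valid (FImp (FAnd K (FACBox a (FAnd A1 A2) (FAnd C1 C2) p))
    (FACBox a A (FAnd C1 C2) p)).
Proof.
intros W [zs [_ [Z ->]]] v [HK H].
assert (K : forall u, sat (FAnd (FImp (FAnd A C1) A2) (FImp (FAnd A C2) A1)) u).
{ intros u; apply (sat_forall_list (v := v) (zs := zs)); trivial.
  intros z I; left; now apply Z. }
clear HK Z.
(* Assumption and commitment are established alternately along the prefixes. *)
assert (L : forall n tau w, (length tau < n)%nat -> sem a v tau w ->
  (forall t, pprefix t tau -> sat A (append v t)) ->
  (forall t, pprefix t tau -> sat (FAnd A1 A2) (append v t)) /\
  sat (FAnd C1 C2) (append v tau)).
{ induction n as [|n IH]; intros tau w Ln R HA; [lia|].
  assert (Q : forall t, pprefix t tau -> sat (FAnd A1 A2) (append v t)).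
  { intros t Q; pose proof (pprefix_length Q).
    (* The induction hypothesis yields both commitments on the shorter trace [t]; with [A] there,
       each implication of [K] turns one commitment into the other component's assumption. *)
    destruct (IH t None) as [_ [S1 S2]]; [lia | exact (sem_prefix R (proj1 Q)) | |].
    - intros t' Q'; apply HA; exact (pprefix_trans_r Q' (proj1 Q)).
    - destruct (K (append v t)) as [K1 K2]; split; [apply K2 | apply K1];
        (split; [now apply HA | assumption]). }
  split; [exact Q|]; now apply (H tau w R). }
intros tau w R; split.
- intros HA; now apply (L (S (length tau)) tau w ltac:(lia) R).
- intros HA u ->; destruct (L (S (length tau)) tau _ ltac:(lia) R) as [L1 [L2 L3]].
  { intros t [Q _]; auto. }
  apply (H tau (Some u) R); trivial; intros t Q.
  apply prefix_pprefix in Q as [->|Q]; [|exact (L1 _ Q)].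
  destruct (K (append v tau)) as [K1 K2]; split; [apply K2 | apply K1];
    (split; [apply HA, prefix_refl | assumption]).
Qed.

(** All traces are empty, so the strict assumption is vacuous and the non-strict one speaks about
    the initial state alone. *)
Lemma sound_no_com a (A C p : fml Sg) : cn_prog a = [] ->
  valid (FIff (FACBox a A C p) (FAnd C (FImp A (FBox a p)))).
Proof.
intros E; apply valid_FIff; intros v.
assert (N : forall tau w, sem a v tau w -> tau = []).
{ intros [|e tau] w R; trivial; pose proof (sem_chan (e := e) R (or_introl eq_refl)) as I.
  rewrite E in I; destruct I. }
split; intros H.
- split.
  { rewrite <- (append_nil v); apply (H [] None (sem_nil _ _)).
    intros t Q; apply pprefix_length in Q; simpl in Q; lia. }
  intros HA tau w R; apply (H tau (Some w) R); trivial.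
  rewrite (N _ _ R); intros t Q; apply prefix_nil in Q as ->; now rewrite append_nil.
- destruct H as [HC HP]; intros tau w R; pose proof (N _ _ R) as ->; split.
  { now rewrite append_nil. }
  intros HA u ->; apply HP; trivial.
  rewrite <- (append_nil v); apply HA, prefix_refl.
Qed.

(** At the end of a run, commitment and assumption hold for its full trace over the initial state;
    [preserves] moves them to the final state, where [C] can be added and [A] discharged. *)
Lemma sound_weaken a (A C p : fml Sg) : wf (FACBox a A C p) ->
  valid (FIff (FACBox a A C p) (FAnd C (FACBox a A C (FAnd C (FImp A p))))).
Proof.
intros [_ [WA [WC [_ N]]]]; apply valid_FIff; intros v.
assert (PA : preserves (sem a) (sat A)).
{ apply sem_preserves; trivial; intros z I J; apply N; insimp; tauto. }
assert (PC : preserves (sem a) (sat C)).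
{ apply sem_preserves; trivial; intros z I J; apply N; insimp; tauto. }
split; intros H.
- split.
  { rewrite <- (append_nil v); apply (H [] None (sem_nil _ _)).
    intros t Q; apply pprefix_length in Q; simpl in Q; lia. }
  intros tau w R; destruct (H tau w R) as [H1 H2]; split; trivial.
  intros HA u ->; split; [|intros _; now apply H2].
  apply (PC _ _ _ _ R), H1; intros t [Q _]; exact (HA t Q).
- destruct H as [_ H]; intros tau w R; destruct (H tau w R) as [H1 H2]; split; trivial.
  intros HA u ->; apply (H2 HA u eq_refl), (PA _ _ _ _ R), HA, prefix_refl.
Qed.

Lemma sound_and a (A C1 C2 p1 p2 : fml Sg) :
  valid (FIff (FACBox a A (FAnd C1 C2) (FAnd p1 p2))
    (FAnd (FACBox a A C1 p1) (FACBox a A C2 p2))).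
Proof.
apply valid_FIff; intros v; split.
- intros H; split; (eapply sat_FACBox_mono; [| | |exact H]); simpl; tauto.
- intros [H1 H2] tau w R; destruct (H1 tau w R) as [K1 L1], (H2 tau w R) as [K2 L2].
  split; [intros Q | intros Q u E]; split;
    [exact (K1 Q) | exact (K2 Q) | exact (L1 Q u E) | exact (L2 Q u E)].
Qed.

(** In the parallel axiom the assumption is given on prefixes of the joint trace but needed on
    prefixes of its projection to one component. *)
Lemma prefix_filter_inv (T : Type) (f : T -> bool) (t r : list T) :
  prefix t (filter f r) -> exists r', prefix r' r /\ filter f r' = t.
Proof.
revert t; induction r as [|e r IH]; intros t; simpl.
- intros P; apply prefix_nil in P as ->; exists []; split; [now exists [] | reflexivity].
- destruct (f e) eqn:F.
  + destruct t as [|e' t]; [intros _; exists []; split; [now eexists | reflexivity]|].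
    intros [q E]; injection E as -> E.
    destruct (IH t) as [r' [[q' ->] E']]; [now exists q|].
    exists (e' :: r'); split; [now exists q' | simpl; now rewrite F, E'].
  + intros P; destruct (IH t P) as [r' [[q' ->] E']].
    exists (e :: r'); split; [now exists q' | simpl; now rewrite F].
Qed.

Lemma rec_by_fch (f : sChan Sg -> bool) h tau :
  fch f (rec_by h tau) = rec_by h (filter (fun e => f (ev_ch (snd e))) tau).
Proof.
unfold rec_by, fch; induction tau as [|[g e] tau IH]; simpl; trivial.
destruct sVT_dec as [->|N] eqn:D; simpl; destruct (f (ev_ch e)) eqn:F; simpl;
  rewrite ?D; simpl; congruence.
Qed.

Lemma sound_par a b (A C p : fml Sg) :
  wf (FACBox (PPar a b) A C p) -> no_interference a b A C p ->
  valid (FImp (FACBox a A C p) (FACBox (PPar a b) A C p)).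
Proof.
intros [Wab [WA [WC [Wp N]]]] [I1 [I2 I3]] v H tau w R.
destruct R as (wa & wb & Ra & Rb & M & S & Rt & ->); cbn [bv] in *.
(* Only the channels that [b] does not access exclusively are observable. *)
set (f := fun c => (negb (mem_chan (cn_prog b) c) || mem_chan (cn_prog a) c)%bool).
assert (Hf : forall q, q = A \/ q = C \/ q = p -> forall c, cn q c -> f c = true).
{ intros q Q c I; unfold f; destruct (mem_chan (cn_prog b) c) eqn:B; trivial; simpl.
  apply mem_chan_In; apply mem_chan_In in B; exact (I3 q Q c I B). }
(* An event dropped by the projection to [a] lies on a channel of [b] that is not one of [a], and
   [f] hides exactly those. *)
assert (HT : forall t h, prefix t tau ->
  fch f (rec_by h t) = fch f (rec_by h (rproj (cn_prog a) t))).
{ intros t h [r ->]; rewrite !rec_by_fch; f_equal.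
  apply rproj_fix_app_l in Rt.
  assert (F : forall e, In e t -> mem_chan (cn_prog a ++ cn_prog b) (ev_ch (snd e)) = true).
  { intros e I; rewrite Rt in I; now apply filter_In in I. }
  clear - F; induction t as [|e t IH]; simpl; trivial.
  rewrite IH by (intros; apply F; now right).
  specialize (F e (or_introl eq_refl)); rewrite mem_chan_In, in_app_iff, <- !mem_chan_In in F.
  unfold f; destruct (mem_chan (cn_prog a) (ev_ch (snd e))) eqn:Ea; simpl.
  - rewrite Ea; simpl; now destruct (mem_chan (cn_prog b) _).
  - destruct F as [F|F]; [discriminate|]; now rewrite F. }
assert (E : forall q, q = A \/ q = C \/ q = p -> wf q -> forall t, prefix t tau ->
  (sat q (append v (rproj (cn_prog a) t)) <-> sat q (append v t))).
{ intros q Q W t P; apply coincidence_chan with f; auto; [now apply Hf|].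
  intros [x|n|h] _; simpl; trivial; unfold fch; rewrite !filter_app.
  f_equal; now apply HT. }
destruct (H _ _ Ra) as [H1 H2]; split.
- intros HA; apply (E C ltac:(tauto) WC tau (prefix_refl _)), H1.
  intros t Q; destruct (prefix_filter_inv (proj1 Q)) as [r [P Er]].
  rewrite <- Er; apply E; [tauto.. |]; apply HA; split; trivial.
  intros ->; now apply (proj2 Q).
- intros HA u Eu; destruct wa as [wa|], wb as [wb|]; try discriminate.
  injection Eu as <-; simpl in M.
  assert (Pa : sat p (append wa (rproj (cn_prog a) tau))).
  { apply H2; trivial; intros t Q; destruct (prefix_filter_inv Q) as [r [P Er]].
    rewrite <- Er; apply E; [tauto..|]; auto. }
  apply sem_frame in Ra as [Na [Ta Fa]]; apply sem_frame in Rb as [Nb [Tb Fb]].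
  refine (proj1 (coincidence_chan (f := f) Wp _ _) Pa); [apply Hf; tauto|].
  intros [x|n|h] I; simpl.
  (* A variable not bound by [a] is taken from [wb]. If [b] binds it, noninterference makes it [mu],
     whose final values agree; otherwise both components keep its initial value. *)
  + destruct in_dec as [J|J]; trivial.
    destruct (in_dec (@var_dec Sg) (VarR x) (bv b)) as [K|K].
    * destruct (I1 (VarR x)) as [[= ->]|[]]; [insimp; tauto | now symmetry].
    * now rewrite Fb, Fa.
  + rewrite Na, Nb; now destruct in_dec.
  + rewrite Ta, Tb; unfold fch; rewrite !filter_app.
    f_equal; [now destruct in_dec | apply HT, prefix_refl].
Qed.

End Boxes.

(** * Recorder renaming *)

Section Renaming.
Context {Sg : signature} (h h0 : sVT Sg).
Implicit Types (v u : state Sg) (tau : rtrace (Sg := Sg)) (a b : prog Sg).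

(* On syntax without [h0] renaming coincides with this involution. *)
Definition swap (g : sVT Sg) : sVT Sg :=
  if sVT_dec g h then h0 else if sVT_dec g h0 then h else g.

Lemma swap_invol g : swap (swap g) = g.
Proof.
unfold swap; repeat destruct sVT_dec; congruence.
Qed.

Lemma swap_inj g g' : swap g = swap g' -> g = g'.
Proof. intros E; now rewrite <- (swap_invol g), E, swap_invol. Qed.

Lemma swap_ren g : g <> h0 -> swap g = ren_tvar h h0 g.
Proof. unfold swap, ren_tvar; destruct sVT_dec; trivial; now destruct sVT_dec. Qed.

Definition swp tau : rtrace := map (fun e => (swap (fst e), snd e)) tau.

Lemma swp_invol tau : swp (swp tau) = tau.
Proof.
unfold swp; rewrite map_map; rewrite <- (map_id tau) at 2; apply map_ext.
intros [g e]; simpl; now rewrite swap_invol.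
Qed.

Lemma swp_app tau1 tau2 : swp (tau1 ++ tau2) = swp tau1 ++ swp tau2.
Proof. apply map_app. Qed.

Lemma swp_eq tau1 tau2 : swp tau1 = swp tau2 <-> tau1 = tau2.
Proof.
split; [|congruence]; intros E; now rewrite <- (swp_invol tau1), E, swp_invol.
Qed.

Lemma swp_nil tau : swp tau = [] <-> tau = [].
Proof. exact (swp_eq tau []). Qed.

Lemma swp_prefix tau1 tau2 : prefix (swp tau1) (swp tau2) <-> prefix tau1 tau2.
Proof.
split; intros [r E]; exists (swp r).
- apply swp_eq; now rewrite swp_app, swp_invol.
- now rewrite E, swp_app.
Qed.

Lemma swp_pprefix tau1 tau2 : pprefix (swp tau1) (swp tau2) <-> pprefix tau1 tau2.
Proof. unfold pprefix; now rewrite swp_prefix, swp_eq. Qed.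

Lemma rproj_swp Y tau : rproj Y (swp tau) = swp (rproj Y tau).
Proof.
unfold rproj, swp; induction tau as [|[g e] tau IH]; simpl; trivial.
destruct mem_chan; simpl; congruence.
Qed.

Lemma chronological_swp tau : chronological (swp tau) <-> chronological tau.
Proof. unfold chronological, swp; now rewrite map_map. Qed.

Lemma rec_by_swp g tau : rec_by (swap g) (swp tau) = rec_by g tau.
Proof.
unfold rec_by, swp; induction tau as [|[g' e] tau IH]; simpl; trivial.
destruct (sVT_dec g' g) as [->|N]; destruct sVT_dec as [E|N']; simpl;
  [congruence | now destruct N' | apply swap_inj in E; now destruct N | exact IH].
Qed.

Lemma obs_le_swp tau w tau' (w' : option (state Sg)) :
  obs_le (swp tau) w (swp tau') w' <-> obs_le tau w tau' w'.
Proof. unfold obs_le; now rewrite swp_eq, swp_prefix. Qed.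

Lemma sem_seq_swp (U U' M M' : denot) v tau w :
  (forall v tau w, U' v (swp tau) w <-> U v tau w) ->
  (forall v tau w, M' v (swp tau) w <-> M v tau w) ->
  (sem_seq U' M' v (swp tau) w <-> sem_seq (Sg := Sg) U M v tau w).
Proof.
intros E F; split; intros [[-> [w' H]]|(t1 & u & t2 & H1 & H2 & Et)].
- left; split; trivial; exists w'; now apply E.
- right; exists (swp t1), u, (swp t2); rewrite <- E, <- F, !swp_invol.
  repeat split; trivial; apply swp_eq; now rewrite Et, swp_app, !swp_invol.
- left; split; trivial; exists w'; now apply E.
- right; exists (swp t1), u, (swp t2); rewrite E, F, Et, swp_app; auto.
Qed.

Lemma cn_ren a : cn_prog (ren_prog h h0 a) = cn_prog a.
Proof. induction a; simpl; congruence. Qed.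

Lemma bv_ren a x : In (VarR x) (bv (ren_prog h h0 a)) <-> In (VarR x) (bv a).
Proof.
induction a; simpl; insimp; try tauto; intuition discriminate.
Qed.

Lemma merge_ext X Y (u v : state Sg) :
  (forall x, In (VarR x) X <-> In (VarR x) Y) ->
  st_N u = st_N v -> st_T u = st_T v -> merge X u v = merge Y u v.
Proof.
intros E EN ET; apply state_eq; intros y; simpl; rewrite ?EN, ?ET.
- specialize (E y); destruct in_dec, in_dec; tauto.
- now destruct in_dec, in_dec.
- now destruct in_dec, in_dec.
Qed.

(** The start and end states are unchanged: recorders show up in the trace of a run only, never in
    the states that [sem] produces. *)
Lemma sem_ren a v tau w : ~ In (VarT h0) (occ_prog a) ->
  (sem (ren_prog h h0 a) v (swp tau) w <-> sem a v tau w).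
Proof.
revert v tau w; induction a; intros v tau w N;
  cbn [ren_prog sem occ_prog] in *; unfold bot_D, sem_test, bot_D;
  rewrite ?swp_nil; try tauto; try (rewrite in_app_iff in N).
- apply sem_seq_swp; intros; [apply IHa1 | apply IHa2]; tauto.
- rewrite IHa1, IHa2; tauto.
- assert (E : forall n v tau w, sem_pow (sem (ren_prog h h0 a)) n v (swp tau) w <->
    sem_pow (sem a) n v tau w).
  { induction n as [|n IH]; intros; cbn [sem_pow].
    - unfold sem_test, bot_D; now rewrite swp_nil.
    - apply sem_seq_swp; trivial; intros; now apply IHa. }
  split; intros [n H]; exists n; now apply E.
- rewrite <- swap_ren by (intros ->; apply N; now left).
  apply (@obs_le_swp tau w [(h1, _)]).
- rewrite <- swap_ren by (intros ->; apply N; now left).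
  split; intros [d H]; exists d; revert H; apply (@obs_le_swp tau w [(h1, _)]).
- cbn [cn_prog]; rewrite !cn_ren, !rproj_swp.
  (* Renaming changes the set that governs the merge in trace variables only, and on those both
     components end with the initial values. *)
  assert (G : forall wa wb, sem a1 v (rproj (cn_prog a1) tau) wa ->
    sem a2 v (rproj (cn_prog a2) tau) wb ->
    omerge (bv (ren_prog h h0 a1)) wa wb = omerge (bv a1) wa wb).
  { intros [wa|] [wb|]; simpl; trivial; intros Ha Hb.
    apply sem_frame in Ha as [Na [Ta _]]; apply sem_frame in Hb as [Nb [Tb _]].
    f_equal; apply merge_ext; [intros; apply bv_ren | congruence | congruence]. }
  split; intros (wa & wb & Ha & Hb & M & S & R & ->); exists wa, wb.
  + rewrite IHa1 in Ha by tauto; rewrite IHa2 in Hb by tauto.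
    rewrite chronological_swp in S; rewrite swp_eq in R; rewrite (G wa wb Ha Hb); tauto.
  + rewrite (G wa wb Ha Hb), IHa1, IHa2, chronological_swp, swp_eq by tauto; tauto.
Qed.

(** Excluding [h0] leaves [u] unconstrained at [h]. The send axiom needs this freedom: there [u]
    keeps the old history at [h] and [v] has an unrelated one at [h0]. *)
Definition renamed v u : Prop :=
  st_R u = st_R v /\ st_N u = st_N v /\
  forall g, g <> h0 -> st_T u (swap g) = st_T v g.

Lemma ev_poly_renamed th v u : renamed v u -> ev_poly th u = ev_poly th v.
Proof. intros [E _]; apply ev_poly_ext; now rewrite E. Qed.

Lemma ev_ren_ttm te v u : renamed v u -> ~ In (VarT h0) (fv_ttm te) ->
  ev_ttm (ren_ttm h h0 te) u = ev_ttm te v.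
Proof.
intros E; induction te; simpl; insimp; intros N; trivial.
- assert (N' : h1 <> h0) by (intros ->; tauto).
  rewrite <- swap_ren by exact N'; destruct E as [_ [_ E]]; now apply E.
- now rewrite !(@ev_poly_renamed _ v u).
- rewrite IHte1, IHte2; tauto.
- now rewrite IHte.
Qed.

Lemma ev_ren_itm ie v u : renamed v u -> ~ In (VarT h0) (fv_itm ie) ->
  ev_itm (ren_itm h h0 ie) u = ev_itm ie v.
Proof.
intros E; induction ie; simpl; insimp; intros N; trivial.
- destruct E as [_ [E _]]; now rewrite E.
- rewrite IHie1, IHie2; tauto.
- now rewrite (@ev_ren_ttm te v u).
Qed.

Lemma ev_ren_ctm ce v u : renamed v u -> ~ In (VarT h0) (fv_ctm ce) ->
  ev_ctm (ren_ctm h h0 ce) u = ev_ctm ce v.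
Proof.
intros E; destruct ce; simpl; insimp; intros N; trivial.
rewrite (@ev_ren_ttm te v u), (@ev_ren_itm ie v u); tauto.
Qed.

Lemma ev_ren_rtm e v u : renamed v u -> ~ In (VarT h0) (fv_rtm e) ->
  ev_rtm (ren_rtm h h0 e) u = ev_rtm e v.
Proof.
intros E; induction e; simpl; insimp; intros N; trivial.
- destruct E as [E _]; now rewrite E.
- rewrite IHe1, IHe2; tauto.
- rewrite IHe1, IHe2; tauto.
- rewrite (@ev_ren_ttm te v u), (@ev_ren_itm ie v u); tauto.
- rewrite (@ev_ren_ttm te v u), (@ev_ren_itm ie v u); tauto.
Qed.

Lemma renamed_append v u tau :
  renamed v u -> renamed (append v tau) (append u (swp tau)).
Proof.
intros [ER [EN ET]]; repeat split; simpl; trivial.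
intros g N; now rewrite ET, rec_by_swp.
Qed.

Lemma renamed_updR v u x d : renamed v u -> renamed (updR v x d) (updR u x d).
Proof.
intros [ER [EN ET]]; repeat split; simpl; trivial; now rewrite ER.
Qed.

Lemma renamed_updN v u n d : renamed v u -> renamed (updN v n d) (updN u n d).
Proof.
intros [ER [EN ET]]; repeat split; simpl; trivial; now rewrite EN.
Qed.

Lemma renamed_updT v u g d : renamed v u -> g <> h0 ->
  renamed (updT v g d) (updT u (ren_tvar h h0 g) d).
Proof.
intros [ER [EN ET]] N; repeat split; simpl; trivial; intros g' N'.
rewrite <- swap_ren by exact N.
destruct (sVT_dec g' g) as [->|D]; destruct sVT_dec as [D'|D']; trivial;
  [now destruct D' | apply swap_inj in D'; now destruct D | now apply ET].
Qed.

Lemma renamed_sem a v u tau w w' :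
  renamed v u -> sem a v tau (Some w) -> sem (ren_prog h h0 a) u (swp tau) (Some w') ->
  st_R w' = st_R w -> renamed w w'.
Proof.
intros [_ [EN ET]] H H' ER.
apply sem_frame in H as [N [T _]]; apply sem_frame in H' as [N' [T' _]].
split; [exact ER|]; split; [congruence|]; intros g D; rewrite T, T'; auto.
Qed.

Theorem sat_ren p v u : wf p -> ~ In (VarT h0) (occ p) -> renamed v u ->
  (sat (ren h h0 p) u <-> sat p v).
Proof.
(* Only the histories of [v] and [u] differ, so [sem_real] passes from [v] to [u] and [sem_ren] then
   renames at [u]. *)
assert (B : forall a v u, wf_prog a -> ~ In (VarT h0) (occ_prog a) -> renamed v u ->
  bisim (fun w w' => st_R w' = st_R w) (sem a)
    (fun v tau w => sem (ren_prog h h0 a) v (swp tau) w) v u).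
{ clear; intros a v u W N E; destruct (@sem_real _ a v u W) as [F B].
  { destruct E as [E _]; now rewrite E. }
  assert (O : forall w w', orel (fun w w' => forall x, st_R w' x = st_R w x) w w' ->
    orel (fun w w' => st_R (Sg := Sg) w' = st_R w) w w').
  { intros w w'; apply orel_mono; intros; now apply functional_extensionality. }
  split; intros tau w H.
  - destruct (F _ _ H) as [w' [H' Ow]]; exists w'; split; auto; now apply sem_ren.
  - rewrite sem_ren in H by exact N.
    destruct (B _ _ H) as [w' [H' Ow]]; exists w'; auto. }
revert v u; induction p; intros v u W N E; cbn [ren sat occ wf fv] in *; insimp.
1,5: rewrite !(fun e => @ev_ren_rtm e v u E) by tauto; tauto.
1,4: rewrite !(fun e => @ev_ren_itm e v u E) by tauto; tauto.
1: rewrite !(fun e => @ev_ren_ctm e v u E) by tauto; tauto.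
1,2: rewrite !(fun e => @ev_ren_ttm e v u E) by tauto; tauto.
1: rewrite (IHp v u); tauto.
1-3: rewrite (IHp1 v u), (IHp2 v u); tauto.
1,2: simpl in N; destruct z as [x|n|g]; simpl.
1,4: assert (J : forall d, sat (ren h h0 p) (updR u x d) <-> sat p (updR v x d))
  by (intros; apply IHp; [exact W | tauto | now apply renamed_updR]).
3,5: assert (J : forall d, sat (ren h h0 p) (updN u n d) <-> sat p (updN v n d))
  by (intros; apply IHp; [exact W | tauto | now apply renamed_updN]).
5,6: assert (J : forall d, sat (ren h h0 p) (updT u (ren_tvar h h0 g) d) <->
    sat p (updT v g d))
  by (intros; apply IHp; [exact W | tauto | apply renamed_updT; trivial; intros ->; tauto]).
1,3,5: split; intros H d; now apply J.
1-3: split; intros [d H]; exists d; now apply J.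
- destruct W as [W1 W2].
  assert (J : forall tau w w', sem a v tau (Some w) ->
    sem (ren_prog h h0 a) u (swp tau) (Some w') -> st_R w' = st_R w ->
    (sat (ren h h0 p) (append w' (swp tau)) <-> sat p (append w tau))).
  { intros tau w w' H H' ER; apply IHp; [exact W2 | tauto|].
    now apply renamed_append, (@renamed_sem a v u tau). }
  destruct (B a v u W1 ltac:(tauto) E) as [F G]; split; intros K tau w H.
  + destruct (F _ _ H) as [[w'|] [H' O]]; [|destruct O].
    apply (J _ _ _ H H' O); auto.
  + rewrite <- (swp_invol tau) in H |- *.
    destruct (G _ _ H) as [[w'|] [H' O]]; [|destruct O].
    apply (J _ _ _ H' H O); auto.
- destruct W as [W1 [W2 [W3 [W4 _]]]].
  assert (J : forall tau w w', sem a v tau (Some w) ->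
    sem (ren_prog h h0 a) u (swp tau) (Some w') -> st_R w' = st_R w ->
    (sat (ren h h0 p3) (append w' (swp tau)) <-> sat p3 (append w tau))).
  { intros tau w w' H H' ER; apply IHp3; [exact W4 | tauto|].
    now apply renamed_append, (@renamed_sem a v u tau). }
  assert (JA : forall t, sat (ren h h0 p1) (append u (swp t)) <-> sat p1 (append v t)).
  { intros t; apply IHp1; [exact W2 | tauto | now apply renamed_append]. }
  assert (JC : forall t, sat (ren h h0 p2) (append u (swp t)) <-> sat p2 (append v t)).
  { intros t; apply IHp2; [exact W3 | tauto | now apply renamed_append]. }
  destruct (B a v u W1 ltac:(tauto) E) as [F G]; split; intros K tau w H.
  + destruct (F _ _ H) as [w' [H' O]]; destruct (K _ _ H') as [K1 K2]; split.
    * intros Q; apply JC, K1; intros t P; rewrite <- (swp_invol t) in P |- *.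
      rewrite swp_pprefix in P; apply JA; exact (Q _ P).
    * intros Q w1 ->; destruct w' as [w'|]; [|destruct O].
      apply (J _ _ _ H H' O), K2; trivial.
      intros t P; rewrite <- (swp_invol t) in P |- *.
      rewrite swp_prefix in P; apply JA; exact (Q _ P).
  + rewrite <- (swp_invol tau) in H |- *.
    destruct (G _ _ H) as [w' [H' O]]; destruct (K _ _ H') as [K1 K2]; split.
    * intros Q; apply JC, K1; intros t P; apply JA, Q; now apply swp_pprefix.
    * intros Q w1 ->; destruct w' as [w'|]; [|destruct O].
      apply (J _ _ _ H' H O), K2; trivial.
      intros t P; apply JA, Q; now apply swp_prefix.
Qed.

End Renaming.

(** The equation in the quantified formula pins [h0] to the extended history, and up to renaming the
    resulting state is the one reached by sending. *)
Lemma sound_send (Sg : signature) ch h th h0 (p : fml Sg) :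
  wf p -> ~ In (VarT h0) (occ (FBox (PSend ch h th) p)) ->
  valid (FIff (FBox (PSend ch h th) p)
    (FAll (VarT h0) (FImp (FEqT (TVar h0) (TCat (TVar h) (TItem ch th (PVar (smu Sg)))))
       (ren h h0 p)))).
Proof.
intros W N; apply valid_FIff; intros v; simpl in N; insimp.
assert (D : h <> h0) by (intros ->; tauto).
set (e := Event ch (ev_poly th v) (st_R v (smu Sg))).
assert (J : sat (ren h h0 p) (updT v h0 (st_T v h ++ [e])) <-> sat p (append v [(h, e)])).
{ apply sat_ren; [exact W | tauto|]; repeat split; simpl; intros g N'.
  unfold swap, rec_by; simpl; destruct (sVT_dec g h) as [->|Dg].
  - destruct sVT_dec as [_|F]; [|now destruct F].
    destruct sVT_dec as [_|F]; [reflexivity | now destruct F].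
  - destruct (sVT_dec g h0) as [F|_]; [now destruct N'|].
    destruct sVT_dec as [F|_]; [now destruct N'|].
    destruct sVT_dec as [F|_]; [now destruct Dg|]; now rewrite app_nil_r. }
assert (T : forall d, ev_poly th (updT v h0 d) = ev_poly th v) by (intros; now apply ev_poly_ext).
split; intros H.
- intros d; simpl; rewrite T; destruct sVT_dec as [_|F]; [|now destruct F].
  destruct sVT_dec as [F|_]; [now destruct D|]; intros ->.
  apply J, H; left; now split.
- intros tau w [[[= ->] ->]|[[=] _]]; apply J.
  pose proof (H (st_T v h ++ [e])) as K; simpl in K; rewrite T in K.
  destruct sVT_dec as [_|F] in K; [|now destruct F].
  destruct sVT_dec as [F|_] in K; [now destruct D|]; now apply K.
Qed.


(** * Differential equations *)

Section IntervalDerivatives.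

(** Extending a function constantly past the ends of [[0, s]] turns continuity relative to the
    interval into the two-sided continuity asked for by the extreme value and mean value
    theorems. *)
Definition clamp (s r : R) : R := Rmax 0 (Rmin s r).

Lemma clamp_id s r : 0 <= r <= s -> clamp s r = r.
Proof. intros J; unfold clamp; rewrite Rmin_right, Rmax_right; lra. Qed.

Lemma clamp_in s r : 0 <= s -> 0 <= clamp s r <= s.
Proof.
intros S; unfold clamp, Rmax, Rmin; repeat destruct Rle_dec; lra.
Qed.

Lemma clamp_dist s r z : 0 <= z <= s -> Rabs (clamp s r - z) <= Rabs (r - z).
Proof.
intros J; unfold clamp, Rmax, Rmin, Rabs;
  repeat destruct Rle_dec; repeat destruct Rcase_abs; lra.
Qed.

Lemma continuity_clamp g s : 0 <= s ->
  (forall z, 0 <= z <= s -> continue_in g (fun z => 0 <= z <= s) z) ->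
  forall z, 0 <= z <= s -> continuity_pt (fun r => g (clamp s r)) z.
Proof.
intros S C z J eps E; destruct (C z J eps E) as [alp [A H]].
exists alp; split; [exact A|]; intros x [_ D].
simpl in *; unfold Rdist in *; rewrite (clamp_id J).
(* The limit in [continue_in] excludes the point itself, yet [clamp] may send a different [x] to
   [z]; the difference is then zero. *)
destruct (Req_dec (clamp s x) z) as [->|N].
- rewrite Rminus_diag, Rabs_R0; exact E.
- apply H; split; [split; [now apply clamp_in | congruence]|].
  apply Rle_lt_trans with (2 := D); now apply clamp_dist.
Qed.

Lemma continue_in_bounded g s : 0 <= s ->
  (forall z, 0 <= z <= s -> continue_in g (fun z => 0 <= z <= s) z) ->
  exists M, 0 <= M /\ forall z, 0 <= z <= s -> Rabs (g z) <= M.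
Proof.
intros S C; pose proof (continuity_clamp S C) as K.
destruct (continuity_ab_maj _ 0 s S K) as [a [Ha _]].
destruct (continuity_ab_min _ 0 s S K) as [b [Hb _]].
exists (Rabs (g (clamp s a)) + Rabs (g (clamp s b))); split.
{ apply Rplus_le_le_0_compat; apply Rabs_pos. }
intros z J; specialize (Ha z J); specialize (Hb z J); simpl in *.
rewrite (clamp_id J) in Ha, Hb.
unfold Rabs; repeat destruct Rcase_abs; lra.
Qed.

Lemma D_in_nonincreasing g g' s : 0 <= s ->
  (forall z, 0 <= z <= s -> D_in g g' (fun z => 0 <= z <= s) z) ->
  (forall z, 0 <= z <= s -> g' z <= 0) -> g s <= g 0.
Proof.
intros S D N.
destruct (Req_dec s 0) as [->|N0]; [apply Rle_refl|].
set (f := fun r => g (clamp s r)).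
assert (F : forall x, 0 < x < s -> derivable_pt_lim f x (g' x)).
{ intros x J eps P; destruct (D x ltac:(lra) eps P) as [alp [A H]].
  (* Increments below this bound keep [x + h] inside the interval, where [clamp] is the identity. *)
  assert (Q : 0 < Rmin alp (Rmin x (s - x))) by (repeat apply Rmin_glb_lt; lra).
  exists (mkposreal _ Q); simpl; intros h Nh Lh.
  pose proof (Rmin_l alp (Rmin x (s - x))); pose proof (Rmin_r alp (Rmin x (s - x))).
  pose proof (Rmin_l x (s - x)); pose proof (Rmin_r x (s - x)).
  destruct (Rabs_def2 _ _ Lh) as [B1 B2].
  unfold f; rewrite !clamp_id by lra; simpl in H; unfold Rdist in H.
  specialize (H (x + h)); replace (x + h - x) with h in H by ring.
  apply H; split; [split; lra|].
  apply Rlt_le_trans with (1 := Lh); lra. }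
(* Cauchy's mean value theorem against the identity gives Lagrange's form. *)
destruct (MVT f id 0 s (fun x J => exist _ (g' x) (F x J))
  (fun x _ => exist _ 1 (derivable_pt_lim_id x))) as [c [J E]]; [lra| | |].
- apply continuity_clamp; [exact S|]; intros z J; exact (cont_deriv _ _ _ _ (D z J)).
- intros x _; apply derivable_continuous_pt, derivable_pt_id.
- unfold f, id in E; simpl in E; rewrite !clamp_id in E by lra.
  specialize (N c ltac:(lra)); nra.
Qed.

(** The integrating factor [exp (- K * r)] makes the derivative of the product equal to [(g' - K g)]
    times that factor, hence nonpositive. *)
Lemma gronwall_zero g g' K s : 0 <= s ->
  (forall z, 0 <= z <= s -> D_in g g' (fun z => 0 <= z <= s) z) ->
  (forall z, 0 <= z <= s -> g' z <= K * g z) -> g 0 = 0 -> g s <= 0.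
Proof.
intros S D N Z.
assert (H : g s * exp (- K * s) <= g 0 * exp (- K * 0)).
{ apply (@D_in_nonincreasing (fun r => g r * exp (- K * r))
    (fun r => g' r * exp (- K * r) + g r * (- K * exp (- K * r)))); trivial.
  - intros z J; apply Dmult; [now apply D|].
    apply D_in_imp with no_cond; [now split|].
    apply derivable_pt_lim_D_in.
    pose proof (derivable_pt_lim_scal id (- K) z 1 (derivable_pt_lim_id z)) as DL.
    pose proof (derivable_pt_lim_comp _ exp z _ _ DL (derivable_pt_lim_exp _)) as DE.
    rewrite Rmult_1_r, Rmult_comm in DE; exact DE.
  - intros z J; specialize (N z J); pose proof (exp_pos (- K * z)); nra. }
rewrite Z, Rmult_0_l in H; pose proof (exp_pos (- K * s)); nra.
Qed.

End IntervalDerivatives.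

(** * Uniqueness for polynomial differential equations *)

Section Odes.
Context {Sg : signature}.
Implicit Types (v u : state Sg) (tau : rtrace (Sg := Sg)).

Lemma poly_bounded th M : 0 <= M -> exists B, 0 <= B /\ forall v,
  (forall x, In (VarR x) (fv_poly th) -> Rabs (st_R v x) <= M) ->
  Rabs (ev_poly th v) <= B.
Proof.
intros HM; induction th as [x|c|a [Ba [Pa Ha]] b [Bb [Pb Hb]]|a [Ba [Pa Ha]] b [Bb [Pb Hb]]];
  simpl.
- exists M; split; trivial; intros v H; apply H; now left.
- exists (Rabs (Q2R c)); split; [apply Rabs_pos | intros; apply Rle_refl].
- exists (Ba + Bb); split; [lra|]; intros v H.
  apply Rle_trans with (1 := Rabs_triang _ _); apply Rplus_le_compat;
    [apply Ha | apply Hb]; intros x I; apply H; insimp; tauto.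
- exists (Ba * Bb); split; [nra|]; intros v H; rewrite Rabs_mult.
  apply Rmult_le_compat; try apply Rabs_pos; [apply Ha | apply Hb];
    intros x I; apply H; insimp; tauto.
Qed.

(** For products, [a b - a' b' = a (b - b') + (a - a') b'] requires bounds on the factors, whence
    the restriction to [M] and the constant [Ba * Lb + La * Bb]. *)
Lemma poly_lipschitz th M : 0 <= M -> exists L, 0 <= L /\ forall v u e, 0 <= e ->
  (forall x, In (VarR x) (fv_poly th) ->
     Rabs (st_R v x) <= M /\ Rabs (st_R u x) <= M /\ Rabs (st_R v x - st_R u x) <= e) ->
  Rabs (ev_poly th v - ev_poly th u) <= L * e.
Proof.
intros HM; induction th as [x|c|a [La [Pa Ha]] b [Lb [Pb Hb]]|a [La [Pa Ha]] b [Lb [Pb Hb]]];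
  simpl.
- exists 1; split; [lra|]; intros v u e _ H; rewrite Rmult_1_l; apply H; now left.
- exists 0; split; [lra|]; intros v u e _ _; rewrite Rminus_diag, Rabs_R0; lra.
- exists (La + Lb); split; [lra|]; intros v u e He H.
  replace (_ - _) with ((ev_poly a v - ev_poly a u) + (ev_poly b v - ev_poly b u)) by ring.
  rewrite Rmult_plus_distr_r.
  apply Rle_trans with (1 := Rabs_triang _ _); apply Rplus_le_compat;
    [apply Ha | apply Hb]; trivial; intros x I; apply H; insimp; tauto.
- destruct (poly_bounded a HM) as [Ba [Qa Ka]], (poly_bounded b HM) as [Bb [Qb Kb]].
  exists (Ba * Lb + La * Bb); split; [nra|]; intros v u e He H.
  replace (_ - _) with (ev_poly a v * (ev_poly b v - ev_poly b u) +
    (ev_poly a v - ev_poly a u) * ev_poly b u) by ring.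
  replace ((Ba * Lb + La * Bb) * e) with (Ba * (Lb * e) + La * e * Bb) by ring.
  apply Rle_trans with (1 := Rabs_triang _ _); rewrite !Rabs_mult.
  apply Rplus_le_compat; apply Rmult_le_compat; try apply Rabs_pos;
    [apply Ka | apply Hb | apply Ha | apply Kb]; trivial; intros x I; apply H; insimp; tauto.
Qed.

Lemma uniform_bound (T : Type) (X : list T) (Q : T -> R -> Prop) :
  (forall x m m', Q x m -> m <= m' -> Q x m') ->
  (forall x, In x X -> exists m, 0 <= m /\ Q x m) ->
  exists M, 0 <= M /\ forall x, In x X -> Q x M.
Proof.
intros U; induction X as [|x X IH]; intros H.
- exists 0; split; [lra | intros x []].
- destruct IH as [M [HM K]]; [intros; apply H; now right|].
  destruct (H x (or_introl eq_refl)) as [m [Hm q]].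
  exists (m + M); split; [lra|]; intros y [<-|I].
  + apply U with m; trivial; lra.
  + apply U with M; auto; lra.
Qed.

Definition dist2 (l : list (sVR Sg * poly Sg)) v u : R :=
  fold_right (fun p acc => (st_R v (fst p) - st_R u (fst p)) ^ 2 + acc) 0 l.

Lemma dist2_pos l v u : 0 <= dist2 l v u.
Proof.
induction l as [|p l IH]; [apply Rle_refl|].
pose proof (pow2_ge_0 (st_R v (fst p) - st_R u (fst p))); simpl in *; lra.
Qed.

Lemma dist2_le l v u x : In x (map fst l) -> (st_R v x - st_R u x) ^ 2 <= dist2 l v u.
Proof.
induction l as [|p l IH]; [intros []|].
pose proof (dist2_pos l v u); pose proof (pow2_ge_0 (st_R v (fst p) - st_R u (fst p))).
intros [<-|I]; [|specialize (IH I)]; simpl in *; lra.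
Qed.

(** The time derivative of [dist2] along two solutions of [l]. *)
Definition ddist2 (l : list (sVR Sg * poly Sg)) v u : R :=
  fold_right (fun p acc => 2 * (st_R v (fst p) - st_R u (fst p)) *
    (ev_poly (snd p) v - ev_poly (snd p) u) + acc) 0 l.

Definition solves (l : list (sVR Sg * poly Sg)) s (phi : R -> state Sg) : Prop :=
  forall z, 0 <= z <= s -> forall x th, In (x, th) l ->
    D_in (fun r => st_R (phi r) x) (fun r => ev_poly th (phi r))
      (fun z => 0 <= z <= s) z.

Lemma D_in_dist2 l s phi psi z : 0 <= z <= s -> solves l s phi -> solves l s psi ->
  D_in (fun r => dist2 l (phi r) (psi r)) (fun r => ddist2 l (phi r) (psi r))
    (fun z => 0 <= z <= s) z.
Proof.
intros J H K; induction l as [|[x th] l IH]; simpl.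
- apply Dconst.
- apply Dadd; [|apply IH; [intros ? ? ? ? I; apply H | intros ? ? ? ? I; apply K];
    trivial; now right].
  pose proof (Dminus _ _ _ _ _ _ (H z J x th (or_introl eq_refl))
    (K z J x th (or_introl eq_refl))) as D.
  refine (D_in_ext _ _ (Dmult _ _ _ _ _ _ D D)); simpl.
  + apply functional_extensionality; intros r; ring.
  + ring.
Qed.

Lemma ode_unique l s phi psi : 0 <= s -> solves l s phi -> solves l s psi ->
  (forall z x, 0 <= z <= s -> In (VarR x) (fv_rhs l) -> ~ In x (map fst l) ->
     st_R (psi z) x = st_R (phi z) x /\ st_R (phi z) x = st_R (phi 0) x) ->
  (forall x, In x (map fst l) -> st_R (phi 0) x = st_R (psi 0) x) ->
  forall x, In x (map fst l) -> st_R (phi s) x = st_R (psi s) x.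
Proof.
intros S H K C E0.
(* Evolving variables are bounded because they are continuous on a compact interval; the other
   variables that are read stay constant. *)
assert (B : exists M, 0 <= M /\ forall z x, 0 <= z <= s -> In (VarR x) (fv_rhs l) ->
  Rabs (st_R (phi z) x) <= M /\ Rabs (st_R (psi z) x) <= M).
{ destruct (@uniform_bound _ (fv_rhs l) (fun y M => forall x, y = VarR x ->
    forall z, 0 <= z <= s -> Rabs (st_R (phi z) x) <= M /\ Rabs (st_R (psi z) x) <= M))
    as [M [HM Q]].
  - intros y m m' Q L x Ex z J; destruct (Q x Ex z J); split; lra.
  - intros [x|n|h] I; [|exists 0; split; [lra | discriminate]..].
    destruct (in_dec (@sVR_dec Sg) x (map fst l)) as [X|X].
    + pose proof (lookup_in X) as X'.
      destruct (@continue_in_bounded (fun r => st_R (phi r) x) s S) as [M1 [P1 B1]].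
      { intros z J; exact (cont_deriv _ _ _ _ (H z J x _ X')). }
      destruct (@continue_in_bounded (fun r => st_R (psi r) x) s S) as [M2 [P2 B2]].
      { intros z J; exact (cont_deriv _ _ _ _ (K z J x _ X')). }
      exists (M1 + M2); split; [lra|]; intros x' [= <-] z J.
      specialize (B1 z J); specialize (B2 z J); split; lra.
    + exists (Rabs (st_R (phi 0) x)); split; [apply Rabs_pos|].
      intros x' [= <-] z J; destruct (C z x J I X) as [-> ->]; split; apply Rle_refl.
  - exists M; split; trivial; intros z x J I; now apply (Q (VarR x)). }
destruct B as [M [HM B]].
destruct (@uniform_bound _ l (fun p L => forall v u e, 0 <= e ->
  (forall x, In (VarR x) (fv_poly (snd p)) ->
     Rabs (st_R v x) <= M /\ Rabs (st_R u x) <= M /\ Rabs (st_R v x - st_R u x) <= e) ->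
  Rabs (ev_poly (snd p) v - ev_poly (snd p) u) <= L * e)) as [L [HL Lip]].
{ intros p m m' Q Lm v u e He F; apply Rle_trans with (m * e); [now apply Q | nra]. }
{ intros p _; exact (poly_lipschitz (snd p) HM). }
(* With [e] the root of [dist2], every coordinate differs by at most [e] and every right-hand side
   by at most [L * e]; so each of the [length l] summands is at most [2 * L * (e * e)]. *)
assert (G : forall z, 0 <= z <= s ->
  ddist2 l (phi z) (psi z) <= INR (length l) * (2 * L) * dist2 l (phi z) (psi z)).
{ intros z J; set (e := sqrt (dist2 l (phi z) (psi z))).
  assert (He : 0 <= e) by apply sqrt_pos.
  assert (Ee : e * e = dist2 l (phi z) (psi z)) by apply sqrt_sqrt, dist2_pos.
  assert (De : forall x, In x (map fst l) -> Rabs (st_R (phi z) x - st_R (psi z) x) <= e).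
  { intros x I; unfold e; rewrite <- sqrt_Rsqr_abs; apply sqrt_le_1_alt.
    unfold Rsqr; pose proof (dist2_le (phi z) (psi z) I); simpl in *; lra. }
  rewrite <- Ee.
  assert (T : forall p, In p l -> 2 * (st_R (phi z) (fst p) - st_R (psi z) (fst p)) *
    (ev_poly (snd p) (phi z) - ev_poly (snd p) (psi z)) <= 2 * L * (e * e)).
  { intros [x th] I; simpl.
    pose proof (De x (in_map fst _ _ I)) as D1.
    assert (D2 : Rabs (ev_poly th (phi z) - ev_poly th (psi z)) <= L * e).
    { apply (Lip _ I); trivial; simpl; intros y Y.
      pose proof (fv_rhs_In I Y) as Y'; destruct (B z y J Y'); repeat split; trivial.
      destruct (in_dec (@sVR_dec Sg) y (map fst l)) as [Z|Z]; [now apply De|].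
      destruct (C z y J Y' Z) as [-> _]; rewrite Rminus_diag, Rabs_R0; exact He. }
    apply Rle_trans with (2 * (Rabs (st_R (phi z) x - st_R (psi z) x) *
      Rabs (ev_poly th (phi z) - ev_poly th (psi z)))).
    - rewrite <- Rabs_mult, Rmult_assoc; apply Rmult_le_compat_l; [lra | apply Rle_abs].
    - pose proof (Rmult_le_compat _ _ _ _ (Rabs_pos _) (Rabs_pos _) D1 D2); nra. }
  (* Since [e] depends on the whole list, its square is frozen before the induction on the
     summands. *)
  clear - T; revert T; generalize (e * e) as q; intros q.
  unfold ddist2; induction l as [|p l' IH]; intros T; simpl fold_right.
  - simpl; lra.
  - cbn [length]; rewrite S_INR; pose proof (T p (or_introl eq_refl)).
    specialize (IH (fun p' I => T p' (or_intror I))); lra. }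
assert (Z : dist2 l (phi s) (psi s) <= 0).
{ refine (@gronwall_zero (fun r => dist2 l (phi r) (psi r)) _ _ s S _ G _).
  - intros z J; now apply D_in_dist2.
  - clear - E0; induction l as [|p l IH]; simpl; trivial.
    rewrite IH by (intros; apply E0; now right); rewrite E0 by (now left); ring. }
intros x I; pose proof (dist2_le (phi s) (psi s) I); nra.
Qed.

(** * Soundness of the differential equation axioms *)

Lemma sound_time l chi (p : fml Sg) :
  valid (FIff (FBox (PODE l chi) p) (FBox (PODE (add_time l) chi) p)).
Proof.
apply valid_FIff; intros v.
assert (E : forall tau w, sem (PODE l chi) v tau w <-> sem (PODE (add_time l) chi) v tau w).
{ unfold add_time; destruct in_dec as [I|N]; [tauto|].
  (* [ode_run] already imposes slope 1 on [mu] and lets it evolve, so the explicit clock equation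
     adds no constraint. *)
  assert (F : forall s phi, ode_run l chi s phi <->
    ode_run ((smu Sg, PConst 1%Q) :: l) chi s phi).
  { intros s phi; split; intros O z J; pose proof (O z J) as [O1 [O2 [O3 O4]]];
      (split; [exact O1|]); split; [|split; trivial| |split; trivial].
    - intros x th [[= <- <-]|I]; [|now apply O2].
      refine (D_in_ext _ _ O1); [reflexivity|]; simpl; unfold Q2R; simpl; lra.
    - intros y Y; apply O4; simpl in Y |- *; insimp; simpl in *; tauto.
    - intros x th I; apply O2; now right.
    - intros y Y; apply O4; simpl in Y |- *; insimp; simpl in *; tauto. }
  intros tau w; split; (intros [H|(T & s & phi & S & O & V)]; [now left|]);
    right; split; trivial; exists s, phi; (split; [exact S|]);
    (split; [now apply F | exact V]). }
split; intros H tau w R; apply H, E, R.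
Qed.

Lemma fv_fora_occ (chi : fora Sg) z : In z (fv_fora chi) -> In z (occ_fora chi).
Proof. induction chi; simpl; insimp; tauto. Qed.

Lemma fv_prog_occ (a : prog Sg) z :
  In z (fv_prog a) -> In z (occ_prog a) \/ z = VarR (smu Sg).
Proof.
induction a; simpl; unfold par_mu; insimp; simpl; try tauto.
- intros [[I|[<-|[]]]|[I|I]]; try tauto; apply fv_fora_occ in I; tauto.
- intros I; apply fv_fora_occ in I; tauto.
- intros [[<-|[<-|[]]]|I]; tauto.
- intros [<-|[<-|[]]]; tauto.
- intros [[I|I]|[[[<-|[]] _] _]]; tauto.
Qed.

(* The variable [mu] may be read without being mentioned. *)
Lemma fv_occ (p : fml Sg) z : In z (fv p) -> In z (occ p) \/ z = VarR (smu Sg).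
Proof.
induction p; simpl; insimp; try tauto; simpl; try tauto.
- intros [I|I]; [apply fv_prog_occ in I|]; tauto.
- intros [[I|I]|I]; [apply fv_prog_occ in I| |]; tauto.
Qed.

Lemma sound_solve l ys t (p : fml Sg) :
  wf (FBox (PODE l ATrue) p) -> In (smu Sg) (map fst l) ->
  ~ In (VarR t) (occ (FBox (PODE l ATrue) p)) -> solution t l ys ->
  valid (FIff (FBox (PODE l ATrue) p)
    (FAll (VarR t) (FImp (FGeR (RVar t) (RConst 0%Q)) (FBox (PAssign ys) p)))).
Proof.
intros [[_ WM] Wp] M N [Lys Sol]; simpl in N; insimp.
assert (Nl : ~ In t (map fst l)) by (rewrite <- In_lhs; tauto).
(* A free variable without an occurrence can only be [mu], and [mu] is a left-hand side while [t] is
   not. *)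
assert (Np : forall x, In (VarR x) (fv p) -> x <> t).
{ intros x I ->; destruct (fv_occ I) as [J|[= J]]; [tauto|]; now rewrite J in Nl. }
assert (Nr : forall x, In (VarR x) (fv_rhs l) -> x <> t) by (intros x I ->; tauto).
apply valid_FIff; intros v; destruct (Sol v) as [Sol0 SolD].
set (psi := fun r => assign ys (updR v t r)).
assert (Out : forall r x, ~ In x (map fst l) -> x <> t -> st_R (psi r) x = st_R v x).
{ intros r x I D; simpl; rewrite lookup_notin by congruence; simpl.
  now destruct sVR_dec. }
assert (In0 : forall x, In x (map fst l) -> st_R (psi 0) x = st_R v x).
{ intros x I; simpl; apply Sol0, lookup_in; congruence. }
assert (Psi : forall s, solves l s psi).
{ intros s z J x th I; simpl.
  apply D_in_imp with no_cond; [now split|]; apply derivable_pt_lim_D_in.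
  apply SolD with x; trivial; [lra|].
  apply lookup_in; rewrite Lys; exact (in_map fst _ _ I). }
split; intros H.
- intros r Hr; simpl in Hr; destruct sVR_dec as [_|D] in Hr; [|now destruct D].
  rewrite RMicromega.Q2R_0 in Hr.
  intros tau w [[_ [=]]|[-> [= ->]]]; rewrite append_nil.
  (* Along [psi] the variable [t] itself runs from 0 to [r], which an evolution of [l] forbids;
     resetting it to its initial value gives a genuine run, and [p] cannot see the difference. *)
  set (phi := fun r => updR (psi r) t (st_R v t)).
  assert (Phi : forall r x, x <> t -> st_R (phi r) x = st_R (psi r) x).
  { intros q x D; simpl; now destruct sVR_dec. }
  assert (Phi0 : phi 0 = v).
  { apply state_eq; trivial; intros x.
    destruct (sVR_dec x t) as [->|D].
    { simpl; destruct sVR_dec; congruence. }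
    rewrite Phi by exact D.
    destruct (in_dec (@sVR_dec Sg) x (map fst l)); auto. }
  assert (Ph : solves l r phi).
  { intros z J x th I.
    assert (D : x <> t) by (intros ->; apply Nl; exact (in_map fst _ _ I)).
    refine (D_in_ext _ _ (Psi r z J x th I)).
    - apply functional_extensionality; intros q; now rewrite Phi.
    - apply ev_poly_ext; intros y Y; symmetry; apply Phi, Nr; exact (fv_rhs_In I Y). }
  assert (K : sat p (append (phi r) [])).
  { apply H; right; split; trivial; exists r, phi; split; [lra|].
    split; [|split; [now symmetry | reflexivity]].
    intros z J; split; [|split; [|split]].
    - pose proof (lookup_in M) as M'; pose proof (WM _ M') as E; rewrite E in M'.
      refine (D_in_ext _ _ (Ph z J _ _ M')); [reflexivity|]; simpl; unfold Q2R; simpl; lra.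
    - now apply Ph.
    - reflexivity.
    - intros [x|n|h] Y; simpl same_at; trivial; insimp; rewrite In_lhs in Y.
      change (st_R (phi z) x = st_R (phi 0) x); rewrite Phi0.
      destruct (sVR_dec x t) as [->|D].
      + simpl; destruct sVR_dec; congruence.
      + rewrite Phi by exact D; apply Out; tauto. }
  rewrite append_nil in K; refine (proj1 (coincidence Wp _) K).
  intros [x|n|h] I; [apply Phi; auto | reflexivity..].
- intros tau w [[_ [=]]|(-> & s & phi & S & O & V & [= ->])]; rewrite append_nil.
  assert (K : sat p (psi s)).
  { rewrite <- (append_nil (psi s)); apply (H s); [|right; now split].
    simpl; destruct sVR_dec as [_|D]; [|now destruct D]; rewrite RMicromega.Q2R_0; lra. }
  assert (F : forall z, 0 <= z <= s ->
    frame (set_union (@var_dec Sg) (lhs l) [VarR (smu Sg)]) v (phi z)).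
  { intros z J; rewrite V; exact (ode_run_frame J O). }
  assert (Out' : forall z x, 0 <= z <= s -> ~ In x (map fst l) ->
    st_R (phi z) x = st_R v x).
  { intros z x J I; destruct (F z J) as [_ [_ F']]; apply F'; insimp; rewrite In_lhs.
    intros [|[[= <-]|[]]]; auto. }
  (* Conversely, an arbitrary run coincides with the polynomial solution by uniqueness; outside the
     left-hand sides the two states can differ in [t] only. *)
  assert (U : forall x, In x (map fst l) -> st_R (phi s) x = st_R (psi s) x).
  { apply ode_unique; trivial.
    - intros z J; pose proof (O z J) as [_ [O2 _]]; exact O2.
    - intros z x J I Ni; rewrite <- V, Out, Out'; auto.
    - intros x I; rewrite <- V, In0; auto. }
  destruct (F s ltac:(lra)) as [FN [FT _]].
  refine (proj1 (coincidence Wp _) K); intros [x|n|h] I.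
  + change (st_R (psi s) x = st_R (phi s) x).
    destruct (in_dec (@sVR_dec Sg) x (map fst l)) as [J|J]; [now rewrite U|].
    rewrite Out, Out'; auto; lra.
  + simpl; now rewrite FN.
  + simpl; now rewrite FT.
Qed.

End Odes.

Theorem theorem1 (Sg : signature) :
  (forall p : fml Sg, axiom p -> wf p -> valid p) /\
  (forall (premises : list (fml Sg)) (conclusion : fml Sg),
     rule premises conclusion ->
     Forall (fun q => wf q) premises -> wf conclusion ->
     Forall (fun q => valid q) premises -> valid conclusion).
Proof.
split.
- intros p [l q A|x q|chi q|a q|a b A C q|a b A C q|a A C q|a A C q|l chi q
    |l ys t q M N S|ch h th h0 q N|ch h th A C q|ch h x A C q M
    |a A A1 A2 C1 C2 q K Cl|a b A C q N|a A C q E|a A C q|a A C1 C2 q1 q2] W.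
  + apply sound_assign; trivial; apply W.
  + apply sound_any.
  + apply sound_test.
  + apply sound_box.
  + apply sound_seq, W.
  + apply sound_choice.
  + apply sound_unfold, W.
  + apply sound_induction, W.
  + apply sound_time.
  + apply sound_solve; trivial; apply W.
  + apply sound_send; trivial; apply W.
  + apply sound_acsend.
  + apply sound_acrecv; trivial; apply W.
  + apply sound_assumption_closure; trivial; simpl in *; tauto.
  + apply sound_par; trivial; apply W.
  + now apply sound_no_com.
  + apply sound_weaken, W.
  + apply sound_and.
- intros premises conclusion [a A1 A2 C1 C2 p1 p2|a A C p] _ _ V.
  + apply Forall_cons_iff in V as [HA V]; apply Forall_cons_iff in V as [HC V].
    apply Forall_cons_iff in V as [Hp _]; intros v.
    exact (sat_FACBox_mono HA HC Hp).
  + apply Forall_cons_iff in V as [H _]; intros v tau w _; split.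
    * intros _; exact (proj1 (H _)).
    * intros _ u _; exact (proj2 (H _)).
Qed.
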